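(* Let $(\tilde\mu_n,h_n,\tau_n)_{n\ge1}$ be a sequence of triples, where $\tilde\mu_n$ is a finite (nonnegative Borel) measure on $[-1,1]$, $h_n$ is a real-valued continuous function on $[-1,1]$, and $\tau_n$ is a polynomial of degree at most $2n$ with real coefficients that does not vanish on $[-1,1]$ and satisfies $\tau_n(0)=1$. Write $$\tau_n(x)=\prod_{i=1}^{2n}\left(1-\frac{x}{a_{n,i}}\right),\qquad a_{n,i}\in\overline{\mathbb C}\setminus[-1,1],$$ where $\{a_{n,1},\dots,a_{n,2n}\}$ is a conjugate-symmetric multi-set and $x/a_{n,i}$ is interpreted as $0$ if $a_{n,i}=\infty$. Assume: (A) there is a finite measure $\mu$ on $[-1,1]$ such that $\limsup_{n\to\infty}\int f\,d\tilde\mu_n\le\int f\,d\mu$ for every nonnegative continuous function $f$ on $[-1,1]$; (B) $\|\log\tilde v_n-\log v\|_{L^1(\omega_{[-1,1]})}\to0$ as $n\to\infty$, where $\tilde v_n$ and $v$ are the Radon–Nikodym derivatives (of the absolutely continuous parts) of $\tilde\mu_n$ and $\mu$ with respect to $\omega_{[-1,1]}$, and $\log \tilde v_n,\log v\in L^1(\omega_{[-1,1]})$; (C) all $h_n$ belong to $\mathcal K$, a fixed compact subset of $C[-1,1]$; (D) $\sum_{i=1}^{2n}(1-|\phi(a_{n,i})|)\to\infty$ as $n\to\infty$. Let $p_n(z)=\gamma_nz^n+\cdots$, $\gamma_n>0$, be the polynomial of degree $n$ satisfying $$\int p_n(x)x^k\,\frac{e^{h_n(x)}d\tilde\mu_n(x)}{\tau_n(x)}=0,\quad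 k\in\{0,\dots,n-1\},\qquad\int p_n^2(x)\,\frac{e^{h_n(x)}d\tilde\mu_n(x)}{\tau_n(x)}=1.$$ Then $$2\widetilde G_n^2(z)\,\frac{p_n^2(z)}{\tau_n(z)}\prod_{j=1}^{2n}\frac{\phi(z)-\phi(a_{n,j})}{1-\overline{\phi(a_{n,j})}\phi(z)}=1+o_{\mathcal K}(1)\qquad\text{as }n\to\infty$$ locally uniformly in $\overline{\mathbb C}\setminus[-1,1]$. In particular, $$\gamma_n^2\,\widetilde G_n^2(\infty)\,2^{1-2n}\prod_{i:\,a_{n,i}\ne\infty}\big(2a_{n,i}\phi(a_{n,i})\big)=1+o_{\mathcal K}(1)\qquad\text{as }n\to\infty.$$
   Context: $d\omega_{[-1,1]}(x)=\dfrac{dx}{\pi\sqrt{1-x^2}}$ on $[-1,1]$. With $w(z)=\sqrt{z^2-1}$, the branch holomorphic in $\mathbb C\setminus[-1,1]$ with $w(z)=z+\mathcal O(1)$ as $z\to\infty$, put $\phi(z)=z-w(z)$: this is the conformal map of $\overline{\mathbb C}\setminus[-1,1]$ onto the unit disk with $\phi(\infty)=0$, $\phi(1)=1$. The Szegő function is $$\widetilde G_n(z)=G(e^{h_n}\tilde\mu_n;z)=\exp\left(\frac{w(z)}2\int_{-1}^1\frac{h_n(x)+\log\tilde v_n(x)}{z-x}\,d\omega_{[-1,1]}(x)\right),\quad z\in\overline{\mathbb C}\setminus[-1,1],$$ so that $\widetilde G_n(\infty)=\exp\big(\tfrac12\int(h_n+\log\tilde v_n)d\omega_{[-1,1]}\big)$.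 Expressions with removable singularities (at $\infty$ and at the $a_{n,j}$) are understood by continuity. $o_{\mathcal K}(1)$ denotes a quantity tending to $0$ as $n\to\infty$ uniformly with respect to the choice of the functions $h_n\in\mathcal K$. *)

(* Defs.v *)
From HB Require Import structures.
From mathcomp Require Import all_boot all_order all_algebra.
From mathcomp Require Import all_classical all_reals all_analysis measurable_realfun.
From mathcomp Require Import complex.

Set Implicit Arguments.
Unset Strict Implicit.
Unset Printing Implicit Defensive.

Import Order.TTheory GRing.Theory Num.Theory.
Import numFieldNormedType.Exports.

Local Open Scope classical_set_scope.
Local Open Scope ring_scope.

(* Naming the structure, rather than writing [R[i]], lets the topology that
   MathComp-Analysis puts on every numFieldType be inferred. *)
Definition Cplx (R : realType) : numClosedFieldType := R[i].

(* The Riemann sphere; [None] is the point at infinity. *)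
Definition Cbar (R : realType) : Type := one_point_compactification (Cplx R).
HB.instance Definition _ (R : realType) := Choice.on (Cbar R).
HB.instance Definition _ (R : realType) := PointedTopological.on (Cbar R).

Section ComplexNumbers.
Variable R : realType.
Local Notation C := (Cplx R).

Definition toC (x : R) : C := real_complex R x.
HB.instance Definition _ := GRing.RMorphism.copy toC (real_complex R).

Definition cmod (z : C) : R := complex.Re `|z|.

Definition cexp (z : C) : C :=
  Complex (expR (complex.Re z) * cos (complex.Im z))
          (expR (complex.Re z) * sin (complex.Im z)).

Definition cintegral (mu : {measure set R -> \bar R}) (D : set R)
    (f : R -> C) : C :=
  Complex (\int[mu]_(x in D) complex.Re (f x))%R
          (\int[mu]_(x in D) complex.Im (f x))%R.

End ComplexNumbers.

Section Arcsine.
Variable R : realType.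

Definition arcsine_pdf (x : R) : R := (pi * Num.sqrt (1 - x ^+ 2))^-1.

Lemma arcsine_pdf_ge0 x : 0 <= arcsine_pdf x.
Proof. by rewrite invr_ge0 mulr_ge0 ?pi_ge0 ?sqrtr_ge0. Qed.

Lemma measurable_arcsine_pdf : measurable_fun setT arcsine_pdf.
Proof.
have minv : measurable_fun setT (@GRing.inv R).
  rewrite -(setvU [set (0 : R)]); apply/measurable_funU => //.
    exact: measurableC.
  split; last exact: measurable_fun_set1.
  apply: open_continuous_measurable_fun.
    by apply: closed_openC; apply: accessible_closed_set1; apply: hausdorff_accessible; exact: Rhausdorff.
  by move=> x; rewrite inE /= => /eqP x0; exact: cvgV.
apply: (measurableT_comp minv); apply: measurable_funM => //.
apply: (measurableT_comp (continuous_measurable_fun (@sqrt_continuous R))).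
by apply: measurable_funB => //; exact: measurable_funX.
Qed.

Definition arcsine (A : set R) : \bar R :=
  (\int[lebesgue_measure]_(x in A `&` `[(-1)%R, 1%R]) (arcsine_pdf x)%:E)%E.

Let arcsine0 : arcsine set0 = 0%E.
Proof. by rewrite /arcsine set0I integral_set0. Qed.

Let arcsine_ge0 A : (0 <= arcsine A)%E.
Proof. by apply: integral_ge0 => x _; rewrite lee_fin arcsine_pdf_ge0. Qed.

Let arcsine_sigma_additive : semi_sigma_additive arcsine.
Proof.
move=> F mF tF mUF; rewrite /arcsine; apply: cvg_toP.
  apply: ereal_nondecreasing_is_cvgn => m n mn.
  apply: lee_sum_nneg_natr => // k _ _; exact: arcsine_ge0.
rewrite setI_bigcupl ge0_integral_bigcup//=.
- by move=> k; apply: measurableI; [exact: mF|exact: measurable_itv].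
- apply/measurable_EFinP; apply: measurable_funS measurable_arcsine_pdf => //.
- by move=> x _; rewrite lee_fin arcsine_pdf_ge0.
- exact: trivIset_setIr.
Qed.

HB.instance Definition _ := isMeasure.Build _ _ _ arcsine
  arcsine0 arcsine_ge0 arcsine_sigma_additive.

End Arcsine.

Section Statement.
Variable R : realType.
Local Notation C := (Cplx R).
Local Notation Cb := (Cbar R).

Definition mutually_singular (mu nu : {measure set R -> \bar R}) : Prop :=
  exists A : set R, [/\ measurable A, mu A = 0%E & nu (~` A) = 0%E].

(* [v] is the density, with respect to [nu], of the absolutely continuous part
   of [mu] in its Lebesgue decomposition. *)
Definition ac_density (mu nu : {measure set R -> \bar R}) (v : R -> R) : Prop :=
  [/\ measurable_fun setT v, forall x, 0 <= v x &
      exists2 s : {measure set R -> \bar R}, mutually_singular s nu &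
        forall A, measurable A ->
          mu A = (s A + \int[nu]_(x in A) (v x)%:E)%E].

(* [ln 0 = 0] in the library, so that positivity has to be required. *)
Definition log_integrable (nu : {measure set R -> \bar R}) (v : R -> R) : Prop :=
  {ae nu, forall x, 0 < v x} /\ nu.-integrable setT (EFin \o (@ln R \o v)).

Definition on_interval (mu : {measure set R -> \bar R}) : Prop :=
  mu (~` `[-1, 1]) = 0%E.

Definition intervalC : set C := @toC R @` `[-1, 1].

Definition slit_sphere : set Cb := ~` (Some @` intervalC).

(* [w] is the branch of sqrt (z^2 - 1) holomorphic off [-1, 1] and such that
   w(z) = z + O(1) at infinity; its values on [-1, 1] are irrelevant. *)
Definition is_w (w : C -> C) : Prop :=
  [/\ forall z, ~ intervalC z -> derivable w z 1,
      forall z, ~ intervalC z -> w z ^+ 2 = z ^+ 2 - 1 &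
      exists M r : R, forall z, r < cmod z -> cmod (w z - z) <= M].

Definition phi (w : C -> C) (p : Cb) : C :=
  if p is Some z then z - w z else 0.

(* The value at [p] of an expression [f], extended by continuity to infinity
   and to the points listed in [s]. *)
Definition by_continuity (s : seq Cb) (f : C -> C) (p : Cb) : C :=
  if p is Some z then
    if p \in s then lim (f x @[x --> z^']) else f z
  else lim (oapp f 0 q @[q --> (p : Cb)^']).

Definition szego (w : C -> C) (h v : R -> R) : Cb -> C :=
  by_continuity [::] (fun z =>
    cexp (w z / 2 *
      cintegral (@arcsine R) `[-1, 1]
        (fun x => toC (h x + ln (v x)) / (z - toC x)))).

(* [tau] is the product of the 1 - x / a_i, where x / infinity is 0. *)
Definition denominator (n : nat) (tau : {poly R}) (a : seq Cb) : Prop :=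
  [/\ (size tau <= (2 * n).+1)%N,
      forall x, x \in `[-1, 1] -> tau.[x] != 0,
      tau.[0] = 1 &
  [/\ forall b, b \in a -> slit_sphere b,
      perm_eq (map (omap (@Num.conj C)) a : seq Cb) a &
      map_poly (@toC R) tau =
        \prod_(b <- a) (1 - (if b is Some c then c^-1 else 0) *: 'X)]].

Definition orthonormal_poly (n : nat) (mu : {measure set R -> \bar R})
    (h : R -> R) (tau p : {poly R}) : Prop :=
  [/\ size p = n.+1, 0 < lead_coef p,
      forall k, (k < n)%N ->
        (\int[mu]_(x in `[(-1)%R, 1%R])
           (p.[x] * x ^+ k * (expR (h x) / tau.[x]))%:E = 0)%E &
      (\int[mu]_(x in `[(-1)%R, 1%R])
         (p.[x] ^+ 2 * (expR (h x) / tau.[x]))%:E = 1)%E].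

Definition asymptotic_lhs (w : C -> C) (h v : R -> R) (tau p : {poly R})
    (a : seq Cb) : Cb -> C :=
  by_continuity a (fun z =>
    2 * szego w h v (Some z) ^+ 2
      * ((map_poly (@toC R) p).[z] ^+ 2 / (map_poly (@toC R) tau).[z])
      * \prod_(b <- a) ((phi w (Some z) - phi w b) /
                        (1 - (phi w b)^* * phi w (Some z)))).

Definition leading_lhs (n : nat) (w : C -> C) (h v : R -> R) (p : {poly R})
    (a : seq Cb) : C :=
  toC (lead_coef p) ^+ 2 * szego w h v None ^+ 2 * 2 ^ (1 - (2 * n)%:Z)
    * \prod_(c <- pmap id a) (2 * c * phi w (Some c)).

End Statement.

(* Main.v *)
(* With [zeta = phi z], [b_j = phi a_j] and [D zeta = \prod_j (1 - b_j zeta)],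
   the left-hand side of the asymptotics is
     [2 kap exp (S zeta) P(zeta)^2 / D(zeta)^2],
   where [S] is the Schwarz integral of [h + log v], [P] is the reciprocal
   polynomial [zeta^n p ((zeta + 1/zeta) / 2)] and [tau = |D|^2 / kap] on the unit
   circle. If [h + log v] is replaced by a polynomial [U] close to it, this is the
   square of a function [F] of the disk algebra with [|F|^2 = 2 e^U p^2 / tau] on
   the circle, so that [|F|^2] has mean close to 2, and with
   [F u = ph u * conj (F u)] there, where the unimodular phase [ph] is a Blaschke
   product of the [b_j] times a factor depending on [U] only. Condition (D) makes
   every Fourier coefficient [mean (ph u * conj (u)^k)], [k >= 0], small, hence
     [mean |F - 1 - ph|^2 = mean |F|^2 + 2 - 4 F 0 + 2 Re (mean ph)]
   is small as soon as [F 0 >= 1 - o(1)], and the Cauchy integral of [F - 1] then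
   gives [F = 1 + o(1)] inside the disk.
   The lower bound on [F 0] is the extremal property of the leading coefficient,
   tested on a polynomial built from an interpolant of [D / G], where [G] is the
   outer function with [|G|^2 = e^U] on the circle. The singular
   parts of the measures are harmless there by (A) and (B), applied to a polynomial
   [V] with [\int |log v - V| d omega] small and [\int e^(- V) d mu <= 1 + o(1)].
   Uniformity in [h] comes from the compactness of [K]. *)
Require Import Defs.
From HB Require Import structures.
From mathcomp Require Import all_boot all_order all_algebra.
From mathcomp Require Import all_classical all_reals all_analysis measurable_realfun.
From mathcomp Require Import complex ring lra zify.
Set Implicit Arguments.
Unset Strict Implicit.
Unset Printing Implicit Defensive.
Import Order.TTheory GRing.Theory Num.Theory.
Import numFieldNormedType.Exports.
Local Open Scope classical_set_scope.
Local Open Scope ring_scope.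


(** * Modulus, real and imaginary parts of complex numbers *)

Section Modulus.
Variable R : realType.
Local Notation C := (Cplx R).
Implicit Types (z u v : C) (x y : R).

(** The logarithm of the weight is known only in [L^1], so its outer function need not belong to the
    disk algebra. A polynomial [U] equals [2 Re g] on the circle for a polynomial [g], and [exp g]
    does belong to it. The price: [U] is close to [h + log v] only in [L^1], whereas [p^2 / tau] has
    no bound uniform in [n], so where [U] is too large [mean |F|^2] is out of control. The cure is
    to subtract from [U] a nonnegative polynomial [t] close to the positive part of [U - h - log v].
    Only the mean of [t] is small, and [t] depends on [n] and [p]; hence the threshold taken from
    (D) may depend on [U] but not on [t], and the effect of [t] on the phase is estimated in mean,
    through [|e^(- th)| <= 1] on the circle, where [t = 2 Re th]. The lower bound on [F 0] needs the
    opposite precaution, [h + V <= U] at every point, because it integrates against measures with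
    singular parts. No measure on the circle is constructed: a mean over it is an arcsine integral
    of averages over two conjugate points, and Cauchy's formula is proved for polynomials by
    algebra. *)

Lemma cnormE z : `|z| = toC (cmod z).
Proof. by rewrite /cmod normc_def. Qed.

Lemma cmodE z : cmod z = Num.sqrt (complex.Re z ^+ 2 + complex.Im z ^+ 2).
Proof. by rewrite /cmod normc_def. Qed.

Lemma cmod_sqr z : cmod z ^+ 2 = complex.Re z ^+ 2 + complex.Im z ^+ 2.
Proof. by rewrite cmodE sqr_sqrtr// addr_ge0 ?sqr_ge0. Qed.

Lemma cmod_ge0 z : 0 <= cmod z.
Proof. by rewrite cmodE sqrtr_ge0. Qed.

Lemma toC_inj : injective (@toC R).
Proof. by move=> x y []. Qed.

Lemma cmodM u v : cmod (u * v) = cmod u * cmod v.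
Proof. by apply: toC_inj; rewrite rmorphM -!cnormE normrM. Qed.

Lemma cmod_toC x : cmod (toC x) = `|x|.
Proof. by rewrite cmodE /= expr0n addr0 sqrtr_sqr. Qed.

Lemma cmod0 : cmod (0 : C) = 0.
Proof. by rewrite -(rmorph0 (@toC R)) cmod_toC normr0. Qed.

Lemma cmod1 : cmod (1 : C) = 1.
Proof. by rewrite -(rmorph1 (@toC R)) cmod_toC normr1. Qed.

Lemma cmod_eq0 z : (cmod z == 0) = (z == 0).
Proof. by rewrite -(inj_eq toC_inj) -cnormE rmorph0 normr_eq0. Qed.

Lemma cmod_gt0 z : (0 < cmod z) = (z != 0).
Proof. by rewrite lt_neqAle cmod_ge0 andbT eq_sym cmod_eq0. Qed.

Lemma cmodN z : cmod (- z) = cmod z.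
Proof. by rewrite /cmod normrN. Qed.

Lemma cmodD u v : cmod (u + v) <= cmod u + cmod v.
Proof.
have := ler_normD u v.
by rewrite !cnormE -rmorphD /toC lecR.
Qed.

Lemma cmodB u v : cmod (u - v) <= cmod u + cmod v.
Proof. by rewrite -[cmod v]cmodN cmodD. Qed.

Lemma cmodBC u v : cmod (u - v) = cmod (v - u).
Proof. by rewrite -cmodN opprB. Qed.

Lemma cmod_dist u v : cmod u <= cmod v + cmod (u - v).
Proof. by have := cmodD v (u - v); rewrite addrC subrK. Qed.

Lemma cmod_tri u v t : cmod (u - t) <= cmod (u - v) + cmod (v - t).
Proof. by have := cmodD (u - v) (v - t); rewrite addrA subrK. Qed.

Lemma cmodV z : cmod z^-1 = (cmod z)^-1.
Proof. by apply: toC_inj; rewrite fmorphV -!cnormE normfV. Qed.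

Lemma cmodX z n : cmod (z ^+ n) = cmod z ^+ n.
Proof. by apply: toC_inj; rewrite rmorphXn -!cnormE normrX. Qed.

Lemma cmod_prod (I : Type) (s : seq I) (F : I -> C) :
  cmod (\prod_(i <- s) F i) = \prod_(i <- s) cmod (F i).
Proof. by elim/big_rec2: _ => [|i x y _ <-]; rewrite ?cmod1 ?cmodM. Qed.

Lemma cmod_sum (I : Type) (s : seq I) (P : pred I) (F : I -> C) :
  cmod (\sum_(i <- s | P i) F i) <= \sum_(i <- s | P i) cmod (F i).
Proof.
elim/big_rec2: _ => [|i x y _ le]; first by rewrite cmod0.
by apply: le_trans (cmodD _ _) _; rewrite lerD2l.
Qed.

Lemma conjCE z : z^* = Complex (complex.Re z) (- complex.Im z).
Proof. by case: z. Qed.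

Lemma conj_toC x : (toC x)^* = toC x.
Proof. by rewrite conjCE /= oppr0. Qed.

Lemma cmod_conj z : cmod z^* = cmod z.
Proof. by rewrite conjCE !cmodE /= sqrrN. Qed.

Lemma mul_conj z : z * z^* = toC (cmod z ^+ 2).
Proof. by rewrite rmorphXn /= -cnormE normCK. Qed.

Lemma conj_circle z : cmod z = 1 -> z^* = z^-1.
Proof.
move=> z1; have z0 : z != 0 by rewrite -cmod_gt0 z1.
by apply: (mulfI z0); rewrite divff// mul_conj z1 expr1n.
Qed.

Lemma circle_neq0 z : cmod z = 1 -> z != 0.
Proof. by move=> z1; rewrite -cmod_gt0 z1. Qed.

Lemma ReD u v : complex.Re (u + v) = complex.Re u + complex.Re v.
Proof. by case: u v => [a b] [c d]. Qed.
Lemma ImD u v : complex.Im (u + v) = complex.Im u + complex.Im v.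
Proof. by case: u v => [a b] [c d]. Qed.
Lemma ReN u : complex.Re (- u) = - complex.Re u.
Proof. by case: u. Qed.
Lemma ImN u : complex.Im (- u) = - complex.Im u.
Proof. by case: u. Qed.
Lemma ReM u v : complex.Re (u * v)
  = complex.Re u * complex.Re v - complex.Im u * complex.Im v.
Proof. by case: u v => [a b] [c d]. Qed.
Lemma ImM u v : complex.Im (u * v)
  = complex.Re u * complex.Im v + complex.Im u * complex.Re v.
Proof. by case: u v => [a b] [c d]. Qed.
Lemma Re_conj u : complex.Re u^* = complex.Re u.
Proof. by rewrite conjCE. Qed.
Lemma Im_conj u : complex.Im u^* = - complex.Im u.
Proof. by rewrite conjCE. Qed.
Lemma Re_toC x : complex.Re (toC x) = x. Proof. by []. Qed.
Lemma Im_toC x : complex.Im (toC x) = 0. Proof. by []. Qed.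
Definition ReImE := (ReD, ImD, ReN, ImN, ReM, ImM, Re_conj, Im_conj, Re_toC, Im_toC).

Lemma complex_ext u v :
  complex.Re u = complex.Re v -> complex.Im u = complex.Im v -> u = v.
Proof. by case: u v => [a b] [c d] /= -> ->. Qed.

Lemma Re_le_cmod z : `|complex.Re z| <= cmod z.
Proof.
rewrite -[X in X <= _]ger0_norm ?normr_ge0// -[cmod z]ger0_norm ?cmod_ge0//.
by rewrite -ler_sqr ?nnegrE ?normr_ge0// ?sqr_normr !real_normK ?num_real// cmod_sqr lerDl sqr_ge0.
Qed.

Lemma Im_le_cmod z : `|complex.Im z| <= cmod z.
Proof.
rewrite -[X in X <= _]ger0_norm ?normr_ge0// -[cmod z]ger0_norm ?cmod_ge0//.
by rewrite -ler_sqr ?nnegrE ?normr_ge0// ?sqr_normr !real_normK ?num_real// cmod_sqr lerDr sqr_ge0.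
Qed.

Lemma cmod_le_ReIm z : cmod z <= `|complex.Re z| + `|complex.Im z|.
Proof.
rewrite -ler_sqr ?nnegrE ?addr_ge0 ?cmod_ge0 ?normr_ge0//.
rewrite cmod_sqr sqrrD !real_normK ?num_real//.
have := mulr_ge0 (normr_ge0 (complex.Re z)) (normr_ge0 (complex.Im z)); lra.
Qed.

Lemma toC_nat n : toC (n%:R : R) = n%:R.
Proof. by rewrite rmorph_nat. Qed.

Lemma ball_cmod z (e : R) u : ball z (toC e) u <-> cmod (z - u) < e.
Proof. by rewrite /ball /= cnormE /toC ltcR. Qed.

Lemma posC (d : C) : 0 < d -> exists2 e : R, 0 < e & d = toC e.
Proof. by case: d => a b; rewrite ltcE /= => /andP[/eqP -> a0]; exists a. Qed.

Lemma nbhs_cmodP z (A : set C) :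
  nbhs z A <-> exists2 e : R, 0 < e & forall u, cmod (u - z) < e -> A u.
Proof.
split.
  move=> /nbhs_ballP[d /= /posC[e e0 ->]] H; exists e => // u uz; apply: H.
  by apply/ball_cmod; rewrite cmodBC.
move=> [e e0 H]; apply/nbhs_ballP; exists (toC e) => /=; first by rewrite /toC ltcR.
by move=> u /ball_cmod uz; apply: H; rewrite cmodBC.
Qed.

Lemma cvg_cmodP (T : Type) (F : set_system T) {FF : Filter F} (f : T -> C) (l : C) :
  (f x @[x --> F] --> l) <-> forall e : R, 0 < e -> \forall x \near F, cmod (f x - l) < e.
Proof.
split.
  move=> H e e0; have : nbhs l (fun u => cmod (u - l) < e).
    by apply/nbhs_cmodP; exists e.
  by move=> /H.
move=> H A /nbhs_cmodP[e e0 He]; apply: filterS (H e e0) => x; exact: He.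
Qed.

Lemma ccontinuous_atP (f : C -> C) z : {for z, continuous f} <->
  forall e : R, 0 < e -> exists2 d : R, 0 < d &
    forall u, cmod (u - z) < d -> cmod (f u - f z) < e.
Proof.
split=> [cf e e0|H A /nbhs_cmodP[e e0 He]].
  exact: (iffLR (nbhs_cmodP _ _) (iffLR (@cvg_cmodP _ (nbhs z) _ f (f z)) cf e e0)).
have [d d0 Hd] := H e e0; apply/nbhs_cmodP; exists d => // u uz.
by apply: He; exact: Hd.
Qed.

Lemma rcontinuous_atP (f : C -> R) z : {for z, continuous f} <->
  forall e : R, 0 < e -> exists2 d : R, 0 < d &
    forall u, cmod (u - z) < d -> `|f u - f z| < e.
Proof.
split=> [cf e e0|H A /nbhs_ballP[e /= e0 He]].
  have /cf : nbhs (f z) (ball (f z) e) by exact: nbhsx_ballx.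
  by move=> /(iffLR (nbhs_cmodP _ _))[d d0 Hd]; exists d => // u /Hd; rewrite /ball /= distrC.
have [d d0 Hd] := H e e0; apply/nbhs_cmodP; exists d => // u uz.
by apply: He; rewrite /ball /= distrC; exact: Hd.
Qed.

End Modulus.


(** * Bernstein polynomials and the Weierstrass theorem on [[-1, 1]] *)

Section Weierstrass.
Variable R : realType.
Implicit Types (x : R) (g : nat -> R).

(* At [x] this is the expectation of [g (s + B)], with [B] binomial of
   parameters [n] and [x]; [bernstein n g 0] is a Bernstein polynomial. *)
Fixpoint bernstein n g s : {poly R} :=
  if n is m.+1 then 'X * bernstein m g s.+1 + (1 - 'X) * bernstein m g s
  else (g s)%:P.

Lemma bernsteinS n g s x : (bernstein n.+1 g s).[x] =
  x * (bernstein n g s.+1).[x] + (1 - x) * (bernstein n g s).[x].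
Proof. by rewrite /= !hornerE. Qed.

Lemma le_bernstein n g1 g2 s x : 0 <= x <= 1 ->
  (forall k, (s <= k <= s + n)%N -> g1 k <= g2 k) ->
  (bernstein n g1 s).[x] <= (bernstein n g2 s).[x].
Proof.
move=> x01; elim: n s => [|n IH] s le12.
  by rewrite /= !hornerC le12// addn0 leqnn.
rewrite !bernsteinS lerD// ler_wpM2l ?IH//; [lra| |lra|] => k /andP[k1 k2].
  by rewrite le12// (ltnW k1) addnS -addSn.
by rewrite le12// k1 addnS ltnW.
Qed.

(** The mean [n x] and the variance [n x (1 - x)] of the binomial law, read off the recursion;
    Bernstein's argument uses no other moments. *)
Lemma bernstein_quadratic n (a b c : R) s x :
  (bernstein n (fun k => a + b * (k%:R - c) ^+ 2) s).[x] =
  a + b * ((s%:R + n%:R * x - c) ^+ 2 + n%:R * (x * (1 - x))).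
Proof.
elim: n s => [|n IH] s; first by rewrite /= hornerC; ring.
rewrite bernsteinS !IH -!natr1; ring.
Qed.

Lemma segment_unif_continuous (f : R -> R) : {within `[-1, 1], continuous f} ->
  forall e : R, 0 < e -> exists2 d : R, 0 < d & forall x y : R, x \in `[-1, 1] ->
    y \in `[-1, 1] -> `|x - y| < d -> `|f x - f y| < e.
Proof.
move=> cf e e0.
have /compact_near_coveringP/near_covering_withinP cov := @segment_compact R (-1) 1.
have covd : \forall d \near (0 : R)^'+, `[(-1 : R), 1] `<=`
    (fun x : R => forall y : R, y \in `[-1, 1] -> `|x - y| < d -> `|f x - f y| < e).
  apply: cov => x xI.
  have /cvgrPdist_lt/(_ (e / 2)) := cf x.
  rewrite divr_gt0// => /(_ isT); rewrite /nbhs /= -nbhs_subspace_in//.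
  rewrite /within /= => -[r /= r0 xr].
  near=> y d => /= yI z zI yz.
  have := xr y; have := xr z; rewrite /ball /= => Hz Hy.
  have xy : `|x - y| < r / 2 by near: y; exists (r / 2) => //=; rewrite divr_gt0.
  have dr : d < r / 2 by near: d; apply: nbhs_right_lt; rewrite divr_gt0.
  have xz : `|x - z| < r.
    have := ler_normD (x - y) (y - z); rewrite addrA subrK; lra.
  have {Hz} : `|f x - f z| < e / 2 by apply: Hz.
  have {Hy} : `|f x - f y| < e / 2 by apply: Hy => //; lra.
  have := ler_normD (f y - f x) (f x - f z); rewrite addrA subrK (distrC (f y) (f x)); lra.
near (0 : R)^'+ => d; exists d.
  by near: d; exact: nbhs_right_gt.
move=> x y xI; apply: (near covd d) => //.
Unshelve. all: by end_near.
Qed.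

Lemma segment_bounded (f : R -> R) : {within `[-1, 1], continuous f} ->
  exists2 M : R, 0 < M & forall x : R, x \in `[-1, 1] -> `|f x| <= M.
Proof.
move=> cf; have /compact_bounded[M [_ HM]] :=
  continuous_compact cf (@segment_compact R (-1) 1).
exists (`|M| + 1); first by rewrite ltr_pwDr.
move=> x xI; apply: (HM (`|M| + 1)); first by rewrite ltr_pwDr// ler_norm.
by exists x.
Qed.

(** Bernstein's proof with Chebyshev's inequality replaced by a pointwise majorant: [|f x - g k|] is
    at most [e / 2] plus a multiple of [(k - n y)^2], and the monotone operator [bernstein] turns
    the square into the variance, which is at most [n]. *)
Theorem weierstrass (f : R -> R) : {within `[-1, 1], continuous f} ->
  forall e : R, 0 < e ->
  exists p : {poly R}, forall x : R, x \in `[-1, 1] -> `|f x - p.[x]| <= e.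
Proof.
move=> cf e e0.
have [d d0 Hd] := segment_unif_continuous cf (divr_gt0 e0 (ltr0n R 2)).
have [M M0 HM] := segment_bounded cf.
(* With [t = 2 k / n - 1] one has [t - x = 2 (k - n y) / n]; the factor 8 makes the quadratic term
   equal to [2 M (t - x)^2 / d^2], which is at least the oscillation [2 M] of [f] once
   [|t - x| >= d]. *)
pose b := 8 * M / d ^+ 2.
have b0 : 0 < b by rewrite divr_gt0 ?exprn_gt0// mulr_gt0.
have [n0 Hn0] : exists n, 2 * b / e < n.+1%:R.
  exists (Num.truncn (2 * b / e)); exact: truncnS_gt.
set n := n0.+1 in Hn0.
pose g k := f (2 * k%:R / n%:R - 1).
have nR0 : (0 : R) < n%:R by rewrite ltr0n.
have gI k : (k <= n)%N -> 2 * k%:R / n%:R - 1 \in `[-1 : R, 1].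
  move=> kn; rewrite in_itv /=; have : k%:R / n%:R <= 1 :> R.
    by rewrite ler_pdivrMr// mul1r ler_nat.
  have : 0 <= k%:R / n%:R :> R by rewrite divr_ge0.
  by rewrite -mulrA; lra.
exists (bernstein n g 0 \Po (2^-1 *: ('X + 1))) => x xI.
rewrite horner_comp.
set y := (X in `|_ - _.[X]|).
have yE : y = 2^-1 * (x + 1) by rewrite /y !hornerE.
have xI' := xI; rewrite in_itv /= in xI'.
have y01 : 0 <= y <= 1 by rewrite yE; lra.
have xy : x = 2 * y - 1 by rewrite yE; lra.
have key k : (0 <= k <= 0 + n)%N ->
    `|f x - g k| <= e / 2 + b / n%:R ^+ 2 * (k%:R - n%:R * y) ^+ 2.
  move=> /andP[_ kn]; pose t : R := 2 * k%:R / n%:R - 1.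
  have tx : t - x = 2 / n%:R * (k%:R - n%:R * y).
    by rewrite /t xy; field; rewrite lt0r_neq0.
  have -> : b / n%:R ^+ 2 * (k%:R - n%:R * y) ^+ 2 = 2 * M / d ^+ 2 * (t - x) ^+ 2.
    by rewrite tx /b; field; rewrite !lt0r_neq0.
  have [xt|xt] := ltP `|x - t| d.
    have /ltW h := Hd _ _ xI (gI k kn) xt; apply: le_trans h _.
    by rewrite lerDl mulr_ge0 ?sqr_ge0// divr_ge0 ?sqr_ge0// mulr_ge0// ltW.
  have h1 := ler_normB (f x) (g k); have h2 := HM x xI; have h3 := HM _ (gI k kn).
  suff : 2 * M <= 2 * M / d ^+ 2 * (t - x) ^+ 2 by rewrite /g in h1 *; lra.
  rewrite -mulrA ler_peMr ?mulr_ge0 ?(ltW M0)// mulrC ler_pdivlMr ?exprn_gt0//.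
  rewrite mul1r -[leRHS]real_normK ?num_real// distrC.
  by rewrite ler_sqr ?nnegrE ?normr_ge0 ?(ltW d0).
have bq a c : (bernstein n (fun k => a + c * (k%:R - n%:R * y) ^+ 2) 0).[y] =
    a + c * (n%:R * (y * (1 - y))) :> R.
  by rewrite bernstein_quadratic; ring.
have c0 : (bernstein n (fun k => f x + e / 2 + b / n%:R ^+ 2 * (k%:R - n%:R * y) ^+ 2) 0).[y]
    <= f x + e.
  rewrite bq.
  have : y * (1 - y) <= 1 by nra.
  have yy0 : 0 <= y * (1 - y) by nra.
  move=> yy1; have -> : b / n%:R ^+ 2 * (n%:R * (y * (1 - y))) = b / n%:R * (y * (1 - y)).
    by field; rewrite lt0r_neq0.
  have bn : b / n%:R <= e / 2.
    rewrite ler_pdivrMr//; move: Hn0; rewrite ltr_pdivrMr//; lra.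
  have : b / n%:R * (y * (1 - y)) <= e / 2 * 1.
    by apply: ler_pM => //; rewrite divr_ge0 ?ltW.
  lra.
have c1 : (bernstein n (fun k => f x - e / 2 + (- (b / n%:R ^+ 2)) * (k%:R - n%:R * y) ^+ 2) 0).[y]
    >= f x - e.
  move: c0; rewrite !bq; lra.
have u : (bernstein n g 0).[y] <= f x + e.
  apply: le_trans c0; apply: le_bernstein => // k /key.
  by rewrite ler_distlC => /andP[h1 h2]; cbv beta; lra.
have l : f x - e <= (bernstein n g 0).[y].
  apply: le_trans c1 _; apply: le_bernstein => // k /key.
  by rewrite ler_distlC => /andP[h1 h2]; cbv beta; lra.
by rewrite ler_distlC; apply/andP; split; [exact: l|exact: u].
Qed.

End Weierstrass.


(** * Integrals over [[-1, 1]] and approximation by polynomials in [L^1] *)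

Section Integration.
Variable R : realType.
Variable mu : {measure set R -> \bar R}.
Local Notation I := (`[(-1)%R, 1%R]%classic : set R).
Implicit Types f g : R -> R.

Definition intg f := mu.-integrable I (EFin \o f).
Definition rint f : R := (\int[mu]_(x in I) f x)%R.

Lemma measI : measurable I. Proof. exact: measurable_itv. Qed.
Hint Resolve measI : core.

Lemma intgD f g : intg f -> intg g -> intg (fun x => f x + g x).
Proof.
move=> hf hg; rewrite /intg.
have -> : EFin \o (fun x => f x + g x) = (fun x => (f x)%:E + (g x)%:E)%E by [].
exact: integrableD.
Qed.

Lemma intgZ c f : intg f -> intg (fun x => c * f x).
Proof. by move=> hf; apply: (integrableZl measI c hf). Qed.

Lemma eq_intg f g : {in I, f =1 g} -> intg f -> intg g.
Proof.
by move=> fg; apply: eq_integrable => // x xI; rewrite /= fg.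
Qed.

Lemma eq_rint f g : {in I, f =1 g} -> rint f = rint g.
Proof. exact: eq_Rintegral. Qed.

Lemma intgN f : intg f -> intg (fun x => - f x).
Proof. by move=> /(intgZ (-1)); apply: eq_intg => x _; rewrite mulN1r. Qed.

Lemma intgB f g : intg f -> intg g -> intg (fun x => f x - g x).
Proof. by move=> hf /intgN hg; exact: intgD. Qed.

Lemma intg_norm f : intg f -> intg (fun x => `|f x|).
Proof. by move=> hf; apply: (integrable_norm hf). Qed.

Lemma intg_measurable f : intg f -> measurable_fun I f.
Proof. by move=> /integrableP[/measurable_EFinP]. Qed.

Lemma intg_le f g : measurable_fun I f -> intg g ->
  (forall x, I x -> `|f x| <= g x) -> intg f.
Proof.
move=> mf hg fg; apply: (le_integrable measI _ _ hg).
  exact/measurable_EFinP.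
by move=> x xI /=; rewrite lee_fin (le_trans (fg _ xI))// ler_norm.
Qed.

Lemma rintD f g : intg f -> intg g -> rint (fun x => f x + g x) = rint f + rint g.
Proof. exact: RintegralD. Qed.

Lemma rintB f g : intg f -> intg g -> rint (fun x => f x - g x) = rint f - rint g.
Proof. exact: RintegralB. Qed.

Lemma rintZ c f : intg f -> rint (fun x => c * f x) = c * rint f.
Proof. exact: RintegralZl. Qed.

Lemma le_rint f g : intg f -> intg g -> (forall x, I x -> f x <= g x) ->
  rint f <= rint g.
Proof. exact: le_Rintegral. Qed.

Lemma rint_ge0 f : (forall x, I x -> 0 <= f x) -> 0 <= rint f.
Proof. exact: Rintegral_ge0. Qed.

Lemma le_abs_rint f : intg f -> `|rint f| <= rint (fun x => `|f x|).
Proof. exact: le_normr_Rintegral. Qed.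

Lemma rintE f : intg f -> (rint f)%:E = (\int[mu]_(x in I) (f x)%:E)%E.
Proof. by move=> hf; rewrite /rint /Rintegral fineK//; exact: integrable_fin_num. Qed.

Lemma ae_le_rint f g : intg f -> intg g -> {ae mu, forall x, I x -> f x <= g x} ->
  rint f <= rint g.
Proof.
move=> hf hg fg; rewrite -subr_ge0 -rintB//; apply: fine_ge0.
have mgf : measurable_fun I (fun x => (g x - f x)%:E).
  by apply/measurable_EFinP; apply: intg_measurable; exact: intgB.
(* Passing to the positive part turns the almost everywhere inequality into one at every point
   without changing the integral. *)
have -> : (\int[mu]_(x in I) (g x - f x)%:E = \int[mu]_(x in I) (Num.max 0 (g x - f x))%:E)%E.
  apply: ae_eq_integral => //.
    apply/measurable_EFinP; apply: measurable_maxr => //.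
    exact/measurable_EFinP.
  apply: filterS fg => x H xI; have := H xI; rewrite -subr_ge0 => h.
  by rewrite max_r.
by apply: integral_ge0 => x _; rewrite lee_fin le_max lexx.
Qed.

Hypothesis mu_fin : (mu I < +oo)%E.

Lemma intg_bounded f (M : R) : measurable_fun I f -> (forall x, I x -> `|f x| <= M) ->
  intg f.
Proof.
move=> mf fM; apply: measurable_bounded_integrable => //.
exists M; split; first exact: num_real.
by move=> y My x xI; apply: le_trans (fM _ xI) (ltW My).
Qed.

Lemma intg_cst c : intg (fun=> c).
Proof. by apply: (@intg_bounded _ `|c|) => //. Qed.

Lemma cont_measurable f : {within I, continuous f} -> measurable_fun I f.
Proof. exact: subspace_continuous_measurable_fun. Qed.

Lemma intg_cont f : {within I, continuous f} -> intg f.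
Proof.
move=> cf; have [M _ HM] := segment_bounded cf.
by apply: (@intg_bounded f M) => //; exact: cont_measurable.
Qed.

Lemma cont_horner (p : {poly R}) : {within I, continuous (horner p)}.
Proof. by apply: continuous_subspaceT => x; exact: continuous_horner. Qed.

Lemma intg_poly (p : {poly R}) : intg (horner p).
Proof. by apply: intg_cont; exact: cont_horner. Qed.

Lemma rint_le_cst f (M : R) : intg f -> (forall x, I x -> f x <= M) ->
  rint f <= M * fine (mu I).
Proof.
move=> hf fM; rewrite -Rintegral_cst//; apply: le_rint => //; exact: intg_cst.
Qed.

(** The [L^1] closure of the polynomials. Integrability is included because [rint] gives [0] to a
    nonnegative function of infinite integral, so that a small [rint] alone says nothing. *)
Definition L1_poly f := intg f /\ forall e : R, 0 < e ->
  exists p : {poly R}, rint (fun x => `|f x - p.[x]|) <= e.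

Lemma L1_dist f g h : intg f -> intg g -> intg h ->
  rint (fun x => `|f x - h x|) <=
  rint (fun x => `|f x - g x|) + rint (fun x => `|g x - h x|).
Proof.
move=> hf hg hh; rewrite -rintD; last 2 first.
- by apply: intg_norm; exact: intgB.
- by apply: intg_norm; exact: intgB.
apply: le_rint.
- by apply: intg_norm; exact: intgB.
- by apply: intgD; apply: intg_norm; exact: intgB.
- by move=> x _; have := ler_normD (f x - g x) (g x - h x); rewrite addrA subrK.
Qed.

Lemma L1_poly_lim f : intg f -> (forall e : R, 0 < e ->
  exists2 g, L1_poly g & rint (fun x => `|f x - g x|) <= e) -> L1_poly f.
Proof.
move=> hf H; split=> // e e0.
have [g [hg Hg] fg] := H _ (divr_gt0 e0 (ltr0n R 2)).
have [p gp] := Hg _ (divr_gt0 e0 (ltr0n R 2)).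
exists p; apply: le_trans (L1_dist hf hg (intg_poly p)) _; lra.
Qed.

Lemma L1_polyD f g : L1_poly f -> L1_poly g -> L1_poly (fun x => f x + g x).
Proof.
move=> [hf Hf] [hg Hg]; split; first exact: intgD.
move=> e e0; have [p fp] := Hf _ (divr_gt0 e0 (ltr0n R 2)).
have [q gq] := Hg _ (divr_gt0 e0 (ltr0n R 2)).
exists (p + q); apply: (@le_trans _ _
    (rint (fun x => `|f x - p.[x]| + `|g x - q.[x]|))).
  apply: le_rint => [||x _].
  - by apply: intg_norm; apply: intgB; [exact: intgD|exact: intg_poly].
  - by apply: intgD; apply: intg_norm; apply: intgB => //; exact: intg_poly.
  - by rewrite hornerD opprD addrACA ler_normD.
rewrite rintD; [lra| |]; by apply: intg_norm; apply: intgB => //; exact: intg_poly.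
Qed.

Lemma L1_polyZ c f : L1_poly f -> L1_poly (fun x => c * f x).
Proof.
move=> [hf Hf]; split; first exact: intgZ.
move=> e e0; have c0 : 0 < `|c| + 1 by rewrite ltr_pwDr.
have [p fp] := Hf _ (divr_gt0 e0 c0).
exists (c *: p).
rewrite (@eq_rint _ (fun x => `|c| * `|f x - p.[x]|)); last first.
  by move=> x _; rewrite hornerZ -mulrBr normrM.
rewrite rintZ; last by apply: intg_norm; apply: intgB => //; exact: intg_poly.
rewrite ler_pdivlMr// in fp; apply: le_trans fp; rewrite mulrC ler_wpM2l//.
  exact: rint_ge0.
by rewrite lerDl.
Qed.

Lemma L1_poly_cont f : {within I, continuous f} -> L1_poly f.
Proof.
move=> cf; split; first exact: intg_cont.
move=> e e0; pose m := fine (mu I) + 1.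
have m0 : 0 < m by rewrite ltr_pwDr// fine_ge0.
have [p Hp] := weierstrass cf (divr_gt0 e0 m0).
exists p; apply: le_trans (rint_le_cst _ (M := e / m) _) _.
- by apply: intg_norm; apply: intgB; [exact: intg_cont|exact: intg_poly].
- by move=> x xI; exact: Hp.
- by rewrite mulrAC ler_pdivrMr// ler_wpM2l ?(ltW e0)// lerDl.
Qed.

Lemma L1_poly_cst c : L1_poly (fun=> c).
Proof. by apply: L1_poly_cont; apply: continuous_subspaceT => x; exact: cst_continuous. Qed.

Lemma L1_poly_ext f g : {in I, f =1 g} -> L1_poly f -> L1_poly g.
Proof.
move=> fg [hf Hf]; split; first exact: eq_intg hf.
move=> e /Hf[p Hp]; exists p; rewrite (@eq_rint _ (fun x => `|f x - p.[x]|))//.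
by move=> x xI; rewrite fg.
Qed.

(** Bounded convergence makes the [L^1] distances tend to [0]; this stability is what a Dynkin class
    argument requires. *)
Lemma L1_poly_dominated (u : nat -> R -> R) f (M : R) :
  (forall n, L1_poly (u n)) -> measurable_fun I f ->
  (forall n x, I x -> `|u n x| <= M) ->
  (forall x, I x -> u n x @[n --> \oo] --> f x) -> L1_poly f.
Proof.
move=> Hu mf uM uf.
have mu_ n : measurable_fun I (EFin \o u n).
  by apply/measurable_EFinP; apply: intg_measurable; case: (Hu n).
have [] := @dominated_convergence _ _ _ mu I measI (fun n => EFin \o u n)
   (EFin \o f) (fun=> M%:E) mu_.
- exact/measurable_EFinP.
- by apply: aeW => x xI; apply/fine_cvgP; split; [exact: nearW|exact: uf].
- exact: intg_cst.
- by apply: aeW => x n xI; rewrite lee_fin uM.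
move=> hf cv _; apply: L1_poly_lim => // e e0.
have /fine_cvgP[_ /cvgrPdist_lt/(_ e e0)[N _ HN]] := cv.
exists (u N) => //.
have := HN N (leqnn N); rewrite /= sub0r normrN ger0_norm; last first.
  by rewrite fine_ge0// integral_ge0// => x _; rewrite abse_ge0.
move=> /ltW h; apply: le_trans h; rewrite /rint /Rintegral.
by under eq_integral do rewrite distrC.
Qed.

End Integration.


(** * Density of the polynomials in [L^1] of a finite measure *)

Section Density.
Import HBSimple.
Variable R : realType.
Variable mu : {measure set R -> \bar R}.
Local Notation I := (`[(-1)%R, 1%R]%classic : set R).
Hypothesis mu_fin : (mu I < +oo)%E.
Implicit Types f g : R -> R.

(** The ramps [min 1 (n (x - a)^+)] are continuous, lie in [[0, 1]] and converge to the
    indicator. *)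
Lemma L1_poly_ray (a : R) : L1_poly mu (\1_(`]a, +oo[%classic : set R)).
Proof.
apply: (@L1_poly_dominated _ _ mu_fin
   (fun n x => Num.min 1 (n%:R * Num.max 0 (x - a))) _ 1) => //.
- move=> n; apply: L1_poly_cont => //; apply: continuous_subspaceT => x.
  apply: (@continuous_min _ _ (fun=> 1) (fun x => n%:R * Num.max 0 (x - a))).
    exact: cst_continuous.
  apply: (@continuousM _ _ (fun=> n%:R) (fun x => Num.max 0 (x - a))).
    exact: cst_continuous.
  apply: (@continuous_max _ _ (fun=> 0) (fun x => x - a)); first exact: cst_continuous.
  by apply: (@continuousB _ _ _ id (fun=> a)); [exact: cvg_id|exact: cst_continuous].
- move=> n x _; rewrite ger0_norm ?ge_min ?lexx//.
  by rewrite le_min ler01 mulr_ge0// le_max lexx.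
- move=> x _; rewrite indicE; have [xa|xa] := boolP (x \in _); last first.
    have -> : (fun n : nat => Num.min 1 (n%:R * Num.max 0 (x - a))) = (fun=> 0 : R).
      apply/funext => n; rewrite max_l ?mulr0 ?min_r//.
      rewrite subr_le0 leNgt; apply/negP => h; move/negP: xa; apply.
      by rewrite inE /= in_itv /= h.
    exact: cvg_cst.
  have {}xa : 0 < x - a by move: xa; rewrite inE /= in_itv /= andbT subr_gt0.
  apply: cvg_near_cst; exists (Num.truncn (x - a)^-1).+1 => // n /= nn.
  rewrite max_r ?ltW// min_l// -ler_pdivrMr// mul1r.
  apply: le_trans (ltW (truncnS_gt _)) _; by rewrite ler_nat.
Qed.

Lemma L1_poly_sum (T : Type) (s : seq T) (F : T -> R -> R) :
  (forall i, L1_poly mu (F i)) -> L1_poly mu (fun x => \sum_(i <- s) F i x).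
Proof.
move=> H; elim: s => [|i s IH].
  by under eq_fun do rewrite big_nil; apply: L1_poly_cst.
by under eq_fun do rewrite big_cons; apply: L1_polyD.
Qed.

(** Dynkin's theorem: the open rays are stable under intersection and generate the Borel sets, and
    the sets whose indicator lies in the closure are stable under complement and countable disjoint
    union. *)
Lemma L1_poly_indic (A : set R) : measurable A -> L1_poly mu (\1_A).
Proof.
move=> mA.
have mE : @measurable _ R = <<s @RGenOInfty.G R >> := RGenOInfty.measurableE R.
apply: (@dynkin_induction _ R (@RGenOInfty.G R) (fun A => L1_poly mu (\1_A))) => //.
- move=> _ _ [x ->] [y ->]; exists (Num.max x y).
  by apply/seteqP; split => z /=; rewrite !in_itv /= !andbT gt_max => /andP.
- by rewrite indicT; exact: L1_poly_cst.
- by move=> _ [x ->]; exact: L1_poly_ray.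
- move=> S mS HS.
  apply: (@L1_poly_ext _ _ (fun x => 1 + (-1) * \1_S x)); last first.
    by apply: L1_polyD => //; [exact: L1_poly_cst|exact: L1_polyZ].
  by move=> x _; rewrite !indicE in_setC; case: (x \in S) => /=; lra.
- move=> F mF tF HF.
  have Fj x j (Fx : F j x) n : \sum_(k < n) \1_(F k) x = (j < n)%:R :> R.
    elim: n => [|n IH]; first by rewrite big_ord0.
    rewrite big_ord_recr /= IH indicE ltnS [(j <= n)%N]leq_eqVlt -natrD; congr (_%:R).
    have [<-|nj] := eqVneq j n; first by rewrite ltnn mem_set.
    rewrite memNset ?addn0// => Fn; move/eqP: nj; apply.
    by apply: (tF j n) => //; exists x.
  apply: (@L1_poly_dominated _ _ mu_fin (fun n x => \sum_(k < n) \1_(F k) x) _ 1).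
  + by move=> n; apply: (@L1_poly_sum _ _ (fun k : 'I_n => \1_(F k))).
  + by apply: measurable_indic; exact: bigcup_measurable.
  + move=> n x _; have [[j Fx]|nF] := pselect (exists j, F j x).
      by rewrite (Fj _ _ Fx); case: (j < n)%N; rewrite ?normr1 ?normr0.
    rewrite big1 ?normr0// => k _; rewrite indicE memNset// => Fk; apply: nF; by exists k.
  + move=> x _; have [[j Fx]|nF] := pselect (exists j, F j x).
      rewrite indicE mem_set; last by exists j.
      apply: cvg_near_cst; exists j.+1 => // n /= jn.
      by rewrite (Fj _ _ Fx) jn.
    rewrite indicE memNset; last by move=> [k _ Fk]; apply: nF; exists k.
    apply: cvg_near_cst; apply: nearW => n.
    rewrite big1// => k _; rewrite indicE memNset// => Fk; apply: nF; by exists k.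
- by rewrite -mE.
Qed.

Lemma intg_L1_poly f : intg mu f -> L1_poly mu f.
Proof.
move=> hf; apply: L1_poly_lim => // e e0.
have [g_ [gi _ gl]] := approximation_sfun_integrable (@measI R) hf.
have /fine_cvgP[_ /cvgrPdist_lt/(_ e e0)[N _ HN]] := gl.
exists (g_ N).
  have := HN N (leqnn N); move: (g_ N) => g _.
  apply: (@L1_poly_ext _ mu (fun x => \sum_(y <- finmap.enum_fset (fset_set (range g)))
    y * \1_(g @^-1` [set y]) x) (g : R -> R)).
    by move=> x _; rewrite -fsbig_finite// -fimfunE.
  by apply: L1_poly_sum => y; apply: L1_polyZ => //; exact: L1_poly_indic.
have := HN N (leqnn N); rewrite /= sub0r normrN ger0_norm; last first.
  by rewrite fine_ge0// integral_ge0// => x _; rewrite abse_ge0.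
exact: ltW.
Qed.

(** Since [f >= 0], replacing an approximant [q] by [|q|] does not increase the distance to [f]; a
    uniform approximant of [|q|], raised by its own error [d], is nonnegative and still close. *)
Lemma ge0_poly_approx f : intg mu f -> (forall x, I x -> 0 <= f x) ->
  forall e : R, 0 < e -> exists p : {poly R}, (forall x, I x -> 0 <= p.[x]) /\
    rint mu (fun x => `|f x - p.[x]|) <= e.
Proof.
move=> hf f0 e e0; have [_ /(_ _ (divr_gt0 e0 (ltr0n R 2)))[q Hq]] := intg_L1_poly hf.
pose m := fine (mu I) + 1.
have m0 : 0 < m by rewrite ltr_pwDr// fine_ge0.
pose d := e / 4 / m; have d0 : 0 < d by rewrite !divr_gt0.
have cq : {within I, continuous (fun x => `|q.[x]|)}.
  apply: continuous_subspaceT => x; apply: (@continuous_comp _ _ _ (horner q) Num.norm).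
    exact: continuous_horner.
  exact: norm_continuous.
have [p Hp] := weierstrass cq d0.
have pI x : I x -> `|q.[x]| <= (p + d%:P).[x] <= `|q.[x]| + 2 * d.
  move=> /Hp; rewrite ler_distlC hornerD hornerC => /andP[h1 h2].
  by apply/andP; split; lra.
exists (p + d%:P); split=> [x /pI/andP[+ _]|]; first exact/le_trans.
have i1 : intg mu (fun x => `|f x - q.[x]|).
  by apply: intg_norm; apply: intgB => //; exact: intg_poly.
apply: (@le_trans _ _ (rint mu (fun x => `|f x - q.[x]| + 2 * d))).
  apply: le_rint => [||x xI].
  - by apply: intg_norm; apply: intgB => //; exact: intg_poly.
  - by apply: intgD => //; exact: intg_cst.
  have /andP[h1 h2] := pI x xI; have h3 := f0 x xI.
  have h4 := ler_norm (f x - q.[x]); have h5 := ler_norm (q.[x] - f x).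
  rewrite distrC in h5; rewrite ler_norml.
  have [q0|q0] := lerP 0 q.[x]; [rewrite (ger0_norm q0) in h1 h2|rewrite (ltr0_norm q0) in h1 h2];
    by apply/andP; split; lra.
rewrite rintD//; last exact: intg_cst.
suff : rint mu (fun=> 2 * d) <= e / 2 by lra.
apply: le_trans (rint_le_cst mu_fin (M := 2 * d) _ _) _ => //; first exact: intg_cst.
have : d * fine (mu I) <= e / 4.
  by rewrite /d mulrAC ler_pdivrMr// ler_wpM2l// ?divr_ge0 ?ltW// ltrDl.
lra.
Qed.

End Density.


(** * Integration against a measure given by a density and a remainder *)

Section IntegralDensity.
Variable R : realType.
Variables (m s nu : {measure set R -> \bar R}) (v : R -> R).
Hypotheses (mv : measurable_fun setT v) (v0 : forall x, 0 <= v x).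
Hypothesis mE : forall A, measurable A ->
  (m A = s A + \int[nu]_(x in A) (v x)%:E)%E.
Variables (D : set R) (mD : measurable D).
Implicit Types f g : R -> R.
Import HBNNSimple.

Let P f := (\int[m]_(x in D) (f x)%:E =
  \int[s]_(x in D) (f x)%:E + \int[nu]_(x in D) (f x * v x)%:E)%E.

Let PD f g : measurable_fun D f -> measurable_fun D g ->
  (forall x, 0 <= f x) -> (forall x, 0 <= g x) -> P f -> P g ->
  P (fun x => f x + g x).
Proof.
move=> mf mg f0 g0 Pf Pg; rewrite /P.
have mvD : measurable_fun D v by exact: measurable_funS mv.
have mfE (h : R -> R) : measurable_fun D h -> measurable_fun D (EFin \o h).
  by move=> ?; exact/measurable_EFinP.
under eq_integral do rewrite EFinD.
rewrite ge0_integralD//; [|by move=> x _; rewrite lee_fin|exact: mfE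
  |by move=> x _; rewrite lee_fin|exact: mfE].
under [X in (_ = X + _)%E]eq_integral do rewrite EFinD.
rewrite [X in (_ = X + _)%E]ge0_integralD//; [|by move=> x _; rewrite lee_fin|exact: mfE
  |by move=> x _; rewrite lee_fin|exact: mfE].
under [X in (_ = _ + X)%E]eq_integral do rewrite mulrDl EFinD.
rewrite [X in (_ = _ + X)%E]ge0_integralD//; [|by move=> x _; rewrite lee_fin mulr_ge0
  |by apply: mfE; exact: measurable_funM
  |by move=> x _; rewrite lee_fin mulr_ge0|by apply: mfE; exact: measurable_funM].
by rewrite Pf Pg addeACA.
Qed.

Let PZ c A : 0 <= c -> measurable A -> P (fun x => c * \1_A x).
Proof.
move=> c0 mA; rewrite /P.
have mvD : measurable_fun D v by exact: measurable_funS mv.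
have mi : measurable_fun D (\1_A : R -> R) by exact: measurable_indic.
under eq_integral do rewrite EFinM.
rewrite ge0_integralZl//; try by [exact/measurable_EFinP|move=> x _; rewrite lee_fin].
under [X in (_ = X + _)%E]eq_integral do rewrite EFinM.
rewrite [X in (_ = X + _)%E]ge0_integralZl//; try by [exact/measurable_EFinP|move=> x _; rewrite lee_fin].
under [X in (_ = _ + X)%E]eq_integral do rewrite -mulrA EFinM.
rewrite [X in (_ = _ + X)%E]ge0_integralZl//; try by
  [apply/measurable_EFinP; exact: measurable_funM|move=> x _; rewrite lee_fin mulr_ge0].
rewrite !integral_indic// mE; last exact: measurableI.
rewrite -ge0_muleDr ?measure_ge0//; last first.
  by apply: integral_ge0 => x _; rewrite lee_fin mulr_ge0.
congr (_ * (_ + _))%E; rewrite integral_mkcondl.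
apply: eq_integral => x _; rewrite patchE indicE.
by case: (x \in A); rewrite ?mul1r ?mul0r.
Qed.

Let Pnnsfun (g : {nnsfun R >-> R}) : P g.
Proof.
(* On the range of [g] the number [Num.max 0 y] is [y]; written so, every term is nonnegative
   whatever list is summed over, and the induction on the list carries no membership hypothesis. *)
have gE : (g : R -> R) = fun x => \sum_(y <- finmap.enum_fset (fset_set (range g)))
    Num.max 0 y * \1_(g @^-1` [set y]) x.
  apply/funext => x; rewrite [LHS]fimfunE fsbig_finite//=.
  rewrite !big_seq; apply: eq_bigr => y.
  rewrite in_fset_set// inE /= => -[z _ <-]; rewrite max_r//.
rewrite gE; move: (finmap.enum_fset _) => l.
have ml y : measurable_fun D (fun x => Num.max 0 y * \1_(g @^-1` [set y]) x).
  by apply: measurable_funM => //; apply: measurable_indic; exact: measurable_funPTI.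
elim: l => [|y l IH].
  rewrite /P; under eq_integral do rewrite big_nil.
  under [X in (_ = X + _)%E]eq_integral do rewrite big_nil.
  under [X in (_ = _ + X)%E]eq_integral do rewrite big_nil mul0r.
  by rewrite !integral0 adde0.
under eq_fun do rewrite big_cons; apply: PD => //.
- by apply: measurable_sum => i; exact: ml.
- by move=> x; rewrite mulr_ge0// le_max lexx.
- by move=> x; apply: sumr_ge0 => i _; rewrite mulr_ge0// le_max lexx.
- apply: PZ; first by rewrite le_max lexx.
  exact: measurable_funPTI.
Qed.

(** The identity on sets passes to simple functions by linearity and to nonnegative functions by
    monotone convergence. *)
Lemma ge0_integral_density f : measurable_fun D f -> (forall x, D x -> 0 <= f x) ->
  (\int[m]_(x in D) (f x)%:E =
  \int[s]_(x in D) (f x)%:E + \int[nu]_(x in D) (f x * v x)%:E)%E.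
Proof.
move=> mf f0.
have mvD : measurable_fun D v by exact: measurable_funS mv.
have mfE : measurable_fun D (EFin \o f) by exact/measurable_EFinP.
pose g := nnsfun_approx mD mfE.
have gf x : D x -> (g n x)%:E @[n --> \oo] --> (f x)%:E.
  by move=> Dx; apply: cvg_nnsfun_approx => // y Dy; rewrite lee_fin f0.
have gnd x a b : D x -> (a <= b)%N -> g a x <= g b x.
  by move=> _ ab; exact/lefP/nd_nnsfun_approx.
have mg n : measurable_fun D (EFin \o g n).
  by apply/measurable_EFinP; exact: measurable_funTS.
have cm (k : {measure set R -> \bar R}) :
    (\int[k]_(x in D) (g n x)%:E)%E @[n --> \oo] --> (\int[k]_(x in D) (f x)%:E)%E.
  have := @cvg_monotone_convergence _ _ _ k D mD (fun n => EFin \o g n).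
  have -> : (\int[k]_(x in D) (f x)%:E = \int[k]_(x in D) limn ((fun n => EFin \o g n) ^~ x))%E.
    by apply: eq_integral => x /[!inE] Dx; apply/esym/cvg_lim => //; exact: gf.
  apply => //.
  - by move=> n x _; rewrite lee_fin.
  - by move=> x Dx a b ab; rewrite lee_fin gnd.
have cv : (\int[nu]_(x in D) (g n x * v x)%:E)%E @[n --> \oo] -->
    (\int[nu]_(x in D) (f x * v x)%:E)%E.
  have := @cvg_monotone_convergence _ _ _ nu D mD (fun n x => (g n x * v x)%:E).
  have -> : (\int[nu]_(x in D) (f x * v x)%:E =
      \int[nu]_(x in D) limn ((fun n x => (g n x * v x)%:E) ^~ x))%E.
    apply: eq_integral => x /[!inE] Dx; apply/esym/cvg_lim => //.
    apply/fine_cvgP; split; first exact: nearW.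
    have /fine_cvgP[_ h] := gf x Dx.
    by apply: (cvgM h); exact: cvg_cst.
  apply => //.
  - by move=> n; apply/measurable_EFinP; apply: measurable_funM => //; exact: measurable_funTS.
  - by move=> n x _; rewrite lee_fin mulr_ge0.
  - by move=> x Dx a b ab; rewrite lee_fin ler_wpM2r// gnd.
have := cm m; under eq_fun do rewrite Pnnsfun.
move=> h; apply: (cvg_unique _ h) => //.
apply: cvgeD; [|exact: cm|exact: cv].
by apply: ge0_adde_def; rewrite inE; apply: integral_ge0 => x Dx;
  rewrite lee_fin ?mulr_ge0 ?f0.
Qed.

End IntegralDensity.

(** * The arcsine measure and its integrals of Chebyshev polynomials *)

Section Arcsine.
Variable R : realType.
Local Notation I := (`[(-1)%R, 1%R]%classic : set R).
Local Notation leb := (@lebesgue_measure R).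

Lemma ge0_integral_arcsine (f : R -> R) : measurable_fun I f ->
  (forall x, I x -> 0 <= f x) ->
  (\int[@arcsine R]_(x in I) (f x)%:E =
   \int[leb]_(x in I) (f x * arcsine_pdf x)%:E)%E.
Proof.
move=> mf f0.
have mid : measurable_fun setT (idfun : measurableTypeR R -> R).
  by move=> _ Y mY; rewrite setTI.
(* Lebesgue measure is a measure for another display than the canonical one of
   [R]; pushing it forward by the identity makes the two comparable. *)
pose nu : {measure set R -> \bar R} :=
  measure_function_pushforward__canonical__measure_function_Measure leb mid.
have nuE (D : set R) (g : R -> R) : measurable D -> measurable_fun D g ->
    (forall x, D x -> 0 <= g x) ->
    (\int[nu]_(x in D) (g x)%:E = \int[leb]_(x in D) (g x)%:E)%E.
  move=> mD mg g0; rewrite (ge0_integral_pushforward mid)//.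
    exact/measurable_EFinP.
  by move=> y; rewrite inE lee_fin => /g0.
have mI : measurable I by exact: measurable_itv.
pose v (x : R) := arcsine_pdf x * \1_I x.
have v0 x : 0 <= v x by rewrite mulr_ge0// arcsine_pdf_ge0.
have mv : measurable_fun setT v.
  by apply: measurable_funM; [exact: measurable_arcsine_pdf|exact: measurable_indic].
have mE (A : set R) : measurable A -> (@arcsine R A =
    (@mzero _ R R) A + \int[nu]_(x in A) (v x)%:E)%E.
  move=> mA; rewrite /mzero add0e nuE//; last exact: measurable_funS mv.
  rewrite /arcsine integral_mkcondr.
  apply: eq_integral => x _; rewrite patchE /v indicE.
  by case: (x \in _); rewrite ?mulr1 ?mulr0.
(* The zero measure takes the place of the singular part in the density formula. *)
rewrite (@ge0_integral_density R (@arcsine R) (@mzero _ R R) nu v mv v0 mE _ mI f mf f0).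
rewrite integral_measure_zero add0e nuE//; last 2 first.
- by apply: measurable_funM => //; exact: measurable_funS mv.
- by move=> x /f0 h; rewrite mulr_ge0.
by apply: eq_integral => x xI; rewrite /v indicE xI mulr1.
Qed.

Lemma measurable_acos : measurable_fun I (@acos R).
Proof.
apply: (@measurable_fun_itv_cc _ _ _ false true).
apply: open_continuous_measurable_fun; first exact: interval_open.
by move=> x; rewrite inE /= in_itv /=; exact: continuous_acos.
Qed.

Section Chebyshev.
Variables (k : nat) (c : R).
Hypotheses (c0 : 0 <= c) (c1 : c <= 1).
Let K : R := k.+1%:R.
Let K0 : K != 0. Proof. by rewrite pnatr_eq0. Qed.
Let prim (x : R) : R := - (acos x + c * (sin (K * acos x) / K)) / pi.
Let f (x : R) : R := (1 + c * cos (K * acos x)) * arcsine_pdf x.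

Let is_derive_prim (x : R) : -1 < x < 1 -> is_derive x 1 prim (f x).
Proof.
move=> x1.
have da : is_derive x (1 : R) (@acos R) (- (Num.sqrt (1 - x ^+ 2))^-1) := is_derive1_acos x1.
have dk : is_derive x (1 : R) (fun y => K * acos y) (K * (- (Num.sqrt (1 - x ^+ 2))^-1)).
  exact: is_deriveZ.
have ds : is_derive x (1 : R) (fun y => sin (K * acos y))
    (cos (K * acos x) * (K * (- (Num.sqrt (1 - x ^+ 2))^-1))).
  exact: (@is_derive1_comp _ sin (fun y => K * acos y)).
have -> : prim = (fun y => - pi^-1 * (acos y + (c / K) * sin (K * acos y))).
  have E A S P L : P != 0 -> L != 0 ->
    - (A + c * (S / L)) / P = - P^-1 * (A + (c / L) * S) :> R.
    by move=> P0 L0; field; rewrite P0 L0.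
  by apply/funext => y; rewrite /prim E// lt0r_neq0// pi_gt0.
have dc := is_deriveZ (c / K) ds.
have D := is_deriveZ (- pi^-1) (is_deriveD da dc).
apply: (is_derive_eq D).
have /andP[xl xr] := x1.
have s0 : Num.sqrt (1 - x ^+ 2) != 0.
  by rewrite sqrtr_eq0 -ltNge; nra.
have E A S P L : P != 0 -> L != 0 -> S != 0 ->
  - P^-1 * (- S^-1 + c / L * (A * (L * - S^-1))) = (1 + c * A) * (P * S)^-1 :> R.
  by move=> P0 L0 S0; field; rewrite P0 L0 S0.
by rewrite /f /arcsine_pdf -(E _ _ _ K)// lt0r_neq0// pi_gt0.
Qed.

Let acos_cont (x : R) : -1 < x < 1 -> {for x, continuous (@acos R)}.
Proof. exact: continuous_acos. Qed.

Let f_cont (x : R) : -1 < x < 1 -> {for x, continuous f}.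
Proof.
move=> x1; have /andP[xl xr] := x1.
apply: (@continuousM _ _ (fun x => 1 + c * cos (K * acos x)) (@arcsine_pdf R)).
  apply: cvgD; first exact: cst_continuous.
  apply: (@continuousM _ _ (fun=> c) (fun x => cos (K * acos x))).
    exact: cst_continuous.
  apply: (@continuous_comp _ _ _ (fun x => K * acos x) cos).
    apply: (@continuousM _ _ (fun=> K) (@acos R)); first exact: cst_continuous.
    exact: acos_cont.
  exact: continuous_cos.
rewrite /arcsine_pdf; apply: cvgV.
  by rewrite mulf_neq0 ?lt0r_neq0 ?pi_gt0// sqrtr_gt0; nra.
apply: cvgM; first exact: cvg_cst.
apply: continuous_cvg; first exact: sqrt_continuous.
apply: cvgB; first exact: cvg_cst.
exact: exprn_continuous.
Qed.

Let measurable_f : measurable_fun I f.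
Proof.
apply: measurable_funM; last exact: measurable_funS (@measurable_arcsine_pdf R).
apply: measurable_funD => //; apply: measurable_funM => //.
apply: (measurableT_comp (continuous_measurable_fun (@continuous_cos R))).
by apply: measurable_funM => //; exact: measurable_acos.
Qed.

Let val (d : R) : R := (pi - 2 * d + c * ((sin (K * (pi - d)) - sin (K * d)) / K)) / pi.

Let integral_itv (d : R) : 0 < d < pi / 2 ->
  (\int[leb]_(x in `[(- cos d)%R, cos d]) (f x)%:E = (val d)%:E)%E.
Proof.
move=> /andP[d0 dpi].
have cd : 0 < cos d by apply: cos_gt0_pihalf; rewrite dpi andbT; have := pi_gt0 R; lra.
have cd1 : cos d < 1.
  rewrite -[ltRHS](@cos0 R) ltr_cos ?in_itv//=; have := pi_gt0 R; lra.
have sub x : - cos d <= x <= cos d -> -1 < x < 1 by move=> ?; lra.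
rewrite (@continuous_FTC2 _ f prim); first last.
- move=> x; rewrite in_itv /= => xI; have xI' : - cos d <= x <= cos d by lra.
  have D := is_derive_prim (sub x xI').
  by rewrite derive1E; exact: derive_val.
- have dc x : - cos d <= x <= cos d -> {for x, continuous prim}.
    move=> xI; have [D _] := is_derive_prim (sub x xI).
    by apply: differentiable_continuous; apply/derivable1_diffP.
  split.
  + move=> x; rewrite in_itv /= => xI; have xI' : - cos d <= x <= cos d by lra.
    by have [D _] := is_derive_prim (sub x xI').
  + by apply: cvg_at_right_filter; apply: dc; lra.
  + by apply: cvg_at_left_filter; apply: dc; lra.
- apply: continuous_in_subspaceT => x; rewrite inE /= in_itv /= => xI.
  by apply: f_cont; exact: sub.
- lra.
have dI : d \in `[0, pi] by rewrite in_itv /=; have := pi_gt0 R; lra.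
have pdI : pi - d \in `[0, pi] by rewrite in_itv /=; have := pi_gt0 R; lra.
have e1 : - cos d = cos (pi - d) by rewrite addrC cosDpi cosN.
rewrite -EFinB; congr EFin; rewrite /prim e1 !cosK// /val.
have E A A' P L : P != 0 -> L != 0 -> - (d + c * (A / L)) / P - - (P - d + c * (A' / L)) / P
   = (P - 2 * d + c * ((A' - A) / L)) / P.
  by move=> P0 L0; field; rewrite P0 L0.
by rewrite E// lt0r_neq0// pi_gt0.
Qed.

(** The density is unbounded at the endpoints, so the fundamental theorem of calculus is applied on
    [[- cos d, cos d]] and [d] tends to [0] by monotone convergence; [val 0 = 1] because [sin]
    vanishes at the multiples of [pi]. *)
Let integral_f : (\int[leb]_(x in I) (f x)%:E = 1)%E.
Proof.
pose d (n : nat) : R := n.+1%:R^-1 / 2.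
have d0 n : 0 < d n by rewrite divr_gt0.
have dpi n : d n < pi / 2.
  have : n.+1%:R^-1 <= 1 :> R by rewrite invf_le1// ler1n.
  have := pihalf_ge1 R; rewrite /d; move: (pi / 2) (n.+1%:R^-1) => A B; lra.
have dI n : d n \in `[0, pi].
  by rewrite in_itv /=; move: (d n) (d0 n) (dpi n) (pi_gt0 R) => D; lra.
have dcv : d n @[n --> \oo] --> (0 : R).
  rewrite -[X in _ --> X](mul0r (2^-1 : R)); apply: cvgM; last exact: cvg_cst.
  exact: cvg_harmonic.
pose F n : set R := `[(- cos (d n))%R, cos (d n)]%classic.
have F1 : \bigcup_n F n = `](-1)%R, 1%R[%classic.
  apply/seteqP; split => x /=.
    move=> [n _]; rewrite /F /= !in_itv /= => xn.
    have : cos (d n) < 1.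
      rewrite -[ltRHS](@cos0 R) ltr_cos ?in_itv//=; move: (d n) (dpi n) (d0 n) (pi_gt0 R) => D; lra.
    move: (cos (d n)) xn => A; lra.
  rewrite in_itv /= => x1.
  have : cos (d n) @[n --> \oo] --> (1 : R).
    rewrite -[X in _ --> X](@cos0 R); apply: continuous_cvg => //; exact: continuous_cos.
  move=> /cvgr_gt/(_ `|x|); rewrite ltr_norml x1 => /(_ isT)/filter_ex[n /ltW].
  by rewrite ler_norml => xn; exists n => //; rewrite /F /= in_itv.
have cF : (\int[leb]_(x in F n) (f x)%:E)%E @[n --> \oo] -->
    (\int[leb]_(x in \bigcup_n F n) (f x)%:E)%E.
  apply: ge0_nondecreasing_set_cvg_integral.
  - apply/nondecreasing_seqP => n; apply/subsetPset => x; rewrite /F /= !in_itv /= => xn.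
    have : cos (d n) <= cos (d n.+1).
      rewrite leNgt ltr_cos ?dI// -leNgt.
      by rewrite /d ler_wpM2r// lef_pV2 ?posrE// ler_nat.
    move: (cos (d n)) (cos (d n.+1)) xn => A B; lra.
  - by move=> n; exact: measurable_itv.
  - move=> n; apply/measurable_EFinP; apply: measurable_funS measurable_f => // x.
    rewrite /F /= !in_itv /=; have := cos_le1 (d n); move: (cos (d n)) => A; lra.
  - move=> n x _; rewrite lee_fin mulr_ge0 ?arcsine_pdf_ge0//.
    have := cos_geN1 (K * acos x); have := c0; have := c1; nra.
have mf := measurable_f.
rewrite -integral_itv_bndo_bndc; last first.
  by apply/measurable_EFinP; apply: measurable_funS mf => //; exact: subset_itv_co_cc.
rewrite -integral_itv_obnd_cbnd; last first.
  by apply/measurable_EFinP; apply: measurable_funS mf => //; exact: subset_itv_oo_cc.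
rewrite -F1; apply: (cvg_unique _ cF) => //.
have E n : (\int[leb]_(x in F n) (f x)%:E = (val (d n))%:E)%E.
  by apply: integral_itv; rewrite d0 dpi.
rewrite /=; under eq_fun do rewrite E.
apply/fine_cvgP; split; first exact: nearW.
have -> : (1 : R) = val 0.
  have sk j : sin (j%:R * pi) = 0 :> R.
    elim: j => [|j IH]; first by rewrite mul0r sin0.
    by rewrite -natr1 mulrDl mul1r sinD IH sinpi mul0r mulr0 addr0.
  by rewrite /val !subr0 !mulr0 /K sk sin0 subrr mul0r mulr0 addr0 subr0 divff// lt0r_neq0 ?pi_gt0.
suff cval : {for 0, continuous val} by exact: (continuous_cvg _ cval dcv).
rewrite /val.
apply: cvgM; last exact: cvg_cst.
apply: cvgD; first by apply: cvgB; [exact: cvg_cst|apply: cvgM; [exact: cvg_cst|exact: cvg_id]].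
apply: cvgM; first exact: cvg_cst.
apply: cvgM; last exact: cvg_cst.
apply: cvgB.
  apply: continuous_cvg; first exact: continuous_sin.
  by apply: cvgM; [exact: cvg_cst|apply: cvgB; [exact: cvg_cst|exact: cvg_id]].
apply: continuous_cvg; first exact: continuous_sin.
by apply: cvgM; [exact: cvg_cst|exact: cvg_id].
Qed.

(** The constant [1] and the bound [c <= 1] keep the integrand nonnegative, so that integrability
    need not be known beforehand. The case [c = 0] is the total mass; comparison with [c = 1] gives
    the orthogonality of the nonconstant Chebyshev polynomials to the constants. *)
Lemma integral_arcsine_cos :
  (\int[@arcsine R]_(x in I) (1 + c * cos (k.+1%:R * acos x))%:E = 1)%E.
Proof.
rewrite ge0_integral_arcsine ?integral_f//.
  apply: measurable_funD => //; apply: measurable_funM => //.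
  apply: (measurableT_comp (continuous_measurable_fun (@continuous_cos R))).
  by apply: measurable_funM => //; exact: measurable_acos.
move=> x _; have := cos_geN1 (K * acos x); have := c0; have := c1; rewrite /K; nra.
Qed.

End Chebyshev.

Lemma arcsine_mass : @arcsine R I = 1%E.
Proof.
have := @integral_arcsine_cos 0 0 (lexx _) ler01.
under eq_integral do rewrite mul0r addr0.
by rewrite integral_cst// mul1e.
Qed.

End Arcsine.


(** * The complex exponential and Euler's limit *)

Section ComplexExponential.
Variable R : realType.
Local Notation C := (Cplx R).
Implicit Types (z w : C).

Lemma mean_value_bound (f df : R -> R) (M b : R) :
  (forall x : R, is_derive x (1 : R) f (df x)) -> f 0 = 0 ->
  (forall x : R, `|x| <= `|b| -> `|df x| <= M) -> `|f b| <= M * `|b|.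
Proof.
move=> fd f0 dM.
have cf : forall x : R, {for x, continuous f}.
  move=> x; have [D _] := fd x.
  by apply: differentiable_continuous; apply/derivable1_diffP.
have cI (A : set R) : {within A, continuous f} by apply: continuous_subspaceT.
have [b0|b0|<-] := ltrgtP 0 b.
- have [c] := @MVT R f df 0 b b0 (fun x _ => fd x) (cI _).
  rewrite in_itv /= f0 !subr0 => /andP[c0 cb] ->.
  by rewrite normrM ler_wpM2r// dM// !gtr0_norm// ltW.
- have [c] := @MVT R f df b 0 b0 (fun x _ => fd x) (cI _).
  rewrite in_itv /= f0 !sub0r => /andP[c0 cb] /eqP; rewrite eqr_oppLR => /eqP ->.
  by rewrite mulrN opprK normrM ler_wpM2r// dM// !ltr0_norm// lerN2 ltW.
- by rewrite f0 !normr0 mulr0.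
Qed.

Lemma normr_sin_le (b : R) : `|sin b| <= `|b|.
Proof.
rewrite -[leRHS]mul1r; apply: (@mean_value_bound sin cos); rewrite ?sin0//.
by move=> x _; rewrite ler_norml cos_geN1 cos_le1.
Qed.

Lemma norm_cosB1 (b : R) : `|cos b - 1| <= b ^+ 2.
Proof.
rewrite -[leRHS]real_normK ?num_real// expr2.
apply: (@mean_value_bound (fun x => cos x - 1) (fun x => - sin x)).
- move=> x; have := is_deriveB (is_derive_cos x) (is_derive_cst (1 : R) x (1 : R)).
  by rewrite subr0.
- by rewrite cos0 subrr.
- by move=> x xb; rewrite normrN; apply: le_trans (normr_sin_le x) xb.
Qed.

Lemma norm_sinB (b : R) : `|b| <= 1 -> `|sin b - b| <= b ^+ 2.
Proof.
move=> b1; rewrite -[leRHS]real_normK ?num_real// expr2.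
apply: (@mean_value_bound (fun x => sin x - x) (fun x => cos x - 1)).
- by rewrite /= sin0 subr0.
- move=> x xb; apply: le_trans (norm_cosB1 x) _.
  rewrite -real_normK ?num_real// expr2 -[leRHS]mulr1.
  by apply: ler_pM => //; exact: le_trans xb b1.
Qed.

Lemma cexp0 : cexp (0 : C) = 1.
Proof. by rewrite /cexp /= expR0 cos0 sin0 mulr1 mulr0. Qed.

Lemma cexpD z w : cexp (z + w) = cexp z * cexp w.
Proof.
by apply: complex_ext; rewrite ?ReM ?ImM /= ReD ImD expRD ?cosD ?sinD; ring.
Qed.

Lemma cmod_cexp z : cmod (cexp z) = expR (complex.Re z).
Proof.
rewrite cmodE /cexp /= !exprMn -mulrDr cos2Dsin2 mulr1 sqrtr_sqr.
by rewrite ger0_norm// expR_ge0.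
Qed.

Lemma cexp_neq0 z : cexp z != 0.
Proof. by rewrite -cmod_gt0 cmod_cexp expR_gt0. Qed.

Lemma cexpN z : cexp (- z) = (cexp z)^-1.
Proof. by apply: (mulfI (cexp_neq0 z)); rewrite -cexpD subrr cexp0 divff// cexp_neq0. Qed.

Lemma cexp_toC (x : R) : cexp (toC x) = toC (expR x).
Proof. by apply: complex_ext; rewrite /cexp /= ?cos0 ?sin0 ?mulr1 ?mulr0. Qed.

Lemma cexp_conj z : cexp z^* = (cexp z)^*.
Proof. by apply: complex_ext; rewrite !conjCE /cexp /= ?cosN ?sinN ?mulrN. Qed.

Lemma cexpMn z n : cexp (z *+ n) = cexp z ^+ n.
Proof. by elim: n => [|n IH]; rewrite ?mulr0n ?cexp0// mulrS cexpD IH exprS. Qed.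

Lemma cmod_cexp_le z : cmod (cexp z) <= expR (cmod z).
Proof. by rewrite cmod_cexp ler_expR (le_trans (ler_norm _) (Re_le_cmod z)). Qed.

(** Real estimates suffice: [1 + a <= e^a <= 1 / (1 - a)] for the real part [a] of [w], and mean
    value bounds for [cos] and [sin] at its imaginary part. *)
Lemma cexp_taylor w : cmod w <= 2^-1 -> cmod (cexp w - 1 - w) <= 4 * cmod w ^+ 2.
Proof.
move=> w1; have aw := Re_le_cmod w; have bw := Im_le_cmod w.
rewrite cmod_sqr; apply: le_trans (cmod_le_ReIm _) _.
rewrite /cexp !ReImE /= oppr0 addr0.
set a := complex.Re w in aw *; set b := complex.Im w in bw *.
have a2 : `|a| <= 2^-1 by exact: le_trans aw w1.
have b2 : `|b| <= 2^-1 by exact: le_trans bw w1.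
have b1 : `|b| <= 1 by lra.
have e1 : 1 + a <= expR a by exact: expR_ge1Dx.
have e2 : expR a <= 1 + a + 2 * a ^+ 2.
  have := expR_ge1Dx (- a); rewrite expRN => h.
  have h' : expR a * (1 - a) <= 1.
    by rewrite -ler_pdivlMl ?expR_gt0// mulr1.
  move: a2; rewrite ler_norml => /andP[al ar].
  rewrite -(ler_pM2r (x := 1 - a)); last lra.
  apply: le_trans h' _; nra.
have hc := norm_cosB1 b; have hs := norm_sinB b1; have hs' := normr_sin_le b.
have c1 : `|cos b| <= 1 by rewrite ler_norml cos_geN1 cos_le1.
have R1 : `|expR a * cos b + -1 + - a| <= 2 * a ^+ 2 + 3 / 2 * b ^+ 2.
  have -> : expR a * cos b + -1 + - a = (expR a - 1 - a) * cos b + (1 + a) * (cos b - 1) by ring.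
  apply: le_trans (ler_normD _ _) _; rewrite !normrM; apply: lerD.
    rewrite -[leRHS]mulr1; apply: ler_pM => //.
    by rewrite ger0_norm; lra.
  apply: ler_pM => //; apply: le_trans (ler_normD _ _) _; rewrite normr1; lra.
have I1 : `|expR a * sin b - b| <= 2 * (`|a| * `|b|) + b ^+ 2.
  have -> : expR a * sin b - b = (expR a - 1) * sin b + (sin b - b) by ring.
  apply: le_trans (ler_normD _ _) _; rewrite normrM lerD// mulrA; apply: ler_pM => //.
  have a22 : 2 * a ^+ 2 <= `|a|.
    rewrite -[a ^+ 2]real_normK ?num_real// expr2 mulrA ler_piMl//; lra.
  have := ler_norm a; have := ler_norm (- a); rewrite normrN => h1 h2.
  rewrite ler_norml; apply/andP; split; lra.
have := sqr_ge0 (`|a| - `|b|); rewrite sqrrB !real_normK ?num_real//.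
move: R1 I1 (sqr_ge0 a) (sqr_ge0 b); rewrite ?subr0 ?add0r.
move: (`|a| * `|b|) (a ^+ 2) (b ^+ 2) => P A B; lra.
Qed.

Lemma cexp_continuous z : {for z, continuous (@cexp R)}.
Proof.
apply/ccontinuous_atP => e e0.
pose M := expR (complex.Re z).
have M0 : 0 < M by exact: expR_gt0.
exists (Num.min 2^-1 (e / (3 * M))).
  by rewrite lt_min invr_gt0 ltr0n /= divr_gt0// mulr_gt0.
move=> u; rewrite lt_min => /andP[u1 u2].
have -> : u = z + (u - z) by ring.
set d := u - z in u1 u2 *.
have -> : cexp (z + d) - cexp z = cexp z * (cexp d - 1) by rewrite cexpD; ring.
rewrite cmodM cmod_cexp -/M.
have h : cmod (cexp d - 1) <= 3 * cmod d.
  apply: le_trans (cmod_dist _ d) _.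
  have := cexp_taylor (ltW u1); have := cmod_ge0 d; nra.
apply: (@le_lt_trans _ _ (M * (3 * cmod d))); first by rewrite ler_wpM2l// ltW.
by move: u2; rewrite ltr_pdivlMr ?mulr_gt0//; lra.
Qed.

Lemma cmod_powB (z w : C) (L d : R) m : 1 <= L -> cmod z <= L -> cmod w <= L ->
  cmod (z - w) <= d -> cmod (z ^+ m - w ^+ m) <= m%:R * d * L ^+ m.
Proof.
move=> L1 zL wL zw; have d0 : 0 <= d by apply: le_trans (cmod_ge0 _) zw.
have L0 : 0 <= L by lra.
elim: m => [|m IH]; first by rewrite !expr0 subrr cmod0 !mul0r.
have -> : z ^+ m.+1 - w ^+ m.+1 = z * (z ^+ m - w ^+ m) + (z - w) * w ^+ m.
  by rewrite !exprS; ring.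
apply: le_trans (cmodD _ _) _; rewrite !cmodM cmodX.
have h1 : cmod z * cmod (z ^+ m - w ^+ m) <= L * (m%:R * d * L ^+ m).
  by apply: ler_pM => //; exact: cmod_ge0.
have Lm0 : 0 <= L ^+ m by exact: exprn_ge0.
have h2 : cmod (z - w) * cmod w ^+ m <= d * L ^+ m.
  apply: ler_pM; rewrite ?cmod_ge0 ?exprn_ge0 ?cmod_ge0//.
  by rewrite lerXn2r// nnegrE ?cmod_ge0.
have h3 : d * L ^+ m <= d * (L * L ^+ m).
  by rewrite ler_wpM2l// ler_peMl.
rewrite exprS -natr1; lra.
Qed.

(** Writes [cexp z] as a power of [cexp w] with [w = z / m.+1] and telescopes the difference of
    powers. The rate makes the exponential of a real polynomial a uniform limit of real polynomials
    on the disk. *)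
Lemma cexp_euler (z : C) m : 2 * cmod z <= m.+1%:R ->
  cmod (cexp z - (1 + toC (m.+1%:R^-1) * z) ^+ m.+1) <=
  4 * cmod z ^+ 2 * expR (cmod z) / m.+1%:R.
Proof.
move=> zm; set w := toC _ * z.
have n0 : (0 : R) < m.+1%:R by rewrite ltr0n.
have wE : cmod w = cmod z / m.+1%:R.
  by rewrite cmodM cmod_toC ger0_norm ?invr_ge0// mulrC.
have w2 : cmod w <= 2^-1 by rewrite wE ler_pdivrMr//; lra.
have zE : z = w *+ m.+1.
  rewrite /w -mulr_natl mulrA -toC_nat -rmorphM /= divff ?pnatr_eq0//.
  by rewrite rmorph1 mul1r.
rewrite [in X in X - _]zE cexpMn.
pose L := expR (cmod w).
have L1 : 1 <= L by rewrite -(@expR0 R) ler_expR cmod_ge0.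
apply: le_trans (cmod_powB (L := L) (d := 4 * cmod w ^+ 2) _ L1 _ _ _) _.
- exact: cmod_cexp_le.
- by apply: le_trans (cmodD _ _) _; rewrite cmod1 expR_ge1Dx.
- by rewrite opprD addrA; exact: cexp_taylor.
have -> : L ^+ m.+1 = expR (cmod z).
  by rewrite /L -expRM_natl wE mulrC divfK// lt0r_neq0.
rewrite wE; rewrite [leLHS](_ : _ = 4 * cmod z ^+ 2 * expR (cmod z) / m.+1%:R)//.
by field; rewrite lt0r_neq0.
Qed.

End ComplexExponential.


(** * Means over the unit circle *)

Section CircleMean.
Variable R : realType.
Local Notation C := (Cplx R).
Local Notation A := (@arcsine R).
Local Notation I := (`[(-1)%R, 1%R]%classic : set R).
Implicit Types (f g : C -> C) (b : C -> R) (z u : C).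

Lemma arcsine_fin : (A I < +oo)%E.
Proof. by rewrite arcsine_mass ltry. Qed.

Lemma rint_arcsine_cst (c : R) : rint A (fun=> c) = c.
Proof. by rewrite /rint Rintegral_cst// [X in fine X]arcsine_mass mulr1. Qed.

Definition clamp (x : R) := Num.max (-1) (Num.min x 1).
(* The clamping makes [ept] a continuous map from all of [R] to the upper unit
   half-circle. *)
Definition ept (x : R) : C := Complex (clamp x) (Num.sqrt (1 - clamp x ^+ 2)).

Lemma clamp_itv x : -1 <= clamp x <= 1.
Proof. by rewrite /clamp le_max lexx /= ge_max ge_min lexx orbT andbT; lra. Qed.

Lemma clamp_id x : I x -> clamp x = x.
Proof.
by rewrite /= in_itv /= /clamp => /andP[x0 x1]; rewrite min_l// max_r.
Qed.

Lemma cmod_ept x : cmod (ept x) = 1.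
Proof.
rewrite cmodE /= sqr_sqrtr; first by rewrite addrC subrK sqrtr1.
by have := clamp_itv x => ?; nra.
Qed.

Lemma Re_continuous z : {for z, continuous (fun u : C => complex.Re u)}.
Proof.
apply/rcontinuous_atP => e e0; exists e => // u uz.
by apply: le_lt_trans uz; rewrite -ReN -ReD Re_le_cmod.
Qed.

Lemma Im_continuous z : {for z, continuous (fun u : C => complex.Im u)}.
Proof.
apply/rcontinuous_atP => e e0; exists e => // u uz.
by apply: le_lt_trans uz; rewrite -ImN -ImD Im_le_cmod.
Qed.

Lemma cmod_continuous z : {for z, continuous (@cmod R)}.
Proof.
apply/rcontinuous_atP => e e0; exists e => // u uz.
apply: le_lt_trans uz; rewrite ler_norml; apply/andP; split.
  by have := cmod_dist z u; rewrite (cmodBC z); lra.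
by have := cmod_dist u z; lra.
Qed.

Lemma conj_continuous z : {for z, continuous (fun u : C => u^*)}.
Proof.
apply/ccontinuous_atP => e e0.
by exists e => // u uz; rewrite -rmorphB cmod_conj.
Qed.

Lemma cvg_Complex (T : Type) (F : set_system T) {FF : Filter F} (x y : T -> R) (a c : R) :
  x t @[t --> F] --> a -> y t @[t --> F] --> c ->
  (Complex (x t) (y t) : C) @[t --> F] --> (Complex a c : C).
Proof.
move=> /cvgrPdist_lt xa /cvgrPdist_lt yc; apply/cvg_cmodP => e e0.
have e2 : 0 < e / 2 by rewrite divr_gt0.
apply: filterS2 (xa _ e2) (yc _ e2) => t h1 h2.
apply: le_lt_trans (cmod_le_ReIm _) _; rewrite /= distrC (distrC (y t)); lra.
Qed.

Lemma clamp_continuous (x : R) : {for x, continuous clamp}.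
Proof.
have cmin : {for x, continuous (fun x : R => Num.min x 1)}.
  by apply: (@continuous_min R R id (fun=> 1)); [exact: cvg_id|exact: cst_continuous].
by apply: (@continuous_max R R (fun=> -1) _ x _ cmin); exact: cst_continuous.
Qed.

Lemma ept_continuous x : {for x, continuous ept}.
Proof.
apply: cvg_Complex; first exact: clamp_continuous.
apply: continuous_cvg; first exact: sqrt_continuous.
apply: cvgB; first exact: cvg_cst.
exact: (continuous_cvg _ (@exprn_continuous R 2 (clamp x)) (@clamp_continuous x)).
Qed.

Lemma Re_ept x : I x -> complex.Re (ept x) = x.
Proof. exact: clamp_id. Qed.

Lemma eptE x : I x -> ept x = Complex (cos (acos x)) (sin (acos x)).
Proof.
move=> xI; rewrite /ept clamp_id// acosK// sin_acos//.
Qed.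

Lemma eptX x k : I x ->
  ept x ^+ k = Complex (cos (k%:R * acos x)) (sin (k%:R * acos x)).
Proof.
move=> xI; elim: k => [|k IH]; first by rewrite expr0 mul0r cos0 sin0.
rewrite exprS IH eptE// -natr1 mulrDl mul1r cosD sinD.
by apply: complex_ext; rewrite ?ReM ?ImM /=; ring.
Qed.

Definition rcont b := forall z, cmod z = 1 -> {for z, continuous b}.
Definition ccont f := forall z, cmod z = 1 -> {for z, continuous f}.

Lemma rcont_cst c : rcont (fun=> c).
Proof. by move=> z _; exact: cst_continuous. Qed.
Lemma rcontD b c : rcont b -> rcont c -> rcont (fun z => b z + c z).
Proof. by move=> hb hc z z1; exact: (cvgD (hb z z1) (hc z z1)). Qed.
Lemma rcontB b c : rcont b -> rcont c -> rcont (fun z => b z - c z).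
Proof. by move=> hb hc z z1; exact: (cvgB (hb z z1) (hc z z1)). Qed.
Lemma rcontM b c : rcont b -> rcont c -> rcont (fun z => b z * c z).
Proof. by move=> hb hc z z1; exact: (cvgM (hb z z1) (hc z z1)). Qed.
Lemma rcontX b n : rcont b -> rcont (fun z => b z ^+ n).
Proof. by move=> hb z z1; exact: (continuous_cvg _ (@exprn_continuous R n (b z)) (hb z z1)). Qed.
Lemma rcont_norm b : rcont b -> rcont (fun z => `|b z|).
Proof.
move=> hb z z1; apply/rcontinuous_atP => e e0.
have [d d0 Hd] := iffLR (rcontinuous_atP _ _) (hb z z1) e e0.
by exists d => // u /Hd; apply: le_lt_trans; exact: ler_dist_dist.
Qed.
Lemma rcont_Re f : ccont f -> rcont (fun z => complex.Re (f z)).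
Proof. by move=> hf z z1; exact: (continuous_cvg _ (@Re_continuous _) (hf z z1)). Qed.
Lemma rcont_Im f : ccont f -> rcont (fun z => complex.Im (f z)).
Proof. by move=> hf z z1; exact: (continuous_cvg _ (@Im_continuous _) (hf z z1)). Qed.
Lemma rcont_cmod f : ccont f -> rcont (fun z => cmod (f z)).
Proof. by move=> hf z z1; exact: (continuous_cvg _ (@cmod_continuous _) (hf z z1)). Qed.

Lemma ccont_ext f g : (forall z, f z = g z) -> ccont f -> ccont g.
Proof. by move=> /funext ->. Qed.
Lemma ccont_cst (c : C) : ccont (fun=> c).
Proof. by move=> z _; exact: cst_continuous. Qed.
Lemma ccont_id : ccont (fun z => z).
Proof. by move=> z _; exact: cvg_id. Qed.
Lemma ccontD f g : ccont f -> ccont g -> ccont (fun z => f z + g z).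
Proof. by move=> hb hc z z1; exact: (cvgD (hb z z1) (hc z z1)). Qed.
Lemma ccontB f g : ccont f -> ccont g -> ccont (fun z => f z - g z).
Proof. by move=> hb hc z z1; exact: (cvgB (hb z z1) (hc z z1)). Qed.
Lemma ccontM f g : ccont f -> ccont g -> ccont (fun z => f z * g z).
Proof. by move=> hb hc z z1; exact: (cvgM (hb z z1) (hc z z1)). Qed.
Lemma ccontX f n : ccont f -> ccont (fun z => f z ^+ n).
Proof.
move=> hf; elim: n => [|n IH]; first by under eq_fun do rewrite expr0; exact: ccont_cst.
by under eq_fun do rewrite exprS; exact: ccontM.
Qed.
Lemma ccontV f : ccont f -> (forall z, cmod z = 1 -> f z != 0) -> ccont (fun z => (f z)^-1).
Proof. by move=> hf f0 z z1; exact: (cvgV (f0 z z1) (hf z z1)). Qed.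
Lemma ccont_cexp f : ccont f -> ccont (fun z => cexp (f z)).
Proof. by move=> hf z z1; exact: (continuous_cvg _ (@cexp_continuous _ _) (hf z z1)). Qed.
Lemma ccont_conj f : ccont f -> ccont (fun z => (f z)^*).
Proof. by move=> hf z z1; exact: (continuous_cvg _ (@conj_continuous _) (hf z z1)). Qed.
Lemma ccont_comp_conj f : ccont f -> ccont (fun z => f z^*).
Proof.
move=> hf z z1; apply: (@continuous_comp _ _ _ (fun u : C => u^*) f).
  exact: conj_continuous.
by apply: hf; rewrite cmod_conj.
Qed.
Lemma ccont_horner (q : {poly C}) : ccont (fun z => q.[z]).
Proof.
elim/poly_ind: q => [|q c IH].
  by apply: (@ccont_ext (fun=> 0)); [move=> z; rewrite horner0|exact: ccont_cst].
apply: (@ccont_ext (fun z => q.[z] * z + c)); first by move=> z; rewrite hornerMXaddC.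
exact: (ccontD (ccontM IH ccont_id) (@ccont_cst c)). 
Qed.

Definition ravg b (x : R) : R := (b (ept x) + b (ept x)^*) / 2.
(** The mean for normalized arc length: the image of that measure under the real part is the arcsine
    measure, and [ravg] averages over the two conjugate points above [x]. *)
Definition rmean b : R := rint A (ravg b).
Definition cmean f : C :=
  Complex (rmean (fun z => complex.Re (f z))) (rmean (fun z => complex.Im (f z))).

Lemma ravg_cont b : rcont b -> continuous (ravg b).
Proof.
move=> hb x.
have e1 := cmod_ept x; have e2 : cmod (ept x)^* = 1 by rewrite cmod_conj.
have c1 : {for x, continuous (fun x => b (ept x))}.
  exact: (continuous_cvg _ (hb _ e1) (@ept_continuous x)).
have cc : {for x, continuous (fun x => (ept x)^*)}.
  exact: (continuous_cvg _ (@conj_continuous (ept x)) (@ept_continuous x)).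
have c2 : {for x, continuous (fun x => b (ept x)^*)}.
  exact: (@continuous_comp _ _ _ (fun x => (ept x)^*) b x cc (hb _ e2)).
exact: (cvgM (cvgD c1 c2) (cvg_cst _)).
Qed.

Lemma ravg_intg b : rcont b -> intg A (ravg b).
Proof.
move=> hb; apply: (intg_cont arcsine_fin); apply: continuous_subspaceT.
exact: ravg_cont.
Qed.

Lemma rmeanD b c : rcont b -> rcont c -> rmean (fun z => b z + c z) = rmean b + rmean c.
Proof.
move=> hb hc; rewrite /rmean -rintD; [|exact: ravg_intg|exact: ravg_intg].
by apply: eq_rint => x _; rewrite /ravg; field.
Qed.

Lemma rmeanZ a b : rcont b -> rmean (fun z => a * b z) = a * rmean b.
Proof.
move=> hb; rewrite /rmean -rintZ; last exact: ravg_intg.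
by apply: eq_rint => x _; rewrite /ravg; field.
Qed.

Lemma rmean_cst c : rmean (fun=> c) = c.
Proof. by rewrite -[RHS]rint_arcsine_cst; apply: eq_rint => x _; rewrite /ravg; field. Qed.

Lemma rmeanN b : rcont b -> rmean (fun z => - b z) = - rmean b.
Proof.
move=> hb; rewrite -mulN1r -rmeanZ//; apply: eq_rint => x _.
by rewrite /ravg; congr (_ / _); rewrite !mulN1r.
Qed.

Lemma rmeanB b c : rcont b -> rcont c -> rmean (fun z => b z - c z) = rmean b - rmean c.
Proof.
move=> hb hc; rewrite -rmeanN// -rmeanD// => z z1.
exact: (cvgN (hc z z1)).
Qed.

Lemma le_rmean b c : rcont b -> rcont c -> (forall z, cmod z = 1 -> b z <= c z) ->
  rmean b <= rmean c.
Proof.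
move=> hb hc bc; apply: le_rint; [exact: ravg_intg|exact: ravg_intg|move=> x _].
rewrite /ravg ler_wpM2r// lerD// bc// ?cmod_conj cmod_ept//.
Qed.

Lemma eq_rmean b c : (forall z, cmod z = 1 -> b z = c z) -> rmean b = rmean c.
Proof.
by move=> bc; apply: eq_rint => x _; rewrite /ravg !bc// ?cmod_conj cmod_ept.
Qed.

Lemma rmean_conj b : rmean (fun z => b z^*) = rmean b.
Proof. by apply: eq_rint => x _; rewrite /ravg conjCK addrC. Qed.

Lemma rmean_le_cst b M : rcont b -> (forall z, cmod z = 1 -> b z <= M) -> rmean b <= M.
Proof. by move=> hb bM; rewrite -[leRHS]rmean_cst le_rmean//; exact: rcont_cst. Qed.

Lemma rmean_abs b : rcont b -> `|rmean b| <= rmean (fun z => `|b z|).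
Proof.
move=> hb; have hn := rcont_norm hb.
have hN : rcont (fun z => - b z) by move=> z z1; exact: (cvgN (hb z z1)).
rewrite ler_norml; apply/andP; split; last by apply: le_rmean => // z _; exact: ler_norm.
rewrite lerNl -rmeanN//; apply: le_rmean => // z _.
by rewrite -normrN ler_norm.
Qed.

Lemma cmeanD f g : ccont f -> ccont g -> cmean (fun z => f z + g z) = cmean f + cmean g.
Proof.
move=> hf hg; apply: complex_ext; rewrite ?ReD ?ImD /= -rmeanD;
  try (by apply: rcont_Re || by apply: rcont_Im);
  by apply: eq_rmean => z _; rewrite ?ReD ?ImD.
Qed.

Lemma cmeanZ (a : C) f : ccont f -> cmean (fun z => a * f z) = a * cmean f.
Proof.
move=> hf; have hR := rcont_Re hf; have hI := rcont_Im hf.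
have h (c : R) b : rcont b -> rcont (fun z => c * b z).
  by move=> hb; apply: rcontM => //; exact: rcont_cst.
apply: complex_ext; rewrite ?ReM ?ImM /=.
  rewrite -!rmeanZ// -rmeanB; [|exact: h|exact: h].
  by apply: eq_rmean => z _; rewrite ReM.
rewrite -!rmeanZ// -rmeanD; [|exact: h|exact: h].
by apply: eq_rmean => z _; rewrite ImM.
Qed.

Lemma cmean_cst (c : C) : cmean (fun=> c) = c.
Proof. by apply: complex_ext; rewrite /= rmean_cst. Qed.

Lemma eq_cmean f g : (forall z, cmod z = 1 -> f z = g z) -> cmean f = cmean g.
Proof. by move=> fg; congr Complex; apply: eq_rmean => z z1; rewrite fg. Qed.

Lemma cmeanB f g : ccont f -> ccont g -> cmean (fun z => f z - g z) = cmean f - cmean g.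
Proof.
move=> hf hg; have hN : ccont (fun z => -1 * g z) by exact: (ccontM (@ccont_cst (-1)) hg).
rewrite (@eq_cmean _ (fun z => f z + -1 * g z)); last by move=> z _; rewrite mulN1r.
by rewrite (cmeanD hf hN) (cmeanZ _ hg) mulN1r.
Qed.

Lemma cmean_conj f : cmean (fun z => f z^*) = cmean f.
Proof.
congr Complex; first exact: (rmean_conj (fun z => complex.Re (f z))).
exact: (rmean_conj (fun z => complex.Im (f z))).
Qed.

(* The factor 2 comes from estimating the real and imaginary parts separately. *)
Lemma cmean_le f b : ccont f -> rcont b -> (forall z, cmod z = 1 -> cmod (f z) <= b z) ->
  cmod (cmean f) <= 2 * rmean b.
Proof.
move=> hf hb fb; have hR := rcont_Re hf; have hI := rcont_Im hf.
have hn := rcont_norm.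
apply: le_trans (cmod_le_ReIm _) _ => /=.
have h1 := rmean_abs hR; have h2 := rmean_abs hI.
have h3 : rmean (fun z => `|complex.Re (f z)|) <= rmean b.
  apply: le_rmean => //; first exact: hn.
  by move=> z z1; apply: le_trans (Re_le_cmod _) (fb z z1).
have h4 : rmean (fun z => `|complex.Im (f z)|) <= rmean b.
  apply: le_rmean => //; first exact: hn.
  by move=> z z1; apply: le_trans (Im_le_cmod _) (fb z z1).
lra.
Qed.

Lemma cmean_le_cst f M : ccont f -> (forall z, cmod z = 1 -> cmod (f z) <= M) ->
  cmod (cmean f) <= 2 * M.
Proof.
by move=> hf fM; rewrite -[M in leRHS]rmean_cst; apply: cmean_le => //; exact: rcont_cst.
Qed.

Lemma rint_cos k : rint A (fun x => cos (k.+1%:R * acos x)) = 0.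
Proof.
have ic : intg A (fun x => cos (k.+1%:R * acos x)).
  have rc : rcont (fun z => complex.Re (z ^+ k.+1)).
    by apply: rcont_Re; apply: ccontX; exact: ccont_id.
  apply: eq_intg (ravg_intg rc) => x /[!inE] xI.
  by rewrite /ravg -rmorphXn /= Re_conj eptX//=; field.
have := @integral_arcsine_cos R k 1 ler01 (lexx _).
rewrite -rintE; last first.
  by apply: intgD; [exact: (intg_cst arcsine_fin)|exact: intgZ].
move=> [] /eqP; rewrite rintD ?rint_arcsine_cst; last 2 first.
- exact: (intg_cst arcsine_fin).
- exact: intgZ.
by rewrite rintZ// mul1r addrC -subr_eq0 addrK => /eqP.
Qed.

(** The imaginary parts at conjugate points cancel, and the real part is a Chebyshev polynomial of
    positive degree. The mean value property and Cauchy's formula rest on this. *)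
Lemma cmeanX k : cmean (fun z => z ^+ k.+1) = 0.
Proof.
apply: complex_ext => /=.
  rewrite -[RHS](rint_cos k); apply: eq_rint => x /[!inE] xI.
  by rewrite /ravg -rmorphXn /= Re_conj eptX//=; field.
rewrite -[RHS](rint_arcsine_cst 0); apply: eq_rint => x /[!inE] xI.
by rewrite /ravg -rmorphXn /= Im_conj subrr mul0r.
Qed.

End CircleMean.


(** * The disk algebra and Cauchy's formula *)

Section DiskAlgebra.
Variable R : realType.
Local Notation C := (Cplx R).
Implicit Types (f g : C -> C) (z u : C).
Local Notation cp := (map_poly (@toC R)).

(** Uniform approximability by polynomials, rather than holomorphy, is taken as the definition:
    identities checked on polynomials then pass to the limit. *)
Definition disk_alg f := forall e : R, 0 < e ->
  exists q : {poly C}, forall z, cmod z <= 1 -> cmod (f z - q.[z]) <= e.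
Definition rdisk_alg f := forall e : R, 0 < e ->
  exists q : {poly R}, forall z, cmod z <= 1 -> cmod (f z - (cp q).[z]) <= e.

Lemma rdisk_alg_sub f : rdisk_alg f -> disk_alg f.
Proof. by move=> H e /H[q Hq]; exists (cp q). Qed.

Lemma disk_alg_poly (q : {poly C}) : disk_alg (horner q).
Proof. by move=> e e0; exists q => z _; rewrite subrr cmod0 ltW. Qed.

Lemma disk_alg_ext f g : (forall z, cmod z <= 1 -> f z = g z) -> disk_alg f -> disk_alg g.
Proof. by move=> fg H e /H[q Hq]; exists q => z z1; rewrite -fg// Hq. Qed.

Lemma poly_bounded (q : {poly C}) :
  exists2 M : R, 0 < M & forall z, cmod z <= 1 -> cmod q.[z] <= M.
Proof.
elim/poly_ind: q => [|q c [M M0 HM]].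
  by exists 1 => // z _; rewrite horner0 cmod0.
exists (M + cmod c + 1); first by rewrite ltr_pwDr// addr_ge0 ?cmod_ge0 ?ltW.
move=> z z1; rewrite hornerMXaddC; apply: le_trans (cmodD _ _) _.
have : cmod (q.[z] * z) <= M * 1.
  by rewrite cmodM; apply: ler_pM; rewrite ?cmod_ge0// HM.
lra.
Qed.

Lemma disk_alg_bounded f : disk_alg f ->
  exists2 M : R, 0 < M & forall z, cmod z <= 1 -> cmod (f z) <= M.
Proof.
move=> /(_ 1 ltr01)[q Hq]; have [M M0 HM] := poly_bounded q.
exists (M + 1); first by rewrite ltr_pwDr// ltW.
move=> z z1; have := cmod_dist (f z) q.[z]; have := Hq z z1; have := HM z z1; lra.
Qed.

Lemma disk_algD f g : disk_alg f -> disk_alg g -> disk_alg (fun z => f z + g z).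
Proof.
move=> Hf Hg e e0; have [p Hp] := Hf _ (divr_gt0 e0 (ltr0n R 2)).
have [q Hq] := Hg _ (divr_gt0 e0 (ltr0n R 2)); exists (p + q) => z z1.
rewrite hornerD opprD addrACA; apply: le_trans (cmodD _ _) _.
have := Hp z z1; have := Hq z z1; lra.
Qed.

Lemma disk_algM f g : disk_alg f -> disk_alg g -> disk_alg (fun z => f z * g z).
Proof.
move=> Hf Hg e e0; have [M M0 HM] := disk_alg_bounded Hf.
have [q Hq] := Hg (e / 2 / M) ltac:(by rewrite !divr_gt0).
have [L L0 HL] := poly_bounded q.
have [p Hp] := Hf (e / 2 / L) ltac:(by rewrite !divr_gt0).
exists (p * q) => z z1; rewrite hornerM.
have -> : f z * g z - p.[z] * q.[z] = f z * (g z - q.[z]) + (f z - p.[z]) * q.[z] by ring.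
apply: le_trans (cmodD _ _) _; rewrite !cmodM.
have h1 : cmod (f z) * cmod (g z - q.[z]) <= M * (e / 2 / M).
  by apply: ler_pM; rewrite ?cmod_ge0 ?HM ?Hq.
have h2 : cmod (f z - p.[z]) * cmod q.[z] <= e / 2 / L * L.
  by apply: ler_pM; rewrite ?cmod_ge0 ?HL ?Hp.
rewrite [M * _]mulrC divfK ?lt0r_neq0// in h1; rewrite divfK ?lt0r_neq0// in h2; lra.
Qed.

Lemma disk_alg_cst (c : C) : disk_alg (fun=> c).
Proof.
by apply: disk_alg_ext (disk_alg_poly c%:P) => z _; rewrite hornerC.
Qed.

Lemma disk_alg_id : disk_alg id.
Proof.
by apply: disk_alg_ext (disk_alg_poly 'X) => z _; rewrite hornerX.
Qed.

Lemma exists_expr_lt (r e : R) : 0 <= r -> r < 1 -> 0 < e -> exists m, r ^+ m < e.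
Proof.
move=> r0 r1 e0; have : `|r| < 1 by rewrite ger0_norm.
move=> /cvg_expr/cvgrPdist_lt/(_ e e0)/filter_ex[m].
by rewrite sub0r normrN ger0_norm ?exprn_ge0// => ?; exists m.
Qed.

Lemma cmod_1B_ge (b z : C) : cmod z <= 1 -> 1 - cmod b <= cmod (1 - b * z).
Proof.
move=> z1; have := cmod_dist 1 (b * z); rewrite cmod1 cmodM.
have : cmod b * cmod z <= cmod b * 1 by rewrite ler_wpM2l ?cmod_ge0.
lra.
Qed.

Lemma neq0_1B (b z : C) : cmod b < 1 -> cmod z <= 1 -> 1 - b * z != 0.
Proof.
by move=> b1 z1; rewrite -cmod_gt0; apply: lt_le_trans (cmod_1B_ge b z1); rewrite subr_gt0.
Qed.

Lemma neq0_1Br (b z : C) : cmod b <= 1 -> cmod z < 1 -> 1 - b * z != 0.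
Proof. by move=> b1 z1; rewrite mulrC neq0_1B. Qed.

Lemma disk_alg_geometric (b : C) : cmod b < 1 -> disk_alg (fun z => (1 - b * z)^-1).
Proof.
move=> b1 e e0; have d0 : 0 < 1 - cmod b by rewrite subr_gt0.
have [m Hm] := exists_expr_lt (cmod_ge0 b) b1 (mulr_gt0 e0 d0).
exists (\sum_(k < m) (b *: 'X) ^+ k) => z z1.
have nz := neq0_1B b1 z1.
have -> : (1 - b * z)^-1 - (\sum_(k < m) (b *: 'X) ^+ k).[z] = (b * z) ^+ m / (1 - b * z).
  apply: (mulIf nz); rewrite mulrBl mulVf// divfK//.
  have -> : (\sum_(k < m) (b *: 'X) ^+ k).[z] = \sum_(k < m) (b * z) ^+ k.
    by rewrite horner_sum; apply: eq_bigr => k _; rewrite horner_exp hornerZ hornerX.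
  have E := subrXX 1 (b * z) m; rewrite expr1n in E.
  have F : \sum_(i < m) 1 ^+ (m.-1 - i) * (b * z) ^+ i = \sum_(k < m) (b * z) ^+ k.
    by apply: eq_bigr => k _; rewrite expr1n mul1r.
  by rewrite F in E; rewrite [_ * (1 - b * z)]mulrC -E; ring.
rewrite cmodM cmodX cmodV ler_pdivrMr ?cmod_gt0//.
apply: le_trans (_ : cmod b ^+ m <= _).
  rewrite lerXn2r ?nnegrE ?cmod_ge0// cmodM -[leRHS]mulr1.
  by rewrite ler_wpM2l ?cmod_ge0.
by apply: le_trans (ltW Hm) _; apply: ler_wpM2l; [exact: ltW|exact: cmod_1B_ge].
Qed.

Lemma rdisk_alg_cexp (q : {poly R}) : rdisk_alg (fun z => cexp (cp q).[z]).
Proof.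
move=> e e0; have [M M0 HM] := poly_bounded (cp q).
pose L := 4 * M ^+ 2 * expR M.
(* The summand [2 M] meets the hypothesis of [cexp_euler]; the summand [L / e] makes its error
   [L / m.+1] at most [e]. *)
pose m := Num.truncn (2 * M + L / e).
have L0 : 0 < L by rewrite !mulr_gt0 ?exprn_gt0 ?expR_gt0.
have mE : 2 * M + L / e < m.+1%:R by exact: truncnS_gt.
have Le : 0 < L / e by rewrite divr_gt0.
exists ((1 + m.+1%:R^-1 *: q) ^+ m.+1) => z z1.
have -> : (cp ((1 + m.+1%:R^-1 *: q) ^+ m.+1)).[z] =
    (1 + toC m.+1%:R^-1 * (cp q).[z]) ^+ m.+1.
  by rewrite rmorphXn rmorphD rmorph1 /= map_polyZ horner_exp hornerD hornerZ hornerC.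
have h := HM z z1; apply: le_trans (cexp_euler _) _; first by lra.
rewrite ler_pdivrMr ?ltr0n//.
apply: (@le_trans _ _ L).
  have i1 : cmod (cp q).[z] ^+ 2 <= M ^+ 2 by rewrite lerXn2r// nnegrE ?cmod_ge0 ?ltW.
  have i2 : expR (cmod (cp q).[z]) <= expR M by rewrite ler_expR.
  have i0 := sqr_ge0 (cmod (cp q).[z]).
  by rewrite /L; apply: ler_pM; rewrite ?expR_ge0//; lra.
rewrite -ler_pdivrMl//; rewrite mulrC; lra.
Qed.

Lemma rdisk_algM f g : rdisk_alg f -> rdisk_alg g -> rdisk_alg (fun z => f z * g z).
Proof.
move=> Hf Hg e e0; have [M M0 HM] := disk_alg_bounded (rdisk_alg_sub Hf).
have [q Hq] := Hg (e / 2 / M) ltac:(by rewrite !divr_gt0).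
have [L L0 HL] := poly_bounded (cp q).
have [p Hp] := Hf (e / 2 / L) ltac:(by rewrite !divr_gt0).
exists (p * q) => z z1; rewrite rmorphM hornerM.
have -> : f z * g z - (cp p).[z] * (cp q).[z] = f z * (g z - (cp q).[z]) + (f z - (cp p).[z]) * (cp q).[z] by ring.
apply: le_trans (cmodD _ _) _; rewrite !cmodM.
have h1 : cmod (f z) * cmod (g z - (cp q).[z]) <= M * (e / 2 / M).
  by apply: ler_pM; rewrite ?cmod_ge0 ?HM ?Hq.
have h2 : cmod (f z - (cp p).[z]) * cmod (cp q).[z] <= e / 2 / L * L.
  by apply: ler_pM; rewrite ?cmod_ge0 ?HL ?Hp.
rewrite [M * _]mulrC divfK ?lt0r_neq0// in h1; rewrite divfK ?lt0r_neq0// in h2; lra.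
Qed.

Lemma rdisk_algXn k : rdisk_alg (fun z => z ^+ k).
Proof.
move=> e e0; exists 'X^k => z _.
by rewrite map_polyXn hornerXn subrr cmod0 ltW.
Qed.

Lemma eq_cmod_small (a b : C) : (forall e : R, 0 < e -> cmod (a - b) <= e) -> a = b.
Proof.
move=> H; apply/eqP; rewrite -subr_eq0 -cmod_eq0 eq_le cmod_ge0 andbT.
by apply/ler_addgt0Pr => e e0; rewrite add0r H.
Qed.

Lemma cmean_horner (q : {poly C}) : cmean (horner q) = q.[0].
Proof.
rewrite (_ : horner q = fun z => \sum_(k < size q) q`_k * z ^+ k); last first.
  by apply/funext => z; rewrite horner_coef.
have H n : cmean (fun z => \sum_(k < n.+1) q`_k * z ^+ k) = q`_0 /\
    ccont (fun z => \sum_(k < n.+1) q`_k * z ^+ k).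
  elim: n => [|n [IH cIH]].
    under eq_fun do rewrite big_ord_recl big_ord0 expr0 mulr1 addr0.
    by split; [exact: cmean_cst|exact: ccont_cst].
  under eq_fun do rewrite big_ord_recr /=.
  have cX : ccont (fun z => q`_n.+1 * z ^+ n.+1).
exact: (ccontM (@ccont_cst _ q`_n.+1) (@ccontX _ _ n.+1 (@ccont_id R))).
  split; last exact: (ccontD cIH cX).
  rewrite (cmeanD cIH cX) IH (cmeanZ _ (@ccontX _ _ n.+1 (@ccont_id R))).
  by rewrite cmeanX mulr0 addr0.
case E : (size q) => [|n].
  under eq_fun do rewrite big_ord0; rewrite cmean_cst.
  by rewrite big_ord0.
rewrite (H n).1 big_ord_recl expr0 mulr1 big1 ?addr0// => k _.
by rewrite exprS mul0r mulr0.
Qed.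

Lemma cmean_disk_alg f : disk_alg f -> ccont f -> cmean f = f 0.
Proof.
move=> Hf cf; apply: eq_cmod_small => e e0.
have [q Hq] := Hf (e / 3) ltac:(by rewrite divr_gt0).
have cq := @ccont_horner _ q.
have z0 : cmod (0 : C) <= 1 by rewrite cmod0 ler01.
have h1 : cmod (cmean f - cmean (horner q)) <= 2 * (e / 3).
  rewrite -(cmeanB cf cq); apply: (cmean_le_cst (ccontB cf cq)).
  by move=> z z1; apply: Hq; rewrite z1.
have := cmod_tri (cmean f) q.[0] (f 0); rewrite -(cmean_horner q).
have := Hq 0 z0; rewrite cmodBC cmean_horner => h2 h3.
rewrite cmean_horner in h1; lra.
Qed.

Lemma ccont_kernel (z : C) : cmod z < 1 -> ccont (fun u => (1 - z * u^*)^-1).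
Proof.
move=> z1; apply: ccontV.
  exact: (ccontB (@ccont_cst _ 1) (ccontM (@ccont_cst _ z) (ccont_conj (@ccont_id R)))).
by move=> u u1; apply: neq0_1B; rewrite ?cmod_conj ?u1.
Qed.

Lemma ccont_geometric (z : C) : cmod z < 1 -> ccont (fun u => (1 - z * u)^-1).
Proof.
move=> z1; apply: ccontV.
  exact: (ccontB (@ccont_cst _ 1) (ccontM (@ccont_cst _ z) (@ccont_id R))).
by move=> u u1; apply: neq0_1B; rewrite ?u1.
Qed.

Lemma cmean_kernel1 (z : C) : cmod z < 1 -> cmean (fun u => (1 - z * u^*)^-1) = 1.
Proof.
move=> z1; rewrite -(cmean_conj (fun u => (1 - z * u^*)^-1)).
rewrite (@eq_cmean _ _ (fun u => (1 - z * u)^-1)); last by move=> u _; rewrite conjCK.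
rewrite (cmean_disk_alg (disk_alg_geometric z1) (ccont_geometric z1)).
by rewrite mulr0 subr0 invr1.
Qed.

(** On the circle [u^* = 1 / u], hence [1 - z u^* = (u - z) / u]. Dividing [q - q.[z]] by [u - z]
    leaves [u s(u)], of mean [0], and a multiple of the kernel, of mean [1]. *)
Lemma cmean_kernel_poly (q : {poly C}) (z : C) : cmod z < 1 ->
  cmean (fun u => q.[u] * (1 - z * u^*)^-1) = q.[z].
Proof.
move=> z1; have ck := ccont_kernel z1.
have /factor_theorem[s qs] : root (q - q.[z]%:P) z by rewrite /root !hornerE subrr.
have qE u : q.[u] = s.[u] * (u - z) + q.[z].
  by have := congr1 (horner^~ u) qs; rewrite !hornerE => <-; rewrite subrK.
rewrite (@eq_cmean _ _ (fun u => u * s.[u] + q.[z] * (1 - z * u^*)^-1)); last first.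
  move=> u u1; rewrite qE mulrDl; congr (_ + _).
  have u0 := circle_neq0 u1; rewrite conj_circle//.
  have nz : u - z != 0.
    by rewrite subr_eq0; apply/eqP => uz; move: z1; rewrite -uz u1 ltxx.
  have -> : 1 - z * u^-1 = (u - z) / u by rewrite mulrBl divff.
  by rewrite invf_div mulrA -[s.[u] * (u - z) * u]mulrAC mulfK// mulrC.
have c1 := ccontM (@ccont_id R) (@ccont_horner _ s).
have c2 := ccontM (@ccont_cst _ q.[z]) ck.
rewrite (cmeanD c1 c2) (cmeanZ _ ck) (cmean_kernel1 z1) mulr1.
rewrite (@eq_cmean _ _ (horner ('X * s))); last by move=> u _; rewrite hornerM hornerX.
by rewrite cmean_horner hornerM hornerX mul0r add0r.
Qed.

Lemma cmod_kernel_le (z u : C) (r : R) : cmod z <= r -> r < 1 -> cmod u = 1 ->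
  cmod (1 - z * u^*)^-1 <= (1 - r)^-1.
Proof.
move=> zr r1 u1; rewrite cmodV lef_pV2 ?posrE ?subr_gt0//.
  by have := @cmod_1B_ge z u^* _; rewrite cmod_conj u1 lexx => /(_ isT); lra.
rewrite cmod_gt0 neq0_1B ?cmod_conj ?u1//; exact: le_lt_trans r1.
Qed.

Lemma cmean_kernel f (z : C) : disk_alg f -> ccont f -> cmod z < 1 ->
  cmean (fun u => f u * (1 - z * u^*)^-1) = f z.
Proof.
move=> Hf cf z1; apply: eq_cmod_small => e e0.
have d0 : 0 < 1 - cmod z by rewrite subr_gt0.
(* The first term is the kernel bound with the factor 2 of [cmean_le_cst], the second accounts for
   the error at [z] itself; the errors then add up to [e]. *)
pose L := 2 / (1 - cmod z) + 1.
have L0 : 0 < L by rewrite ltr_pwDr// divr_ge0// ltW.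
have [q Hq] := Hf (e / L) ltac:(by rewrite divr_gt0).
have ck := ccont_kernel z1; have cq := @ccont_horner _ q.
have h1 : cmod (cmean (fun u => f u * (1 - z * u^*)^-1) - q.[z]) <= 2 * (e / L * (1 - cmod z)^-1).
  rewrite -(cmean_kernel_poly _ z1) -(cmeanB (ccontM cf ck) (ccontM cq ck)).
  apply: (cmean_le_cst (ccontB (ccontM cf ck) (ccontM cq ck))).
  move=> u u1; rewrite -mulrBl cmodM; apply: ler_pM; rewrite ?cmod_ge0//.
    by rewrite Hq ?u1.
  exact: cmod_kernel_le.
have h2 := Hq z (ltW z1); rewrite cmodBC in h2.
have h3 := cmod_tri (cmean (fun u => f u * (1 - z * u^*)^-1)) q.[z] (f z).
have : 2 * (e / L * (1 - cmod z)^-1) + e / L = e.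
  rewrite /L; field; rewrite ?lt0r_neq0//; last by lra.
lra.
Qed.

End DiskAlgebra.


(** * Approximation by Cauchy kernels with real parameters *)

Section KernelApproximation.
Variable R : realType.
Local Notation C := (Cplx R).
Implicit Types (f g : C -> C) (z u : C) (s : seq (R * R)).
Local Notation cp := (map_poly (@toC R)).

Definition kcomb s z : C := \sum_(p <- s) toC p.1 / (1 - toC p.2 * z).
Definition kadm s := all (fun p : R * R => (p.2 != 0) && (`|p.2| < 1)) s.
Definition kapx f := forall e : R, 0 < e -> exists2 s, kadm s &
  forall z, cmod z <= 1 -> cmod (f z - kcomb s z) <= e.

Lemma kapx_lim f : (forall e : R, 0 < e -> exists2 g, kapx g &
  forall z, cmod z <= 1 -> cmod (f z - g z) <= e) -> kapx f.
Proof.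
move=> H e e0; have [g Hg fg] := H _ (divr_gt0 e0 (ltr0n R 2)).
have [s sa Hs] := Hg _ (divr_gt0 e0 (ltr0n R 2)); exists s => // z z1.
have := cmod_tri (f z) (g z) (kcomb s z); have := fg z z1; have := Hs z z1; lra.
Qed.

Lemma kapx_ext f g : (forall z, cmod z <= 1 -> f z = g z) -> kapx f -> kapx g.
Proof. by move=> fg H e /H[s sa Hs]; exists s => // z z1; rewrite -fg// Hs. Qed.

Lemma kapxD f g : kapx f -> kapx g -> kapx (fun z => f z + g z).
Proof.
move=> Hf Hg e e0; have [s sa Hs] := Hf _ (divr_gt0 e0 (ltr0n R 2)).
have [t ta Ht] := Hg _ (divr_gt0 e0 (ltr0n R 2)); exists (s ++ t).
  by rewrite /kadm all_cat; apply/andP.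
move=> z z1; rewrite /kcomb big_cat opprD addrACA; apply: le_trans (cmodD _ _) _.
have := Hs z z1; have := Ht z z1; rewrite /kcomb; lra.
Qed.

Lemma kapxZ (a : R) f : kapx f -> kapx (fun z => toC a * f z).
Proof.
move=> Hf e e0; have a0 : 0 < `|a| + 1 by rewrite ltr_pwDr.
have [s sa Hs] := Hf _ (divr_gt0 e0 a0).
exists (map (fun p => (a * p.1, p.2)) s).
  by rewrite /kadm all_map; apply: sub_all sa => p.
move=> z z1; rewrite /kcomb big_map.
rewrite (_ : \sum_(p <- s) _ = toC a * kcomb s z); last first.
  by rewrite mulr_sumr; apply: eq_bigr => p _; rewrite rmorphM mulrA.
rewrite -mulrBr cmodM cmod_toC; have := Hs z z1.
rewrite ler_pdivlMr// => h; apply: le_trans h; rewrite mulrC ler_wpM2l ?cmod_ge0//.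
by rewrite lerDl.
Qed.

Lemma kapx0 : kapx (fun=> 0).
Proof.
by move=> e e0; exists [::] => // z _; rewrite /kcomb big_nil subr0 cmod0 ltW.
Qed.

Lemma kapx_sum n (F : nat -> C -> C) : (forall k, (k < n)%N -> kapx (F k)) ->
  kapx (fun z => \sum_(k < n) F k z).
Proof.
elim: n => [|n IH] H.
  by apply: kapx_ext kapx0 => z _; rewrite big_ord0.
apply: (@kapx_ext (fun z => \sum_(k < n) F k z + F n z)).
  by move=> z _; rewrite big_ord_recr.
by apply: kapxD; [apply: IH => k kn; apply: H; exact: ltnW|exact: H].
Qed.

Lemma kapx_kernel (c : R) : c != 0 -> `|c| < 1 -> kapx (fun z => (1 - toC c * z)^-1).
Proof.
move=> c0 c1 e e0; exists [:: (1, c)]; first by rewrite /kadm /= c0 c1.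
by move=> z _; rewrite /kcomb big_seq1 rmorph1 mul1r subrr cmod0 ltW.
Qed.

(* [z^k / (1 - c z)] tends to [z^k] as [c] tends to [0], and it is a combination
   of [1 / (1 - c z)] and of lower powers of [z]. *)
Lemma kapxX k : kapx (fun z => z ^+ k).
Proof.
elim/ltn_ind: k => k IH; apply: kapx_lim => e e0.
(* Chosen so that [c / (1 - c) <= e], a bound for the distance from [z^k] to [z^k / (1 - c z)]. *)
pose c : R := e / (1 + e) / 2.
have c0 : 0 < c by rewrite !divr_gt0// ltr_pwDl// ltW.
have ce : c / (1 - c) <= e.
  have ee : 0 < 1 + e by lra.
  have h : c * (1 + e) * 2 = e by rewrite /c; field; rewrite lt0r_neq0.
  have c1 : c < 1 by nra.
  rewrite ler_pdivrMr ?subr_gt0//; nra.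
have c1 : `|c| < 1.
  rewrite gtr0_norm//; have ee : 0 < 1 + e by lra.
  have h : c * (1 + e) * 2 = e by rewrite /c; field; rewrite lt0r_neq0.
  nra.
have cc1 : cmod (toC c) < 1 by rewrite cmod_toC.
exists (fun z => z ^+ k / (1 - toC c * z)).
  apply: (@kapx_ext (fun z => toC (c ^- k) * ((1 - toC c * z)^-1 +
     toC (-1) * (\sum_(j < k) toC (c ^+ j) * z ^+ j)))).
    move=> z z1; have nz := neq0_1B cc1 z1.
    have E := subrXX 1 (toC c * z) k; rewrite expr1n in E.
    have F : \sum_(i < k) 1 ^+ (k.-1 - i) * (toC c * z) ^+ i = \sum_(j < k) toC (c ^+ j) * z ^+ j.
      by apply: eq_bigr => j _; rewrite expr1n mul1r exprMn rmorphXn.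
    rewrite F in E; rewrite fmorphV rmorphXn /= rmorphN1.
    have ck0 : toC c ^+ k != 0 by rewrite expf_neq0// -cmod_gt0 cmod_toC gtr0_norm.
    have SE : \sum_(j < k) toC (c ^+ j) * z ^+ j = (1 - toC c ^+ k * z ^+ k) / (1 - toC c * z).
      by apply: (mulIf nz); rewrite divfK// mulrC -E exprMn.
    rewrite SE; move: (toC c ^+ k) (1 - toC c * z) (z ^+ k) ck0 nz => X D Y X0 D0.
    by field; rewrite X0 D0.
  apply: kapxZ; apply: kapxD; first by apply: kapx_kernel => //; exact: lt0r_neq0.
  apply: kapxZ; apply: (kapx_sum (F := fun j z => toC (c ^+ j) * z ^+ j)) => j jk.
  by apply: kapxZ; exact: IH.
move=> z z1; have nz := neq0_1B cc1 z1.
have -> : z ^+ k - z ^+ k / (1 - toC c * z) = - (z ^+ k * (toC c * z)) / (1 - toC c * z).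
  by apply: (mulIf nz); rewrite mulrBl !divfK//; ring.
rewrite mulNr cmodN cmodM cmodV; apply: le_trans ce.
apply: ler_pM; rewrite ?cmod_ge0 ?invr_ge0 ?cmod_ge0//.
  rewrite !cmodM cmodX cmod_toC (gtr0_norm c0).
  have k1 : cmod z ^+ k <= 1 by rewrite exprn_ile1// cmod_ge0.
  have Kr : cmod z ^+ k * cmod z <= 1 by rewrite mulr_ile1 ?exprn_ge0 ?cmod_ge0.
  by rewrite mulrCA; apply: ler_piMr => //; exact: ltW.
rewrite lef_pV2 ?posrE ?cmod_gt0 ?subr_gt0//; last by rewrite -(gtr0_norm c0).
by have := cmod_1B_ge (toC c) z1; rewrite cmod_toC (gtr0_norm c0).
Qed.

Lemma kapx_rdisk_alg f : rdisk_alg f -> kapx f.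
Proof.
move=> Hf; apply: kapx_lim => e /Hf[q Hq]; exists (horner (cp q)) => //.
apply: (@kapx_ext (fun z => \sum_(k < size q) toC q`_k * z ^+ k)).
  move=> z _; rewrite horner_coef size_map_poly.
  by apply: eq_bigr => k _; rewrite coef_map.
apply: (kapx_sum (F := fun k z => toC q`_k * z ^+ k)) => k _.
by apply: kapxZ; exact: kapxX.
Qed.

End KernelApproximation.

(** * Splitting a polynomial in [Re z] into analytic halves *)

Section HalfAnalytic.
Variable R : realType.
Local Notation C := (Cplx R).
Implicit Types (z u : C) (p q : {poly R}).
Local Notation cp := (map_poly (@toC R)).

Lemma horner_cp_toC p (x : R) : (cp p).[toC x] = toC p.[x].
Proof. by rewrite horner_map. Qed.

Lemma horner_cp_conj p z : (cp p).[z^*] = ((cp p).[z])^*.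
Proof.
rewrite !horner_coef rmorph_sum /=; apply: eq_bigr => k _.
by rewrite coef_map rmorphM rmorphXn /= conj_toC.
Qed.

(** A symmetric Laurent polynomial is its part in [z] plus the same part in [1 / z], the constant
    term being shared equally. On the circle this reads [p = 2 Re q], so that [exp q] has squared
    modulus [exp p]. *)
Lemma half_analytic p : exists q : {poly R}, forall z, z != 0 ->
  (cp p).[(z + z^-1) / 2] = (cp q).[z] + (cp q).[z^-1].
Proof.
elim/poly_ind: p => [|p c [q Hq]].
  by exists 0 => z _; rewrite !rmorph0 !horner0 addr0.
have [q' [d qE]] : exists q' d, q = q' * 'X + d%:P.
  elim/poly_ind: q {Hq} => [|q' d _]; last by exists q', d.
  by exists 0, 0; rewrite mul0r addr0.
have QE z : (cp q).[z] = (cp q').[z] * z + toC d.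
  by rewrite qE rmorphD rmorphM /= map_polyX map_polyC hornerMXaddC.
(* Multiplication by [(z + 1/z) / 2] produces [q(z) / z = q'(z) + d / z]; the polar term [d / z]
   belongs to the half in [1 / z], which by symmetry accounts for [d *: 'X]. *)
exists (2^-1 *: (q * 'X + q' + d *: 'X) + (c / 2)%:P) => z z0.
have LE u : (cp (p * 'X + c%:P)).[u] = (cp p).[u] * u + toC c.
  by rewrite rmorphD rmorphM /= map_polyX map_polyC hornerMXaddC.
have NE u : (cp (2^-1 *: (q * 'X + q' + d *: 'X) + (c / 2)%:P)).[u] =
    toC 2^-1 * ((cp q).[u] * u + (cp q').[u] + toC d * u) + toC (c / 2).
  rewrite rmorphD /= map_polyC map_polyZ /= !rmorphD /= rmorphM /= map_polyX map_polyZ /= map_polyX.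
  by rewrite !(hornerD, hornerZ, hornerM, hornerX, hornerC).
rewrite LE !NE Hq// !QE fmorphV rmorphM fmorphV rmorph_nat.
by field; rewrite z0.
Qed.

Lemma half_analytic_circle p : exists q : {poly R}, forall z, cmod z = 1 ->
  p.[complex.Re z] = 2 * complex.Re (cp q).[z].
Proof.
have [q Hq] := half_analytic p; exists q => z z1.
have := Hq z (circle_neq0 z1); rewrite -conj_circle// horner_cp_conj.
have -> : (z + z^*) / 2 = toC (complex.Re z).
  by rewrite -toC_nat -fmorphV; apply: complex_ext; rewrite !ReImE /=; field.
by rewrite horner_cp_toC => /(congr1 (@complex.Re R)); rewrite ReD Re_conj Re_toC => ->; ring.
Qed.

End HalfAnalytic.


(** * Blaschke products, outer functions and the phase *)

Section Blaschke.
Variable R : realType.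
Local Notation C := (Cplx R).
Implicit Types (z u b : C) (bs : seq C).
Local Notation cp := (map_poly (@toC R)).

Definition in_disk bs := all (fun b => cmod b < 1) bs.
Definition conj_sym bs := perm_eq (map (@Num.conj C) bs) bs.
Definition blaschke bs z : C := \prod_(b <- bs) ((z - b) / (1 - b^* * z)).
Definition bden bs z : C := \prod_(b <- bs) (1 - b * z).
Definition deficit bs : R := \sum_(b <- bs) (1 - cmod b).

Lemma bden_conjE bs z : conj_sym bs -> \prod_(b <- bs) (1 - b^* * z) = bden bs z.
Proof.
by move=> sb; rewrite /bden -[RHS](perm_big _ sb) big_map.
Qed.

Lemma bden_conj bs z : conj_sym bs -> bden bs z^* = (bden bs z)^*.
Proof.
move=> sb; rewrite -(bden_conjE _ sb) /bden rmorph_prod /=.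
by apply: eq_bigr => b _; rewrite rmorphB rmorph1 rmorphM.
Qed.

Lemma bden_neq0 bs z : in_disk bs -> cmod z <= 1 -> bden bs z != 0.
Proof.
move=> /allP db z1; rewrite /bden prodf_seq_neq0; apply/allP => b /db b1.
exact: neq0_1B.
Qed.

Lemma blaschkeE bs z : conj_sym bs ->
  blaschke bs z = (\prod_(b <- bs) (z - b)) / bden bs z.
Proof. by move=> sb; rewrite /blaschke prodf_div bden_conjE. Qed.

Lemma blaschke_circle bs z : in_disk bs -> cmod z = 1 -> cmod (blaschke bs z) = 1.
Proof.
move=> /allP db z1; rewrite /blaschke cmod_prod big_seq big1// => b /db b1.
have -> : 1 - b^* * z = z * (z - b)^*.
  by rewrite rmorphB mulrBr mul_conj z1 expr1n rmorph1 mulrC.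
rewrite cmodM cmodV cmodM z1 mul1r cmod_conj divff// cmod_eq0 subr_eq0.
by apply/eqP => zb; move: b1; rewrite -zb z1 ltxx.
Qed.

Lemma blaschke_bden bs z : in_disk bs -> conj_sym bs -> cmod z = 1 ->
  blaschke bs z = z ^+ size bs * bden bs z^* / bden bs z.
Proof.
move=> db sb z1; rewrite blaschkeE//; congr (_ / _).
rewrite /bden; elim: bs {db sb} => [|b bs IH]; first by rewrite !big_nil expr0 mul1r.
rewrite !big_cons IH /= exprS conj_circle// mulrACA; congr (_ * _).
by rewrite mulrBr mulr1 mulrCA divff ?mulr1// circle_neq0.
Qed.

Lemma blaschke_disk_alg bs : in_disk bs -> disk_alg (blaschke bs).
Proof.
rewrite /in_disk; elim: bs => [_|b bs IH /andP[b1 /IH Hb]].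
  apply: disk_alg_ext (@disk_alg_cst _ 1) => z _; by rewrite /blaschke big_nil.
apply: (@disk_alg_ext _ (fun z => (z + - b) * (1 - b^* * z)^-1 * blaschke bs z)).
  by move=> z _; rewrite /blaschke big_cons.
apply: disk_algM Hb; apply: disk_algM.
  apply: (disk_algD (@disk_alg_id _) (@disk_alg_cst _ (- b))).
by apply: disk_alg_geometric; rewrite cmod_conj.
Qed.

Lemma blaschke_ccont bs : in_disk bs -> ccont (blaschke bs).
Proof.
rewrite /in_disk; elim: bs => [_|b bs IH /andP[b1 /IH Hb]].
  by apply: ccont_ext (@ccont_cst _ 1) => z; rewrite /blaschke big_nil.
apply: (@ccont_ext _ (fun z => (z - b) * (1 - b^* * z)^-1 * blaschke bs z)).
  by move=> z; rewrite /blaschke big_cons.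
have b1' : cmod b^* < 1 by rewrite cmod_conj.
exact: (ccontM (ccontM (ccontB (@ccont_id R) (@ccont_cst _ b)) (ccont_geometric b1')) Hb).
Qed.

Lemma bdenV_disk_alg bs : in_disk bs -> disk_alg (fun z => (bden bs z)^-1).
Proof.
rewrite /in_disk; elim: bs => [_|b bs IH /andP[b1 /IH Hb]].
  by apply: disk_alg_ext (@disk_alg_cst _ 1) => z _; rewrite /bden big_nil invr1.
apply: (@disk_alg_ext _ (fun z => (1 - b * z)^-1 * (bden bs z)^-1)).
  by move=> z _; rewrite /bden big_cons invfM.
by apply: disk_algM Hb; exact: disk_alg_geometric.
Qed.

Lemma bdenV_ccont bs : in_disk bs -> ccont (fun z => (bden bs z)^-1).
Proof.
rewrite /in_disk; elim: bs => [_|b bs IH /andP[b1 /IH Hb]].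
  by apply: ccont_ext (@ccont_cst _ 1) => z; rewrite /bden big_nil invr1.
apply: (@ccont_ext _ (fun z => (1 - b * z)^-1 * (bden bs z)^-1)).
  by move=> z; rewrite /bden big_cons invfM.
exact: (ccontM (ccont_geometric b1) Hb).
Qed.

(** The squared modulus is [1 - (1 - c^2) (1 - |b|^2) / |1 - b^* c|^2], where the denominator is at
    most [4] and [1 - |b|^2 >= 1 - |b|]; then [1 - x <= e^(- x)]. *)
Lemma blaschke_factor (c : R) b : `|c| < 1 -> cmod b < 1 ->
  cmod ((toC c - b) / (1 - b^* * toC c)) ^+ 2 <=
  expR (- ((1 - c ^+ 2) / 4 * (1 - cmod b))).
Proof.
move=> c1 b1.
have cc1 : cmod (toC c) < 1 by rewrite cmod_toC.
have nz : 0 < cmod (1 - b^* * toC c).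
  by rewrite cmod_gt0 neq0_1B ?cmod_conj// ltW.
have nz2 : 0 < cmod (1 - b^* * toC c) ^+ 2 by rewrite exprn_gt0.
have D4 : cmod (1 - b^* * toC c) ^+ 2 <= 4.
  have h : cmod (1 - b^* * toC c) <= 2.
    apply: le_trans (cmodB _ _) _; rewrite cmod1 cmodM cmod_conj.
    have : cmod b * cmod (toC c) <= 1.
      by rewrite mulr_ile1 ?cmod_ge0 ?(ltW b1) ?(ltW cc1).
    lra.
  have : 0 <= cmod (1 - b^* * toC c) by exact: ltW.
  move: h; move: (cmod _) => t; nra.
have E : cmod (toC c - b) ^+ 2 = cmod (1 - b^* * toC c) ^+ 2
    - (1 - c ^+ 2) * (1 - cmod b ^+ 2).
  by rewrite !cmod_sqr !ReImE /=; ring.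
rewrite cmodM cmodV exprMn exprVn E mulrBl divff ?lt0r_neq0//.
have c2 : 0 <= 1 - c ^+ 2.
  by rewrite subr_ge0 -real_normK ?num_real// expr_le1// ltW.
apply: le_trans (expR_ge1Dx _); rewrite lerD2l lerN2.
rewrite ler_pdivlMr//.
have b0 := cmod_ge0 b.
have bb : 0 <= (1 - c ^+ 2) * (1 - cmod b) by rewrite mulr_ge0// subr_ge0 ltW.
have h1 : (1 - c ^+ 2) * (1 - cmod b) <= (1 - c ^+ 2) * (1 - cmod b ^+ 2).
  by apply: ler_wpM2l => //; nra.
apply: le_trans h1.
move: D4 bb; move: (cmod (1 - _) ^+ 2) => X X4 Y0.
have : (1 - c ^+ 2) * (1 - cmod b) * X <= (1 - c ^+ 2) * (1 - cmod b) * 4 by rewrite ler_wpM2l.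
lra.
Qed.

Lemma blaschke_le (c : R) bs : `|c| < 1 -> in_disk bs ->
  cmod (blaschke bs (toC c)) ^+ 2 <= expR (- ((1 - c ^+ 2) / 4 * deficit bs)).
Proof.
move=> c1; rewrite /in_disk /deficit; elim: bs => [_|b bs IH /= /andP[b1 /IH Hb]].
  by rewrite /blaschke !big_nil cmod1 expr1n mulr0 oppr0 expR0.
rewrite /blaschke !big_cons cmodM exprMn mulrDr opprD expRD.
by apply: ler_pM; rewrite ?sqr_ge0 ?blaschke_factor.
Qed.

Lemma blaschke_small (c t : R) : `|c| < 1 -> 0 < t -> exists T : R, forall bs,
  in_disk bs -> T <= deficit bs -> cmod (blaschke bs (toC c)) <= t.
Proof.
move=> c1 t0; pose k := (1 - c ^+ 2) / 4.
have k0 : 0 < k.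
  by rewrite divr_gt0// subr_gt0 -real_normK ?num_real// expr_lt1.
(* Comes from [e^(- x) <= 1 / (1 + x)], used in place of a logarithm. *)
exists ((k * t ^+ 2)^-1) => bs db Tb.
have t2 : 0 < t ^+ 2 by rewrite exprn_gt0.
rewrite -ler_sqr ?nnegrE ?cmod_ge0 ?(ltW t0)//; apply: le_trans (blaschke_le c1 db) _.
rewrite -/k expRN -[leRHS]invrK lef_pV2 ?posrE ?expR_gt0 ?invr_gt0//.
apply: le_trans (expR_ge1Dx _).
have : k * (k * t ^+ 2)^-1 <= k * deficit bs by rewrite ler_wpM2l// ltW.
have -> : k * (k * t ^+ 2)^-1 = (t ^+ 2)^-1 by field; rewrite !lt0r_neq0.
lra.
Qed.

Definition outer (g : {poly R}) z : C := cexp (cp g).[z].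

Lemma outer_conj g z : outer g z^* = (outer g z)^*.
Proof. by rewrite /outer horner_cp_conj cexp_conj. Qed.

Lemma outer_neq0 g z : outer g z != 0. Proof. exact: cexp_neq0. Qed.

Lemma outer_disk_alg g : disk_alg (outer g).
Proof. by apply: rdisk_alg_sub; exact: rdisk_alg_cexp. Qed.

Lemma outer_ccont g : ccont (outer g).
Proof. exact: (ccont_cexp (@ccont_horner _ (cp g))). Qed.

Lemma outerN g z : outer (- g) z = (outer g z)^-1.
Proof. by rewrite /outer rmorphN hornerN cexpN. Qed.

(** As [g] is real, [outer g z^*] is the conjugate of [outer g z]. Written as a composition with
    conjugation, its inverse can be approximated by kernels taken at [z^*]. *)
Definition phase bs g z : C := blaschke bs z * (outer g z / outer g z^*).

Lemma phase_ccont bs g : in_disk bs -> ccont (phase bs g).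
Proof.
move=> db; have c1 := @outer_ccont g.
have c2 : ccont (fun z => (outer g z^*)^-1).
  apply: (ccontV (ccont_comp_conj c1)) => z _; exact: outer_neq0.
exact: (ccontM (blaschke_ccont db) (ccontM c1 c2)).
Qed.

Lemma phase_circle bs g z : in_disk bs -> cmod z = 1 -> cmod (phase bs g z) = 1.
Proof.
move=> db z1; rewrite /phase !cmodM cmodV blaschke_circle// outer_conj cmod_conj mul1r.
by rewrite divff// cmod_eq0 outer_neq0.
Qed.

Lemma kcomb_ccont s : kadm s -> ccont (fun z : C => kcomb s z^*).
Proof.
rewrite /kadm; elim: s => [_|p s IH /= /andP[/andP[_ p1] /IH H]].
  by apply: (@ccont_ext _ (fun=> 0)) (@ccont_cst _ 0) => z; rewrite /kcomb big_nil.
apply: (@ccont_ext _ (fun z => toC p.1 * (1 - toC p.2 * z^*)^-1 + kcomb s z^*)).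
  by move=> z; rewrite /kcomb big_cons.
have p2 : cmod (toC p.2) < 1 by rewrite cmod_toC.
exact: (ccontD (ccontM (@ccont_cst _ (toC p.1)) (ccont_kernel p2)) H).
Qed.

Lemma cmean_kcomb f s : disk_alg f -> ccont f -> kadm s ->
  cmean (fun z => f z * kcomb s z^*) = \sum_(p <- s) toC p.1 * f (toC p.2).
Proof.
move=> Hf cf; elim: s => [_|p s IH].
  rewrite big_nil -(@cmean_cst R 0); apply: eq_cmean => z _.
  by rewrite /kcomb big_nil mulr0.
rewrite /kadm /= => /andP[/andP[_ p1] sa].
have p2 : cmod (toC p.2) < 1 by rewrite cmod_toC.
rewrite big_cons -(IH sa) -(cmean_kernel Hf cf p2).
have c1 := ccontM cf (ccont_kernel p2); have c2 := ccontM cf (kcomb_ccont sa).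
rewrite -(cmeanZ (toC p.1) c1) -(cmeanD (ccontM (@ccont_cst _ (toC p.1)) c1) c2).
apply: eq_cmean => z _; rewrite /kcomb big_cons; ring.
Qed.

Lemma blaschke_small_seq (s : seq (R * R)) (t : R) : kadm s -> 0 < t ->
  exists T : R, forall bs, in_disk bs -> T <= deficit bs ->
  forall p, p \in s -> cmod (blaschke bs (toC p.2)) <= t.
Proof.
move=> + t0; rewrite /kadm; elim: s => [_|p s IH /= /andP[/andP[_ p1] /IH[T HT]]].
  by exists 0.
have [T' HT'] := blaschke_small p1 t0; exists (Num.max T T') => bs db.
rewrite ge_max => /andP[b1 b2] q; rewrite inE => /predU1P[->|]; first exact: HT'.
exact: HT.
Qed.

(** The integrand is [(B G)(z)], with [B] the Blaschke product and [G = outer g], times the value at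
    [z^*] of [z^k / G], a function independent of [bs]. Approximating the latter by kernels reduces
    the mean to values of [B G] at finitely many fixed points. *)
Lemma phase_mean_small g k (e : R) : 0 < e -> exists T : R, forall bs,
  in_disk bs -> T <= deficit bs ->
  cmod (cmean (fun z => phase bs g z * z^* ^+ k)) <= e.
Proof.
move=> e0; have [M M0 HM] := disk_alg_bounded (@outer_disk_alg g).
have HK : kapx (fun z => z ^+ k * outer (- g) z).
  by apply: kapx_rdisk_alg; apply: rdisk_algM; [exact: rdisk_algXn|exact: rdisk_alg_cexp].
have [s sa Hs] := HK (e / (4 * M)) ltac:(by rewrite divr_gt0// mulr_gt0).
pose L := \sum_(p <- s) `|p.1| + 1.
have L0 : 0 < L by rewrite ltr_wpDl// sumr_ge0.
have [T HT] := @blaschke_small_seq s (e / (2 * M * L)) sa ltac:(by rewrite divr_gt0// !mulr_gt0).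
exists T => bs db Tb.
pose f z := blaschke bs z * outer g z.
have Hf : disk_alg f := disk_algM (blaschke_disk_alg db) (@outer_disk_alg g).
have cf : ccont f := ccontM (blaschke_ccont db) (@outer_ccont g).
pose h (z : C) := z^* ^+ k * outer (- g) z^*.
have ch : ccont h.
  exact: (ccontM (@ccontX _ _ k (ccont_conj (@ccont_id R)))
    (ccont_comp_conj (@outer_ccont (- g)))).
rewrite (@eq_cmean _ _ (fun z => f z * h z)); last first.
  by move=> z _; rewrite /phase /f /h outerN; ring.
have ck := kcomb_ccont sa.
have h1 : cmod (cmean (fun z => f z * h z) - cmean (fun z => f z * kcomb s z^*)) <= e / 2.
  rewrite -(cmeanB (ccontM cf ch) (ccontM cf ck)).
  apply: le_trans (cmean_le_cst (ccontB (ccontM cf ch) (ccontM cf ck)) (M := M * (e / (4 * M))) _) _.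
    move=> z z1; rewrite -mulrBr cmodM; apply: ler_pM; rewrite ?cmod_ge0//.
      by rewrite cmodM blaschke_circle// mul1r HM// z1.
    by apply: Hs; rewrite cmod_conj z1.
  have -> : M * (e / (4 * M)) = e / 4 by field; rewrite lt0r_neq0.
  lra.
have h2 : cmod (cmean (fun z => f z * kcomb s z^*)) <= e / 2.
  rewrite (cmean_kcomb Hf cf sa); apply: le_trans (cmod_sum _ _ _) _.
  apply: (@le_trans _ _ (\sum_(p <- s) `|p.1| * (e / (2 * L)))).
    rewrite big_seq [leRHS]big_seq; apply: ler_sum => p ps.
    rewrite cmodM cmod_toC ler_wpM2l// /f cmodM.
    have p1 : `|p.2| < 1 by move/allP: sa => /(_ p ps)/andP[].
    have := HT bs db Tb p ps; have := HM (toC p.2); rewrite cmod_toC => /(_ (ltW p1)) k1 k2.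
    have -> : e / (2 * L) = e / (2 * M * L) * M by field; rewrite !lt0r_neq0.
    by apply: ler_pM; rewrite ?cmod_ge0.
  rewrite -mulr_suml.
  have -> : e / (2 * L) = e / 2 / L by field; rewrite lt0r_neq0.
  rewrite mulrA ler_pdivrMr// mulrC ler_wpM2l ?divr_ge0 ?(ltW e0)//.
  by rewrite /L lerDl.
have := cmod_dist (cmean (fun z => f z * h z)) (cmean (fun z => f z * kcomb s z^*)); lra.
Qed.

End Blaschke.


(** * Rational interpolation and the trial polynomial *)

Section Trial.
Variable R : realType.
Local Notation C := (Cplx R).
Implicit Types (z u b : C) (bs : seq C) (p q : {poly R}).
Local Notation cp := (map_poly (@toC R)).

Fixpoint chebyshev2 k : {poly R} * {poly R} :=
  if k is j.+1 then
    let: (t0, t1) := chebyshev2 j in (t1, 2 *: ('X * t1) - t0)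
  else (1, 'X).
Definition chebyshev k := (chebyshev2 k).1.

Lemma chebyshevSS k : chebyshev k.+2 = 2 *: ('X * chebyshev k.+1) - chebyshev k.
Proof. by rewrite /chebyshev /=; case: (chebyshev2 k). Qed.

Lemma chebyshevP k : [/\ (size (chebyshev k) <= k.+1)%N,
  (chebyshev k.+1)`_k.+1 = 2 ^+ k &
  forall z, z != 0 -> (cp (chebyshev k)).[(z + z^-1) / 2] = (z ^+ k + z ^- k) / 2].
Proof.
have H j : [/\ (size (chebyshev j) <= j.+1)%N, (size (chebyshev j.+1) <= j.+2)%N,
    (chebyshev j.+1)`_j.+1 = 2 ^+ j &
    forall z, z != 0 -> (cp (chebyshev j)).[(z + z^-1) / 2] = (z ^+ j + z ^- j) / 2 /\
      (cp (chebyshev j.+1)).[(z + z^-1) / 2] = (z ^+ j.+1 + z ^- j.+1) / 2].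
  elim: j => [|j [s1 s2 l H]].
    split; rewrite ?size_polyC ?oner_eq0 ?size_polyX ?coefX ?expr0//.
    move=> z z0; rewrite rmorph1 hornerC map_polyX hornerX expr0 invr1.
    by split => //; field.
  have s3 : (size (2 *: ('X * chebyshev j.+1) : {poly R}) <= j.+3)%N.
    apply: leq_trans (size_scale_leq _ _) _; apply: leq_trans (size_polyMleq _ _) _.
    by rewrite size_polyX.
  split => //.
  - rewrite chebyshevSS (leq_trans (size_polyD _ _))// geq_max size_polyN.
    rewrite s3 /=; apply: leq_trans s1 _; by rewrite ltnS; apply: leqW.
  - rewrite chebyshevSS coefB coefZ coefXM /= l [X in _ - X]nth_default ?subr0 ?exprS//.
    by apply: leq_trans s1 _; exact: leqW.
  - move=> z z0; have [h1 h2] := H z z0; split => //.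
    rewrite chebyshevSS rmorphB /= map_polyZ rmorphM /= map_polyX toC_nat.
    rewrite !(hornerD, hornerN, hornerZ, hornerM, hornerX) h1 h2 !exprS.
    have zj : z ^+ j != 0 by rewrite expf_neq0.
    by field; rewrite zj z0.
by have [s1 s2 l hz] := H k; split => // z /hz[].
Qed.

Lemma chebyshev_coef_lt k j : (k < j)%N -> (chebyshev k)`_j = 0.
Proof. by move=> kj; have [s _ _] := chebyshevP k; apply: nth_default; apply: leq_trans s kj. Qed.

(** At [x = Re z] on the circle this is the real part of [z^(- n) N(z)], since [Re z^k] is a
    Chebyshev polynomial of [x]. The index stays below [2 n], so only [j = 0] reaches degree [n] and
    the leading coefficient is read off the constant term of [N]. *)
Definition trial_poly n (N : {poly R}) : {poly R} :=
  \sum_(j < 2 * n) N`_j *: chebyshev `|n%:Z - j%:Z|%N.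

Lemma trial_poly_size n N : (size (trial_poly n N) <= n.+1)%N.
Proof.
apply: (leq_trans (size_sum _ _ _)); apply/bigmax_leqP => j _.
apply: leq_trans (size_scale_leq _ _) _.
have [s _ _] := chebyshevP `|n%:Z - j%:Z|%N; apply: leq_trans s _.
rewrite ltnS; have := ltn_ord j; lia.
Qed.

Lemma trial_poly_coef n N : (0 < n)%N -> (trial_poly n N)`_n = N`_0 * 2 ^+ n.-1.
Proof.
case: n => // n _; rewrite /trial_poly mulnS add2n big_ord_recl /= coefD coefZ.
rewrite addn0.
have [_ -> _] := chebyshevP n.
rewrite coef_sum big1 ?addr0// => j _.
rewrite coefZ chebyshev_coef_lt ?mulr0// /bump /=; have := ltn_ord j; lia.
Qed.

Lemma trial_poly_circle n (N : {poly R}) z : (size N <= 2 * n)%N -> cmod z = 1 ->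
  (trial_poly n N).[complex.Re z] = complex.Re (z ^- n * (cp N).[z]).
Proof.
move=> sN z1; have z0 := circle_neq0 z1.
have xE : (z + z^-1) / 2 = toC (complex.Re z).
  rewrite -conj_circle// -toC_nat -fmorphV.
  by apply: complex_ext; rewrite !ReImE /=; field.
have ce k : (chebyshev k).[complex.Re z] = complex.Re (z ^+ k).
  have [_ _ /(_ z z0)] := chebyshevP k; rewrite xE horner_cp_toC => E.
  apply: toC_inj; rewrite E -exprVn -conj_circle// -rmorphXn /=.
  by rewrite -toC_nat -fmorphV; apply: complex_ext; rewrite !ReImE /=; field.
have zk k : complex.Re (z ^- k) = complex.Re (z ^+ k).
  by rewrite -exprVn -conj_circle// -rmorphXn /= Re_conj.
have cd (j : nat) : complex.Re (z ^- n * z ^+ j) = (chebyshev `|n%:Z - j%:Z|%N).[complex.Re z].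
  rewrite ce; have [nj|jn] := leqP n j.
    have -> : z ^- n * z ^+ j = z ^+ (j - n).
      by rewrite -{1}(subnK nj) exprD mulrCA mulVf ?mulr1// expf_neq0.
    by congr (complex.Re (z ^+ _)); lia.
  have -> : z ^- n * z ^+ j = z ^- (n - j).
    rewrite -{1}(subnK (ltnW jn)) exprD invfM -mulrA mulVf ?mulr1//.
    by rewrite expf_neq0.
  by rewrite zk; congr (complex.Re (z ^+ _)); lia.
rewrite /trial_poly horner_sum.
have -> : (cp N).[z] = \sum_(j < 2 * n) toC N`_j * z ^+ j.
  rewrite (@horner_coef_wide _ (2 * n)); last by rewrite size_map_poly.
  by apply: eq_bigr => j _; rewrite coef_map.
rewrite mulr_sumr.
have Rs m (F : 'I_m -> C) : complex.Re (\sum_(j < m) F j) = \sum_(j < m) complex.Re (F j).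
  by apply: (big_morph (@complex.Re R)) => [u v|]; [exact: ReD|].
rewrite Rs; apply: eq_bigr => j _; rewrite hornerZ -cd [in RHS]mulrCA [RHS]ReM Re_toC Im_toC mul0r subr0.
by [].
Qed.

(** With [B] the Blaschke product and [D = bden bs], reflection and conjugate symmetry give
    [D(1/c) = B(c) prod (1/c - b)]. So [D - B(c) prod (z - b)] is divisible by [1 - c z], and the
    division brings the degree below the number of points. The quotient interpolates the kernel at
    the zeros of [B], with an error proportional to [B(c)]. *)
Lemma rational_kernel bs (c : R) : in_disk bs -> conj_sym bs -> c != 0 -> `|c| < 1 ->
  exists N : {poly C}, (size N <= size bs)%N /\ forall z, cmod z <= 1 ->
    N.[z] / bden bs z =
    (1 - blaschke bs (toC c) * blaschke bs z) / (1 - toC c * z).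
Proof.
move=> db sb c0 c1.
have cc0 : toC c != 0 by rewrite -cmod_eq0 cmod_toC normr_eq0.
have cc1 : cmod (toC c) < 1 by rewrite cmod_toC.
pose Dp : {poly C} := \prod_(b <- bs) (1 - b *: 'X).
pose Np : {poly C} := \prod_(b <- bs) ('X - b%:P).
have DpE z : Dp.[z] = bden bs z.
  by rewrite /Dp horner_prod; apply: eq_bigr => b _; rewrite !hornerE.
have NpE z : Np.[z] = \prod_(b <- bs) (z - b).
  by rewrite /Np horner_prod; apply: eq_bigr => b _; rewrite !hornerE.
have sD : (size Dp <= (size bs).+1)%N.
  rewrite /Dp; elim: (bs) => [|b l IH]; first by rewrite big_nil size_polyC oner_eq0.
  rewrite big_cons (leq_trans (size_polyMleq _ _))//.
  have : (size ((1 - b *: 'X)%R : {poly C}) <= 2)%N.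
    rewrite (leq_trans (size_polyD _ _))// geq_max size_polyC oner_eq0 /= size_polyN.
    by rewrite (leq_trans (size_scale_leq _ _))// size_polyX.
  move: IH => /=; lia.
have sN : size Np = (size bs).+1 by rewrite /Np size_prod_XsubC.
pose E := Dp - blaschke bs (toC c) *: Np.
have rE : root E (toC c)^-1.
  rewrite /root /E hornerD hornerN hornerZ DpE NpE blaschkeE//.
  have -> : bden bs (toC c)^-1 = (toC c) ^- size bs * \prod_(b <- bs) (toC c - b).
    rewrite /bden; elim: (bs) => [|b l IH]; first by rewrite !big_nil expr0 invr1 mulr1.
    rewrite !big_cons IH /= exprS invfM mulrACA; congr (_ * _).
    by rewrite mulrBr mulVf// [b * _]mulrC.
  have -> : \prod_(b <- bs) ((toC c)^-1 - b) = (toC c) ^- size bs * bden bs (toC c).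
    rewrite /bden; elim: (bs) => [|b l IH]; first by rewrite !big_nil expr0 invr1 mulr1.
    rewrite !big_cons IH /= exprS invfM mulrACA; congr (_ * _).
    by rewrite mulrBr mulr1 mulrCA mulVf ?mulr1.
  have D0 := bden_neq0 db (ltW cc1).
  by rewrite mulrCA divfK// subrr.
have /factor_theorem[T ET] := rE.
exists (- (toC c)^-1 *: T); split.
  apply: leq_trans (size_scale_leq _ _) _.
  have [->|T0] := eqVneq T 0; first by rewrite size_poly0.
  have : (size E <= (size bs).+1)%N.
    rewrite (leq_trans (size_polyD _ _))// geq_max sD size_polyN.
    by rewrite (leq_trans (size_scale_leq _ _))// sN.
  by rewrite ET size_Mmonic ?monicXsubC// size_XsubC addn2.
move=> z z1; have D0 := bden_neq0 db z1; have nz := neq0_1B cc1 z1.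
have := congr1 (horner^~ z) ET; rewrite /= hornerM hornerXsubC /E hornerD hornerN hornerZ DpE NpE.
move=> EE.
have TE : T.[z] = - toC c * (bden bs z - blaschke bs (toC c) * \prod_(b <- bs) (z - b)) / (1 - toC c * z).
  by apply: (mulIf nz); rewrite divfK// EE; field.
rewrite hornerZ TE (blaschkeE z sb).
move: (bden bs z) D0 (1 - toC c * z) nz => d d0 k k0.
by field; rewrite d0 k0 cc0.
Qed.

Lemma rational_kcomb bs s : in_disk bs -> conj_sym bs -> kadm s ->
  exists N : {poly C}, (size N <= size bs)%N /\ forall z, cmod z <= 1 ->
    N.[z] / bden bs z = kcomb s z -
    blaschke bs z * \sum_(p <- s) toC p.1 * blaschke bs (toC p.2) / (1 - toC p.2 * z).
Proof.
move=> db sb; elim: s => [_|p s IH].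
  exists 0; rewrite size_poly0; split => // z _.
  by rewrite /kcomb !big_nil horner0 mul0r mulr0 subrr.
rewrite /kadm /= => /andP[/andP[p0 p1] /IH[N [sN HN]]].
have [M [sM HM]] := rational_kernel db sb p0 p1.
exists (toC p.1 *: M + N); split.
  rewrite (leq_trans (size_polyD _ _))// geq_max sN andbT.
  by rewrite (leq_trans (size_scale_leq _ _)).
move=> z z1; rewrite hornerD hornerZ mulrDl HN// -mulrA HM// /kcomb !big_cons.
have nz : 1 - toC p.2 * z != 0 by rewrite neq0_1B// cmod_toC.
by move: (1 - toC p.2 * z) nz => d d0; field.
Qed.

Definition Re_poly (N : {poly C}) : {poly R} := \poly_(i < size N) complex.Re N`_i.

Lemma Re_polyE N z : (cp (Re_poly N)).[z] = (N.[z] + (N.[z^*])^*) / 2.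
Proof.
have sR : (size (cp (Re_poly N)) <= size N)%N by rewrite size_map_poly size_poly.
rewrite (horner_coef_wide _ sR) !horner_coef rmorph_sum /= -big_split mulr_suml /=.
apply: eq_bigr => i _; rewrite coef_map coef_poly ltn_ord rmorphM rmorphXn /= conjCK -mulrDl.
rewrite mulrAC; congr (_ * _).
by rewrite -toC_nat -fmorphV; apply: complex_ext; rewrite !ReImE /=; field.
Qed.

Lemma blaschke_disk_le bs z : in_disk bs -> cmod z <= 1 -> cmod (blaschke bs z) <= 1.
Proof.
rewrite /in_disk => + z1; elim: bs => [_|b bs IH /= /andP[b1 /IH Hb]].
  by rewrite /blaschke big_nil cmod1.
rewrite /blaschke big_cons cmodM mulr_ile1 ?cmod_ge0// cmodM cmodV.
have nz : 0 < cmod (1 - b^* * z) by rewrite cmod_gt0 neq0_1B// cmod_conj.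
rewrite ler_pdivrMr// mul1r -ler_sqr ?nnegrE ?cmod_ge0//.
have E : cmod (1 - b^* * z) ^+ 2 - cmod (z - b) ^+ 2 = (1 - cmod z ^+ 2) * (1 - cmod b ^+ 2).
  by rewrite !cmod_sqr !ReImE /=; ring.
rewrite -subr_ge0 E mulr_ge0// subr_ge0 expr_le1// ?cmod_ge0//; exact: ltW.
Qed.

(** [N / D] interpolates a combination of kernels close to [1 / outer g]. The error carries the
    values of the Blaschke product at finitely many fixed points, so one threshold on the deficit
    makes it small on the whole closed disk. *)
Lemma trial_numerator (g : {poly R}) (e : R) : 0 < e -> exists T : R, forall bs,
  in_disk bs -> conj_sym bs -> T <= deficit bs ->
  exists N : {poly R}, (size N <= size bs)%N /\ forall z, cmod z <= 1 ->
    cmod ((cp N).[z] * outer g z / bden bs z - 1) <= e.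
Proof.
move=> e0; have [M M0 HM] := disk_alg_bounded (@outer_disk_alg _ g).
have [s sa Hs] := kapx_rdisk_alg (@rdisk_alg_cexp _ (- g)) (e := e / (2 * M))
  ltac:(by rewrite divr_gt0// mulr_gt0).
pose L := \sum_(p <- s) `|p.1| / (1 - `|p.2|) + 1.
have sa1 (p : R * R) : p \in s -> `|p.2| < 1 by move=> ps; move/allP: sa => /(_ p ps)/andP[].
have L0 : 0 < L.
  rewrite ltr_wpDl// big_seq sumr_ge0// => p /sa1 p1.
  by rewrite divr_ge0// subr_ge0 ltW.
have [T HT] := blaschke_small_seq sa (t := e / (2 * M * L)) ltac:(by rewrite divr_gt0// !mulr_gt0).
exists T => bs db sb Tb; have [N [sN HN]] := rational_kcomb db sb sa.
have bz z : cmod z <= 1 -> cmod (blaschke bs z) <= 1.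
  exact: blaschke_disk_le.
have key z : cmod z <= 1 -> cmod (N.[z] * outer g z / bden bs z - 1) <= e.
  move=> z1.
  have g0 := outer_neq0 g z.
  have -> : N.[z] * outer g z / bden bs z - 1 = (N.[z] / bden bs z - outer (- g) z) * outer g z.
    by rewrite outerN mulrBl mulVf// mulrAC.
  rewrite HN// cmodM.
  apply: (@le_trans _ _ ((e / (2 * M) + e / (2 * M * L) * (L - 1)) * M)).
    apply: ler_pM; rewrite ?cmod_ge0 ?HM//.
    rewrite addrAC; apply: le_trans (cmodB _ _) _; apply: lerD.
      by rewrite cmodBC; exact: Hs.
    rewrite cmodM -[leRHS]mul1r; apply: ler_pM; rewrite ?cmod_ge0 ?bz//.
    apply: le_trans (cmod_sum _ _ _) _; rewrite /L addrK mulr_sumr.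
    rewrite big_seq [leRHS]big_seq; apply: ler_sum => p ps.
    have p1 := sa1 p ps.
    have -> : cmod (toC p.1 * blaschke bs (toC p.2) / (1 - toC p.2 * z)) =
        `|p.1| / cmod (1 - toC p.2 * z) * cmod (blaschke bs (toC p.2)).
      by rewrite !cmodM cmodV cmod_toC mulrAC.
    rewrite [leRHS]mulrC.
    apply: ler_pM; rewrite ?divr_ge0 ?cmod_ge0//; last exact: HT.
    apply: ler_wpM2l => //; rewrite lef_pV2 ?posrE ?subr_gt0//.
      by have := cmod_1B_ge (toC p.2) z1; rewrite cmod_toC.
    by rewrite cmod_gt0 neq0_1B// cmod_toC.
  have -> : (e / (2 * M) + e / (2 * M * L) * (L - 1)) * M = e - e / (2 * L).
    by field; rewrite !lt0r_neq0.
  by rewrite gerBl divr_ge0 ?mulr_ge0 ?ltW.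
exists (Re_poly N); split; first by rewrite (leq_trans (size_poly _ _)).
move=> z z1; rewrite Re_polyE.
have zc1 : cmod z^* <= 1 by rewrite cmod_conj.
have -> : (N.[z] + (N.[z^*])^*) / 2 * outer g z / bden bs z - 1 =
   toC 2^-1 * ((N.[z] * outer g z / bden bs z - 1) + (N.[z^*] * outer g z^* / bden bs z^* - 1)^*).
  have -> : (N.[z^*] * outer g z^* / bden bs z^* - 1)^* = (N.[z^*])^* * outer g z / bden bs z - 1.
    by rewrite rmorphB rmorph1 !rmorphM fmorphV /= outer_conj bden_conj// !conjCK.
  have -> : toC (2^-1 : R) = 2^-1 by rewrite fmorphV rmorph_nat.
  by move: (bden bs z) (bden_neq0 db z1) => d d0; field.
rewrite cmodM cmod_toC ger0_norm ?invr_ge0//.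
have := cmodD (N.[z] * outer g z / bden bs z - 1) (N.[z^*] * outer g z^* / bden bs z^* - 1)^*.
rewrite [cmod (_)^*]cmod_conj; have := key z z1; have := key _ zc1; lra.
Qed.

End Trial.


(** * Comparing a measure with its absolutely continuous part *)

Section MeasureComparison.
Variable R : realType.
Local Notation A := (@arcsine R).
Local Notation I := (`[(-1)%R, 1%R]%classic : set R).
Implicit Types (f g v X : R -> R) (V : {poly R}).
Local Notation mI := (@measI R).

Lemma intg_ge0 (m : {measure set R -> \bar R}) f (c : R) : measurable_fun I f ->
  (forall x, I x -> 0 <= f x) -> (\int[m]_(x in I) (f x)%:E <= c%:E)%E ->
  intg m f /\ rint m f <= c.
Proof.
move=> mf f0 fc.
have hf : intg m f.
  apply/integrableP; split; first exact/measurable_EFinP.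
  apply: le_lt_trans (ltry c); apply: le_trans fc.
  rewrite (eq_integral (fun x => (f x)%:E))// => x; rewrite inE => xI /=.
  by rewrite ger0_norm ?f0.
by split=> //; rewrite -lee_fin rintE.
Qed.

Lemma measurable_expR_poly V : measurable_fun I (fun x => expR (- V.[x])).
Proof.
apply: cont_measurable; apply: continuous_subspaceT => x.
apply: (@continuous_comp _ _ _ (fun x => - V.[x]) expR); last exact: continuous_expR.
exact: (cvgN (@continuous_horner _ V x)).
Qed.

Lemma ac_density_le (m : {finite_measure set R -> \bar R}) v f :
  ac_density m A v -> measurable_fun I f -> (forall x, I x -> 0 <= f x) ->
  intg m f -> intg A (fun x => f x * v x) /\ rint A (fun x => f x * v x) <= rint m f.
Proof.
move=> [mv v0 [s _ mE]] mf f0 hf.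
have mvI : measurable_fun I v by exact: measurable_funS mv.
apply: intg_ge0.
- exact: measurable_funM.
- by move=> x xI; rewrite mulr_ge0 ?f0.
- rewrite rintE// (ge0_integral_density mv v0 mE mI mf f0).
  by rewrite leeDr// integral_ge0// => x xI; rewrite lee_fin f0.
Qed.

Lemma log_integrable_intg v : log_integrable A v -> intg A (fun x => ln (v x)).
Proof. by move=> [_ hv]; apply: integrableS hv. Qed.

Lemma finite_measI (m : {finite_measure set R -> \bar R}) : (m I < +oo)%E.
Proof. by rewrite ltey_eq fin_num_measure. Qed.

(** Discarding the singular part bounds integrals for [m] from below only. Applied to [K - X]
    instead of [X], this becomes an upper bound, because the total mass of [e^(- V) dm] appears on
    the right: excess singular mass would show up there. *)
Lemma ac_compare (m : {finite_measure set R -> \bar R}) v V X (K : R) :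
  ac_density m A v -> log_integrable A v -> {within I, continuous X} ->
  (forall x, I x -> 0 <= X x <= K) ->
  rint m (fun x => expR (- V.[x]) * X x) <=
  rint A X + K * (rint m (fun x => expR (- V.[x])) - 1 +
                  rint A (fun x => `|ln (v x) - V.[x]|)).
Proof.
move=> hm lv cX XK.
have fm := finite_measI m; have fA := arcsine_fin R.
have mX := cont_measurable cX; have mE := measurable_expR_poly V.
have cE : intg m (fun x => expR (- V.[x])).
  apply: (intg_cont fm); apply: continuous_subspaceT => x.
  apply: (@continuous_comp _ _ _ (fun x => - V.[x]) expR); last exact: continuous_expR.
  exact: (cvgN (@continuous_horner _ V x)).
have K0 : 0 <= K by have /andP[a b] := XK 0 ltac:(by rewrite /= in_itv /=; lra); apply: le_trans a b.
have cEX : intg m (fun x => expR (- V.[x]) * X x).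
  apply: (intg_le _ (intgZ K cE)); first exact: measurable_funM.
  move=> x /XK/andP[X0 X1]; rewrite ger0_norm ?mulr_ge0 ?expR_ge0// mulrC.
  by rewrite ler_wpM2r ?expR_ge0.
pose f x := expR (- V.[x]) * (K - X x).
have mf : measurable_fun I f.
  by apply: measurable_funM => //; apply: measurable_funB.
have f0 x : I x -> 0 <= f x.
  by move=> /XK/andP[_ h]; rewrite mulr_ge0 ?expR_ge0 ?subr_ge0.
have fE : f = fun x => K * expR (- V.[x]) - expR (- V.[x]) * X x.
  by apply/funext => x; rewrite /f; ring.
have hf : intg m f by rewrite fE; apply: intgB => //; exact: intgZ.
have rf : rint m f = K * rint m (fun x => expR (- V.[x])) - rint m (fun x => expR (- V.[x]) * X x).
  by rewrite fE rintB ?rintZ//; exact: intgZ.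
have [hfv rfv] := ac_density_le hm mf f0 hf.
have hl := log_integrable_intg lv.
have hd : intg A (fun x => `|ln (v x) - V.[x]|).
  by apply: intg_norm; apply: intgB => //; exact: (intg_poly fA).
have hX : intg A X by exact: (intg_cont fA).
have hg : intg A (fun x => K - X x - K * `|ln (v x) - V.[x]|).
  by apply: intgB; [apply: intgB => //; exact: (intg_cst fA)|exact: intgZ].
have rg : rint A (fun x => K - X x - K * `|ln (v x) - V.[x]|) =
    K - rint A X - K * rint A (fun x => `|ln (v x) - V.[x]|).
  rewrite rintB ?rintB ?rintZ ?rint_arcsine_cst//; first exact: (intg_cst fA).
  - by apply: intgB => //; exact: (intg_cst fA).
  - exact: intgZ.
(* From [e^(- V) v >= 1 - |log v - V|] and [0 <= K - X <= K]. *)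
have : rint A (fun x => K - X x - K * `|ln (v x) - V.[x]|) <= rint A (fun x => f x * v x).
  apply: ae_le_rint => //; case: lv => + _; apply: filterS => x vx xI.
  have /andP[X0 X1] := XK x xI.
  have h1 : 1 - `|ln (v x) - V.[x]| <= expR (- V.[x]) * v x.
    rewrite -{2}(@lnK _ (v x)) ?posrE// -expRD.
    apply: le_trans (expR_ge1Dx _); rewrite lerD2l.
    by rewrite lerNl -normrN opprB [- V.[x] + _]addrC opprB ler_norm.
  have h2 : (K - X x) * (1 - `|ln (v x) - V.[x]|) <= f x * v x.
    by rewrite /f -mulrA mulrCA ler_wpM2l// subr_ge0.
  apply: le_trans h2; have := normr_ge0 (ln (v x) - V.[x]); nra.
rewrite rg; lra.
Qed.

End MeasureComparison.


(** * Polynomial approximation of the logarithm of the weight *)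

Section LogWeightApproximation.
Variable R : realType.
Local Notation A := (@arcsine R).
Local Notation I := (`[(-1)%R, 1%R]%classic : set R).
Implicit Types (f g v X : R -> R) (V : {poly R}).
Local Notation mI := (@measI R).

Lemma rint_dominated (m : {measure set R -> \bar R}) (u : nat -> R -> R) f g :
  (forall n, measurable_fun I (u n)) -> measurable_fun I f ->
  {ae m, forall x, I x -> u n x @[n --> \oo] --> f x} -> intg m g ->
  {ae m, forall x, forall n, I x -> `|u n x| <= g x} ->
  rint m (u n) @[n --> \oo] --> rint m f.
Proof.
move=> mu mf uf hg ug.
have [] := @dominated_convergence _ _ _ m I mI (fun n => EFin \o u n) (EFin \o f) (EFin \o g).
- by move=> n; exact/measurable_EFinP.
- exact/measurable_EFinP.
- apply: filterS uf => x H xI; apply/fine_cvgP; split; first exact: nearW.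
  exact: H.
- exact: hg.
- by apply: filterS ug => x H n xI; rewrite lee_fin H.
move=> hf _ cv; have := cv; rewrite -(rintE hf) => /fine_cvgP[_].
exact.
Qed.

Definition clampn (n : nat) (y : R) : R := Num.max (- n%:R) (Num.min y n%:R).

Lemma clampn_norm n y : `|clampn n y| <= n%:R.
Proof.
rewrite /clampn ler_norml le_max lexx /= ge_max ge_min lexx orbT andbT.
by rewrite lerNl (le_trans _ (ler0n _ n))// oppr_le0 oppr_ge0 ?oppr_le0 ?ler0n.
Qed.

Lemma clampn_id n y : `|y| <= n%:R -> clampn n y = y.
Proof. by rewrite ler_norml /clampn => /andP[a b]; rewrite min_l// max_r. Qed.

Lemma clampnB n y : `|y - clampn n y| <= `|y| /\ y - clampn n y <= Num.max 0 y.
Proof.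
have n0 : (0 : R) <= n%:R by [].
rewrite /clampn; have [h1|h1] := leP y n%:R.
  have [h2|h2] := leP (- n%:R) y; first by rewrite subrr normr0 normr_ge0 le_max lexx.
  have y0 : y < 0 by lra.
  rewrite ltr0_norm ?ltr0_norm//; last lra.
  by split; [lra|rewrite le_max; apply/orP; left; lra].
have y0 : 0 < y by lra.
rewrite max_r; last lra.
rewrite gtr0_norm ?gtr0_norm//; last lra.
by split; [lra|rewrite le_max; apply/orP; right; lra].
Qed.

Lemma cvg_clampn y : clampn n y @[n --> \oo] --> y.
Proof.
apply: cvg_near_cst; exists (Num.truncn `|y|).+1 => // n /= nn.
apply: clampn_id; apply: le_trans (ltW (truncnS_gt _)) _; by rewrite ler_nat.
Qed.

Lemma measurable_clampn n f : measurable_fun I f -> measurable_fun I (fun x => clampn n (f x)).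
Proof.
move=> mf; apply: measurable_maxr => //.
exact: measurable_minr.
Qed.

Lemma expRD_le (a t L : R) : 0 <= L -> expR (a + t) <= L -> expR (a + t) <= expR a + L * `|t|.
Proof.
move=> L0 hL; have [t0|t0] := leP t 0.
  by rewrite (le_trans _ (ler_wpDr (mulr_ge0 L0 (normr_ge0 t)) (lexx _)))// ler_expR; lra.
have h1 : expR (a + t) * (1 - expR (- t)) <= L * t.
  apply: ler_pM; rewrite ?expR_ge0 ?subr_ge0//; last by have := expR_ge1Dx (- t); lra.
  by rewrite -[leRHS](@expR0 R) ler_expR oppr_le0 ltW.
have E : expR a = expR (a + t) * expR (- t) by rewrite -expRD addrK.
by rewrite gtr0_norm// E; move: h1; rewrite mulrBr mulr1; lra.
Qed.

(** [psi n] is [log v] truncated at height [n] on [S], and the large value [n] off [S], a set that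
    carries the singular part and is null for the arcsine measure. Thus [e^(- psi n)] tends to [0]
    on the singular part and [e^(- psi n) v] tends to [1] almost everywhere. The bounded function
    [psi n] is replaced by a polynomial at the end. *)
Lemma exists_log_weight (mu : {finite_measure set R -> \bar R}) v (e : R) :
  ac_density mu A v -> log_integrable A v -> 0 < e ->
  exists V, rint mu (fun x => expR (- V.[x])) <= 1 + e /\
    rint A (fun x => `|ln (v x) - V.[x]|) <= e.
Proof.
move=> hm lv e0.
have fA := arcsine_fin R; have fm := finite_measI mu.
have hl := log_integrable_intg lv; have ml := intg_measurable hl.
have [mv v0 [s [S [mS sS0 AS0]] mE]] := hm.
have mvI : measurable_fun I v by exact: measurable_funS mv.
have m1S : measurable_fun I (\1_S : R -> R) by exact: measurable_indic.
have hv : intg A v.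
  have [h _] := ac_density_le hm (measurable_cst (1 : R)) (fun _ _ => ler01) (intg_cst fm 1).
  by apply: eq_intg h => x _; rewrite mul1r.
pose psi (n : nat) x := \1_S x * clampn n (ln (v x)) + (1 - \1_S x) * n%:R.
have mpsi n : measurable_fun I (psi n).
  apply: measurable_funD; apply: measurable_funM => //; first exact: measurable_clampn.
  exact: measurable_funB.
have psiN n x : `|psi n x| <= n%:R.
  rewrite /psi indicE; case: (x \in S); rewrite /= ?mul1r ?mul0r ?subrr ?subr0 ?mul0r ?mul1r ?addr0 ?add0r.
    exact: clampn_norm.
  by rewrite ger0_norm.
have aeS : {ae A, forall x, S x}.
  by exists (~` S); split => //; exact: measurableC.
have aesS : {ae s, forall x, ~ S x}.
  by exists S; split => // x /= /contrapT.
have psiS n x : S x -> psi n x = clampn n (ln (v x)).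
  by move=> Sx; rewrite /psi indicE mem_set// mul1r subrr mul0r addr0.
have psinS n x : ~ S x -> psi n x = n%:R.
  by move=> Sx; rewrite /psi indicE memNset// mul0r subr0 mul1r add0r.
have ecomp f : measurable_fun I f -> measurable_fun I (fun x => expR (- f x)).
  move=> mf; rewrite (_ : (fun x => _) = fun x => expR (0 - f x)); last first.
    by apply/funext => x; rewrite sub0r.
  by apply: (measurableT_comp (@measurable_expR R)); exact: measurable_funB.
have sI : (s I <= mu I)%E.
  by rewrite mE// leeDl// integral_ge0// => x _; rewrite lee_fin.
have sfin : (s I < +oo)%E by exact: le_lt_trans sI fm.
have c1 : rint A (fun x => `|ln (v x) - psi n x|) @[n --> \oo] --> rint A (fun=> 0).
  apply: (@rint_dominated A _ _ (fun x => `|ln (v x)|)) => //.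
  - move=> n; apply: (measurableT_comp (@normr_measurable R setT)).
    exact: measurable_funB.
  - apply: filterS aeS => x Sx xI; rewrite -(normr0 R).
    apply: continuous_cvg; first exact: norm_continuous.
    rewrite -(subrr (ln (v x))); apply: cvgB; first exact: cvg_cst.
    rewrite (_ : (fun n => psi n x) = fun n => clampn n (ln (v x))); first exact: cvg_clampn.
    by apply/funext => n; exact: psiS.
  - exact: intg_norm.
  - apply: filterS aeS => x Sx n xI; rewrite normr_id psiS//.
    by have [] := clampnB n (ln (v x)).
have c2 : rint s (fun x => expR (- psi n x)) @[n --> \oo] --> rint s (fun=> 0).
  apply: (@rint_dominated s _ _ (fun=> 1)) => //.
  - by move=> n; exact: ecomp.
  - apply: filterS aesS => x Sx xI.
    rewrite (_ : (fun n => expR (- psi n x)) = fun n : nat => expR (- 1) ^+ n); last first.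
      by apply/funext => n; rewrite psinS// -expRM_natl mulrN1.
    apply: cvg_expr; rewrite ger0_norm ?expR_ge0// -[ltRHS](@expR0 R) ltr_expR; lra.
  - exact: (intg_cst sfin).
  - apply: filterS aesS => x Sx n xI.
    by rewrite ger0_norm ?expR_ge0// psinS// -[leRHS](@expR0 R) ler_expR oppr_le0.
have c3 : rint A (fun x => expR (- psi n x) * v x) @[n --> \oo] --> rint A (fun=> 1).
  have lvp : {ae A, forall x, 0 < v x} by case: lv.
  have aeSv : {ae A, forall x, S x /\ 0 < v x} by apply: filterS2 aeS lvp.
  have E n x : 0 < v x -> S x -> expR (- psi n x) * v x = expR (ln (v x) - clampn n (ln (v x))).
    by move=> vx Sx; rewrite psiS// expRD lnK ?posrE// mulrC.
  apply: (@rint_dominated A _ _ (fun x => 1 + v x)) => //.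
  - by move=> n; apply: measurable_funM => //; exact: ecomp.
  - apply: filterS aeSv => x [Sx vx] xI.
    rewrite (_ : (fun n => _) = fun n => expR (ln (v x) - clampn n (ln (v x)))); last first.
      by apply/funext => n; exact: E.
    rewrite -(@expR0 R); apply: continuous_cvg; first exact: continuous_expR.
    rewrite -(subrr (ln (v x))); apply: cvgB; first exact: cvg_cst.
    exact: cvg_clampn.
  - by apply: intgD => //; exact: (intg_cst fA).
  - apply: filterS aeSv => x [Sx vx] n xI; rewrite E// ger0_norm ?expR_ge0//.
    have [_ h] := clampnB n (ln (v x)).
    (* The exponential of the positive part of [log v] is at most [1 + v], which is the dominating
       function. *)
    apply: le_trans (_ : expR (Num.max 0 (ln (v x))) <= _); first by rewrite ler_expR.
    have [l0|l0] := leP 0 (ln (v x)); first by rewrite lnK ?posrE// lerDr.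
    by rewrite expR0 lerDl.
rewrite rint_arcsine_cst in c1; rewrite rint_arcsine_cst in c3.
have s0 : rint s (fun=> 0) = 0 by rewrite /rint Rintegral_cst// mul0r.
rewrite s0 in c2.
have e4 : 0 < e / 4 by rewrite divr_gt0.
have [n [n1 [n2 n3]]] : exists n, rint A (fun x => `|ln (v x) - psi n x|) < e / 4 /\
   rint s (fun x => expR (- psi n x)) < e / 4 /\
   rint A (fun x => expR (- psi n x) * v x) < 1 + e / 4.
  have o4 : 1 < 1 + e / 4 by rewrite ltrDl.
  near \oo => n; exists n; split; [|split]; near: n.
  - by apply: (@cvgr_lt _ _ _ _ _ _ c1).
  - by apply: (@cvgr_lt _ _ _ _ _ _ c2).
  - by apply: (@cvgr_lt _ _ _ _ _ _ c3).
have hpsi (m : {measure set R -> \bar R}) : (m I < +oo)%E -> intg m (psi n).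
  by move=> mfin; apply: (intg_bounded mfin (mpsi n) (M := n%:R)) => x _.
have hexp (m : {measure set R -> \bar R}) : (m I < +oo)%E -> intg m (fun x => expR (- psi n x)).
  move=> mfin; apply: (intg_bounded mfin (M := expR n%:R)); first exact: ecomp.
  move=> x _; rewrite ger0_norm ?expR_ge0// ler_expR.
  by have := psiN n x; rewrite ler_norml => /andP[]; rewrite lerNl.
have mupsi : rint mu (fun x => expR (- psi n x)) <= 1 + e / 2.
  rewrite -lee_fin (rintE (hexp _ fm)).
  rewrite (ge0_integral_density mv v0 mE mI (ecomp _ (mpsi n)) (fun x _ => expR_ge0 _)).
  have hev : intg A (fun x => expR (- psi n x) * v x).
    by have [] := ac_density_le hm (ecomp _ (mpsi n)) (fun x _ => expR_ge0 _) (hexp _ fm).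
  by rewrite -(rintE (hexp _ sfin)) -(rintE hev) -EFinD lee_fin; lra.
(* Approximation in [L^1] of the sum controls the error for both measures at once. *)
pose rho : {measure set R -> \bar R} := measure_add A mu.
have rfin : (rho I < +oo)%E by rewrite [rho I](measure_addE A mu I) lte_add_pinfty.
have hr : intg rho (fun x => psi n x + n%:R).
  by apply: intgD; [exact: hpsi|exact: (intg_cst rfin)].
pose L : R := expR n%:R.
have L0 : 1 <= L by rewrite -(@expR0 R) ler_expR.
have r0 x : I x -> 0 <= psi n x + n%:R.
  by move=> _; have := psiN n x; rewrite ler_norml => /andP[]; lra.
(* [psi n] is raised by [n] to become nonnegative, and [q] is nonnegative too: then
   [e^(n - q) <= L = e^n], so that replacing [psi n] in the exponential costs at most [L] times the
   distance. *)
have [q [q0 Hq]] := ge0_poly_approx rfin hr r0 (e := e / 4 / L) ltac:(by rewrite !divr_gt0// ?(lt_le_trans ltr01)).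
pose d x := `|psi n x + n%:R - q.[x]|.
have md : measurable_fun I d.
  apply: (measurableT_comp (@normr_measurable R setT)); apply: measurable_funB.
    exact: measurable_funD.
  exact: (cont_measurable (@cont_horner R q)).
have hd : intg rho d by apply: intg_norm; apply: intgB => //; exact: (intg_poly rfin).
have [[hdA dA] [hdm dm]] : (intg A d /\ rint A d <= e / 4 / L) /\ (intg mu d /\ rint mu d <= e / 4 / L).
  have d0 x : I x -> 0 <= d x by move=> _; exact: normr_ge0.
  have d0E x : I x -> (0 <= (d x)%:E)%E by move=> xI; rewrite lee_fin d0.
  have E := ge0_integral_measure_add A mu mI d0E ltac:(exact/measurable_EFinP).
  have F : (\int[A]_(x in I) (d x)%:E + \int[mu]_(x in I) (d x)%:E <= (e / 4 / L)%:E)%E.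
    by rewrite -E -(rintE hd) lee_fin.
  split; apply: intg_ge0 => //; apply: le_trans F.
    by rewrite leeDl// integral_ge0.
  by rewrite leeDr// integral_ge0.
exists (q - n%:R%:P); split.
  have -> : (fun x => expR (- (q - n%:R%:P).[x])) = fun x => expR (n%:R - q.[x]).
    by apply/funext => x; rewrite !hornerE opprB.
  have hq : intg mu (fun x => expR (n%:R - q.[x])).
    apply: (intg_cont fm); apply: continuous_subspaceT => x.
    apply: (@continuous_comp _ _ _ (fun x => n%:R - q.[x]) expR); last exact: continuous_expR.
    exact: (cvgB (cvg_cst _) (@continuous_horner _ q x)).
  apply: (@le_trans _ _ (rint mu (fun x => expR (- psi n x) + L * d x))).
    apply: le_rint => //; first by apply: intgD; [exact: hexp|exact: intgZ].
    move=> x xI; set a := - psi n x.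
    have -> : n%:R - q.[x] = a + (psi n x + n%:R - q.[x]) by rewrite /a; ring.
    rewrite -/(d x) /d; set t := psi n x + n%:R - q.[x].
    have atn : a + t <= n%:R by have := q0 x xI; rewrite /a /t; lra.
    by apply: expRD_le; [exact: expR_ge0|rewrite ler_expR].
  rewrite rintD ?rintZ//; [|exact: hexp|exact: intgZ].
  have : L * rint mu d <= L * (e / 4 / L) by rewrite ler_wpM2l//; lra.
  rewrite [L * (_ / L)]mulrC divfK; last by rewrite lt0r_neq0//; lra.
  lra.
have hV : intg A (fun x => `|ln (v x) - psi n x|).
  by apply: intg_norm; apply: intgB => //; exact: hpsi.
apply: (@le_trans _ _ (rint A (fun x => `|ln (v x) - psi n x| + d x))).
  apply: le_rint => [||x _].
  - by apply: intg_norm; apply: intgB => //; exact: (intg_poly fA).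
  - exact: intgD.
  - rewrite !hornerE /d.
    have -> : ln (v x) - (q.[x] - n%:R) = (ln (v x) - psi n x) + (psi n x + n%:R - q.[x]) by ring.
    exact: ler_normD.
rewrite rintD//.
have : e / 4 / L <= e / 4 by rewrite ler_pdivrMr ?(lt_le_trans ltr01)// ler_peMr// ltW.
lra.
Unshelve. all: by end_near.
Qed.

End LogWeightApproximation.


(** * Lower bound for the leading coefficient *)

Section LowerBound.
Variable R : realType.
Local Notation C := (Cplx R).
Local Notation A := (@arcsine R).
Local Notation I := (`[(-1)%R, 1%R]%classic : set R).
Local Notation cp := (map_poly (@toC R)).
Implicit Types (z u : C) (bs : seq C) (p q tau g U V : {poly R}) (h v : R -> R).

Definition admissible n bs (kap : R) tau :=
  [/\ in_disk bs, conj_sym bs, size bs = (2 * n)%N, 0 < kap &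
      forall z, cmod z = 1 -> tau.[complex.Re z] * kap = cmod (bden bs z) ^+ 2].

Lemma admissible_tau_gt0 n bs kap tau x : admissible n bs kap tau -> I x -> 0 < tau.[x].
Proof.
move=> [db sb _ k0 tE] xI; have := tE _ (cmod_ept x); rewrite Re_ept// => E.
have : 0 < tau.[x] * kap.
  by rewrite E exprn_gt0// cmod_gt0 bden_neq0// cmod_ept.
by rewrite pmulr_lgt0.
Qed.

Lemma within_expR_div h tau : {within I, continuous h} ->
  (forall x, I x -> 0 < tau.[x]) -> {within I, continuous (fun x => expR (h x) / tau.[x])}.
Proof.
move=> /subspace_continuousP ch t0; apply/subspace_continuousP => x xI.
apply: cvgM; first by apply: continuous_cvg; [exact: continuous_expR|exact: ch].
apply: cvgV; first by rewrite lt0r_neq0// t0.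
by apply: cvg_within_filter; exact: continuous_horner.
Qed.

Lemma within_polyM (f : R -> R) q : {within I, continuous f} ->
  {within I, continuous (fun x => q.[x] * f x)}.
Proof.
move=> /subspace_continuousP cf; apply/subspace_continuousP => x xI.
apply: cvgM; last exact: cf.
by apply: cvg_within_filter; exact: continuous_horner.
Qed.

(** [Q] is [c p] plus a polynomial of degree less than [n], orthogonal to [p], so its squared norm
    is at least [c^2], where [c] is the quotient of the coefficients of degree [n]. *)
Lemma extremal (m : {finite_measure set R -> \bar R}) h n tau p (Q : {poly R}) :
  {within I, continuous h} -> (forall x, I x -> 0 < tau.[x]) ->
  orthonormal_poly n m h tau p -> (size Q <= n.+1)%N ->
  Q`_n ^+ 2 <= lead_coef p ^+ 2 *
    rint m (fun x => Q.[x] ^+ 2 * (expR (h x) / tau.[x])).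
Proof.
move=> ch t0 [sp lp p0 p1] sQ; have fm := finite_measI m.
pose w x := expR (h x) / tau.[x].
have cw : {within I, continuous w} by exact: within_expR_div.
pose J q := rint m (fun x => q.[x] * w x).
have hJ q : intg m (fun x => q.[x] * w x) by apply: (intg_cont fm); exact: within_polyM.
have JD q1 q2 : J (q1 + q2) = J q1 + J q2.
  by rewrite /J -rintD; [apply: eq_rint => x _; rewrite hornerD mulrDl|exact: hJ|exact: hJ].
have JZ c q : J (c *: q) = c * J q.
  by rewrite /J -rintZ; [apply: eq_rint => x _; rewrite hornerZ -mulrA|exact: hJ].
have J0 : J 0 = 0 by have := JZ 0 0; rewrite scale0r mul0r.
have Jpk k : (k < n)%N -> J (p * 'X^k) = 0.
  move=> /p0 E; rewrite /J /rint /Rintegral -[RHS](congr1 fine E); congr fine.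
  by apply: eq_integral => x _; rewrite hornerM hornerXn.
have Jpp : J (p ^+ 2) = 1.
  rewrite /J /rint /Rintegral -[RHS](congr1 fine p1); congr fine.
  by apply: eq_integral => x _; rewrite horner_exp.
have Jpr (r : {poly R}) : (size r <= n)%N -> J (p * r) = 0.
  move=> sr; have -> : r = \sum_(i < n) r`_i *: 'X^i.
    apply/polyP => i; rewrite coef_sum; have [ni|ni] := leqP n i.
      rewrite nth_default ?(leq_trans sr)// big1// => j _.
      rewrite coefZ coefXn; case: eqP => [E|]; last by rewrite mulr0.
      by have := ltn_ord j; rewrite -E ltnNge ni.
    rewrite (bigD1 (Ordinal ni))//= coefZ coefXn eqxx mulr1 big1 ?addr0// => j ji.
    rewrite coefZ coefXn; case: eqP => [E|]; last by rewrite mulr0.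
    by move/eqP: ji; case; apply: val_inj.
  rewrite mulr_sumr (big_morph J JD J0) big1// => i _.
  by rewrite -scalerAr JZ Jpk ?mulr0.
have J_ge0 q : 0 <= J (q ^+ 2).
  apply: rint_ge0 => x xI; rewrite horner_exp mulr_ge0 ?sqr_ge0//.
  by rewrite divr_ge0 ?expR_ge0// ltW// t0.
pose c := Q`_n / lead_coef p; pose r := Q - c *: p.
have lpE : lead_coef p = p`_n by rewrite lead_coefE sp.
have sr : (size r <= n)%N.
  apply/leq_sizeP => j nj; rewrite /r coefB coefZ.
  have [->|jn] := eqVneq j n; first by rewrite -lpE /c divfK ?subrr// lt0r_neq0.
  have {nj jn} nj : (n < j)%N by rewrite ltn_neqAle eq_sym jn.
  by rewrite !nth_default ?sp ?mulr0 ?subrr//; apply: leq_trans nj.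
have QE : Q ^+ 2 = r ^+ 2 + (2 * c) *: (p * r) + c ^+ 2 *: (p ^+ 2).
  have -> : Q = r + c *: p by rewrite /r subrK.
  rewrite -!mul_polyC polyCM polyC_exp polyC_natr; ring.
have JQ : c ^+ 2 <= J (Q ^+ 2).
  by rewrite QE !JD !JZ Jpr// Jpp mulr0 addr0 mulr1 lerDr.
have -> : rint m (fun x => Q.[x] ^+ 2 * (expR (h x) / tau.[x])) = J (Q ^+ 2).
  by apply: eq_rint => x _; rewrite horner_exp.
rewrite -ler_pdivrMl ?exprn_gt0//; apply: le_trans JQ.
by rewrite /c expr_div_n mulrC.
Qed.

Definition outer_pair U g := forall z, cmod z = 1 -> U.[complex.Re z] = 2 * complex.Re (cp g).[z].

Lemma cmod_outer U g z : outer_pair U g -> cmod z = 1 -> cmod (outer g z) ^+ 2 = expR U.[complex.Re z].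
Proof.
by move=> Ug z1; rewrite Ug// cmod_cexp -expRM_natl.
Qed.

(** This is the value at [0] of [hardy_fun], [lead_coef p / 2 ^+ n] being the constant term of the
    reciprocal polynomial. *)
Definition gamma0 g n kap p : R := Num.sqrt (2 * kap) * expR g.[0] * (lead_coef p / 2 ^+ n).

(** [T] depends on [U], [g] and [eta] alone. From [h + V <= U] at every point follows
    [e^h <= e^(- V) e^U], also on the singular part of [m]; the trial polynomial makes the remaining
    factor [X] bounded, with mean close to [1], and [ac_compare] applies. *)
Lemma lower_bound U V g (eta : R) : outer_pair U g -> 0 < eta -> eta <= 1 ->
  exists T : R, forall n bs kap tau (m : {finite_measure set R -> \bar R}) v h p (d : R),
  (0 < n)%N -> admissible n bs kap tau -> T <= deficit bs ->
  ac_density m A v -> log_integrable A v -> {within I, continuous h} ->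
  (forall x, I x -> h x + V.[x] <= U.[x]) ->
  rint m (fun x => expR (- V.[x])) <= 1 + d ->
  rint A (fun x => `|ln (v x) - V.[x]|) <= d ->
  orthonormal_poly n m h tau p ->
  (1 - eta) ^+ 2 <= gamma0 g n kap p ^+ 2 * (1 + 10 * eta + 16 * d).
Proof.
move=> Ug eta0 eta1; have [T1 HT1] := trial_numerator g eta0.
have [T2 HT2] := phase_mean_small g 0 eta0.
exists (Num.max T1 T2) => n bs kap tau m v h p d n0 adm.
rewrite ge_max => /andP[Tb1 Tb2] hm lv ch hVU mV AV op.
have t0 x (xI : I x) : 0 < tau.[x] := admissible_tau_gt0 adm xI.
have [db sb s2n k0 tE] := adm.
have [N [sN HN]] := HT1 bs db sb Tb1; rewrite s2n in sN.
have cP := HT2 bs db Tb2.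
pose Q0 := trial_poly n N.
(* The scaling cancels [kap] and supplies the factor in [2 (Re y)^2 = |y|^2 + Re (y^2)], by which
   [X] is expanded. *)
pose a := Num.sqrt (2 / kap).
have a2 : a ^+ 2 = 2 / kap by rewrite sqr_sqrtr// divr_ge0// ltW.
pose S z := (cp N).[z] * outer g z / bden bs z.
have S1 z : cmod z <= 1 -> cmod (S z) <= 1 + eta.
  by move=> z1; have := HN z z1; have := cmod_dist (S z) 1; rewrite cmod1 /S; lra.
have cS : ccont S.
  exact: (ccontM (ccontM (@ccont_horner _ (cp N)) (@outer_ccont _ g)) (bdenV_ccont db)).
have cph : ccont (phase bs g) := @phase_ccont _ bs g db.
have cphc : ccont (fun z => (phase bs g z)^*) := ccont_conj cph.
have cS2 : ccont (fun z => S z ^+ 2) := @ccontX _ _ 2 cS.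
pose X x := (a * Q0.[x]) ^+ 2 * (expR U.[x] / tau.[x]).
have cX : {within I, continuous X}.
  have -> : X = (fun x => ((a *: Q0) ^+ 2).[x] * (expR U.[x] / tau.[x])).
    by apply/funext => x; rewrite horner_exp hornerZ.
  by apply: within_polyM; apply: within_expR_div => //; exact: cont_horner.
(* Here [S = z^n y k] with [k = outer g / bden bs], and the phase is [z^(2 n) k / k^*], so that
   [S^2] times its conjugate is [y^2 |k|^2]. *)
have XE z : cmod z = 1 -> X (complex.Re z) =
    cmod (S z) ^+ 2 + complex.Re (S z ^+ 2 * (phase bs g z)^*).
  move=> z1; have z0 := circle_neq0 z1.
  have D0 : bden bs z != 0 by rewrite bden_neq0// z1.
  have g0 := outer_neq0 g z.
  have zz : z ^- n * (z ^- n)^* = 1.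
    by rewrite fmorphV rmorphXn /= -invfM -exprMn mul_conj z1 expr1n rmorph1 expr1n invr1.
  set y := z ^- n * (cp N).[z].
  have Q0E : Q0.[complex.Re z] = complex.Re y by exact: trial_poly_circle.
  have tz0 : tau.[complex.Re z] != 0.
    apply/eqP => tz; have := tE z z1; rewrite tz mul0r => /esym/eqP.
    by rewrite expf_eq0 /= cmod_eq0 (negbTE D0).
  have tz : tau.[complex.Re z] = cmod (bden bs z) ^+ 2 / kap.
    by rewrite -tE// mulfK// lt0r_neq0.
  pose k := outer g z / bden bs z.
  have XK : X (complex.Re z) = 2 * complex.Re y ^+ 2 * cmod k ^+ 2.
    rewrite /X Q0E exprMn a2 -(cmod_outer Ug z1) tz /k cmodM cmodV.
    have c0 : cmod (bden bs z) != 0 by rewrite cmod_eq0.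
    by field; rewrite c0 lt0r_neq0.
  have Sy : S z = z ^+ n * (y * k).
    rewrite /S /y /k !mulrA divff ?mul1r//; by rewrite expf_neq0.
  have phE : phase bs g z = z ^+ n * z ^+ n * (k / k^*).
    rewrite /phase blaschke_bden// s2n mul2n -addnn exprD outer_conj bden_conj//.
    rewrite /k rmorphM fmorphV /=.
    have gc0 : (outer g z)^* != 0 by rewrite conjC_eq0.
    have dc0 : (bden bs z)^* != 0 by rewrite conjC_eq0.
    by field; rewrite dc0 gc0 D0.
  have k0' : k != 0 by rewrite mulf_neq0 ?invr_eq0.
  have kc0 : k^* != 0 by rewrite conjC_eq0.
  have zn : z ^+ n * (z ^+ n)^* = 1.
    by rewrite rmorphXn -exprMn mul_conj z1 expr1n rmorph1 expr1n.
  have SP : S z ^+ 2 * (phase bs g z)^* = y ^+ 2 * toC (cmod k ^+ 2).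
    rewrite Sy phE -mul_conj; move: k k0' kc0 {XK Sy phE} => k k0' kc0.
    rewrite !rmorphM fmorphV /= conjCK.
    have -> : (z ^+ n * (y * k)) ^+ 2 * ((z ^+ n)^* * (z ^+ n)^* * (k^* / k)) =
      (z ^+ n * (z ^+ n)^*) ^+ 2 * (y ^+ 2 * (k * k^*)) by field.
    by rewrite zn expr1n mul1r.
  rewrite SP Sy XK; clear - z1; clearbody y k; rewrite !cmodM cmodX z1 expr1n mul1r exprMn.
  rewrite (cmod_sqr y) (expr2 y) ReM ReM ImM /=; move: (cmod k ^+ 2) => K; ring.
(* [|S| <= 2] because [eta <= 1], and each of the two terms of [X] is at most [|S|^2]. *)
have XK x : I x -> 0 <= X x <= 8.
  move=> xI; have e1 := cmod_ept x.
  have X0 : 0 <= X x by rewrite mulr_ge0 ?sqr_ge0// divr_ge0 ?expR_ge0// ltW// t0.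
  rewrite X0 /= -{1}(Re_ept xI) XE//.
  have h1 := S1 (ept x) ltac:(by rewrite e1).
  have h2 : complex.Re (S (ept x) ^+ 2 * (phase bs g (ept x))^*) <= cmod (S (ept x)) ^+ 2.
    apply: le_trans (ler_norm _) _; apply: le_trans (Re_le_cmod _) _.
    by rewrite cmodM cmod_conj cmodX phase_circle// mulr1.
  have h0 := cmod_ge0 (S (ept x)); nra.
(* The errors are [2 eta + eta^2] from [|S|^2], twice as much from replacing [S^2] by [1] in the
   second term, and [eta] from the mean of the phase. *)
have rX : rint A X <= 1 + 10 * eta.
  pose f z := S z ^+ 2 * (phase bs g z)^*.
  have cf : ccont f := ccontM cS2 cphc.
  have rS : rcont (fun z => cmod (S z) ^+ 2) := @rcontX _ _ 2 (rcont_cmod cS).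
  have -> : rint A X = rmean (fun z => cmod (S z) ^+ 2 + complex.Re (f z)).
    apply: eq_rint => x /[!inE] xI; rewrite /ravg -!XE ?cmod_conj ?cmod_ept//.
    by rewrite Re_conj Re_ept//; field.
  rewrite (rmeanD rS (rcont_Re cf)).
  have h1 : rmean (fun z => cmod (S z) ^+ 2) <= 1 + 2 * eta + eta ^+ 2.
    have -> : 1 + 2 * eta + eta ^+ 2 = (1 + eta) ^+ 2 by ring.
    apply: (rmean_le_cst rS) => z z1.
    by rewrite lerXn2r ?nnegrE ?cmod_ge0 ?S1 ?z1//; clear - eta0; lra.
  have h2 : cmod (cmean f - cmean (fun z => (phase bs g z)^*)) <= 2 * (2 * eta + eta ^+ 2).
    rewrite -(cmeanB cf cphc); apply: (cmean_le_cst (ccontB cf cphc)) => z z1.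
    have -> : f z - (phase bs g z)^* = ((S z - 1) * (S z + 1)) * (phase bs g z)^*.
      by rewrite /f; ring.
    rewrite !cmodM cmod_conj phase_circle// mulr1.
    have z1' : cmod z <= 1 by rewrite z1.
    have hh := HN z z1'; rewrite -/(S z) in hh.
    have : cmod (S z + 1) <= 2 + eta.
      by apply: le_trans (cmodD _ _) _; rewrite cmod1; have := S1 z z1'; lra.
    have := cmod_ge0 (S z - 1); have := cmod_ge0 (S z + 1).
    have -> : 2 * eta + eta ^+ 2 = eta * (2 + eta) by ring.
    by move=> q1 q2 q3; apply: ler_pM.
  have h3 : cmod (cmean (fun z => (phase bs g z)^*)) <= eta.
    (* Conjugating the phase amounts to conjugating [z], which leaves the mean unchanged. *)
    rewrite (@eq_cmean _ _ (fun z => phase bs g z^*)); last first.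
      move=> z z1; rewrite /phase rmorphM fmorph_div /= !outer_conj !conjCK.
      congr (_ * _); rewrite !blaschke_bden ?cmod_conj// conjCK !bden_conj//.
      by rewrite fmorph_div rmorphM rmorphXn /= conjCK.
    rewrite (cmean_conj (phase bs g)); apply: le_trans cP.
    by rewrite le_eqVlt; apply/orP; left; apply/eqP; congr cmod;
      apply: eq_cmean => z _; rewrite expr0 mulr1.
  have : complex.Re (cmean f) <= cmod (cmean f).
    by apply: le_trans (ler_norm _) (Re_le_cmod _).
  rewrite {1}/cmean /= => h4.
  have := cmod_dist (cmean f) (cmean (fun z => (phase bs g z)^*)).
  have : eta ^+ 2 <= eta by rewrite expr2 ler_piMr// ltW.
  lra.
have W : rint m (fun x => (a *: Q0).[x] ^+ 2 * (expR (h x) / tau.[x])) <= 1 + 10 * eta + 16 * d.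
  have fm := finite_measI m.
  apply: (@le_trans _ _ (rint m (fun x => expR (- V.[x]) * X x))).
    apply: le_rint.
    - apply: (intg_cont fm).
      have -> : (fun x => (a *: Q0).[x] ^+ 2 * (expR (h x) / tau.[x])) =
          (fun x => ((a *: Q0) ^+ 2).[x] * (expR (h x) / tau.[x])).
        by apply/funext => x; rewrite horner_exp.
      by apply: within_polyM; exact: within_expR_div.
    - apply: (intg_cont fm); move/subspace_continuousP: cX => cX'.
      apply/subspace_continuousP => x xI; apply: cvgM; last exact: cX'.
      apply: continuous_cvg; first exact: continuous_expR.
      by apply: cvgN; apply: cvg_within_filter; exact: continuous_horner.
    - move=> x xI; rewrite hornerZ /X [leRHS]mulrCA; apply: ler_wpM2l; first exact: sqr_ge0.
      rewrite [leRHS]mulrA; apply: ler_wpM2r; first by rewrite invr_ge0 ltW// t0.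
      by rewrite -expRD ler_expR; have := hVU x xI; lra.
  (* The bound 8 times the two errors [d] gives the term [16 d]. *)
  have := @ac_compare _ m v V X 8 hm lv cX XK; lra.
have := extremal ch t0 op (Q := a *: Q0) _.
rewrite (leq_trans (size_scale_leq _ _) (trial_poly_size _ _)) => /(_ isT).
rewrite coefZ trial_poly_coef// => ex.
have {}ex := le_trans ex (ler_wpM2l (sqr_ge0 _) W).
have S0 : (1 - eta) ^+ 2 <= (N`_0 * expR g.[0]) ^+ 2.
  have z0 : cmod (0 : C) <= 1 by rewrite cmod0.
  have := HN 0 z0; rewrite /outer.
  have -> : bden bs 0 = 1 by rewrite /bden big1// => b _; rewrite mulr0 subr0.
  rewrite -(rmorph0 (@toC R)) !horner_cp_toC cexp_toC divr1 -(rmorph1 (@toC R)).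
  rewrite -rmorphM -rmorphB cmod_toC (horner_coef0 N) ler_norml => /andP[h1 _].
  by rewrite lerXn2r ?nnegrE; clear - h1 eta1; lra.
have gE : gamma0 g n kap p ^+ 2 = (2 * kap) * expR g.[0] ^+ 2 * (lead_coef p ^+ 2 / (2 ^+ n) ^+ 2).
  by rewrite /gamma0 !exprMn exprVn sqr_sqrtr// mulr_ge0// ltW.
have e2 : (2 : R) ^+ n = 2 * 2 ^+ n.-1 by rewrite -exprS prednK.
apply: le_trans S0 _; rewrite gE.
have p2 : (0 : R) < 2 ^+ n.-1 by rewrite exprn_gt0.
have -> : (N`_0 * expR g.[0]) ^+ 2 = (a * (N`_0 * 2 ^+ n.-1)) ^+ 2 *
   ((2 * kap) * expR g.[0] ^+ 2 / (2 ^+ n) ^+ 2).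
  rewrite [(a * _) ^+ 2]exprMn a2 e2; field.
  by rewrite lt0r_neq0 // lt0r_neq0.
have -> : 2 * kap * expR g.[0] ^+ 2 * (lead_coef p ^+ 2 / (2 ^+ n) ^+ 2) * (1 + 10 * eta + 16 * d) =
  (lead_coef p ^+ 2 * (1 + 10 * eta + 16 * d)) * ((2 * kap) * expR g.[0] ^+ 2 / (2 ^+ n) ^+ 2) by ring.
apply: ler_wpM2r => //.
by rewrite divr_ge0 ?mulr_ge0 ?sqr_ge0 ?(ltW k0).
Qed.

End LowerBound.


(** * The Schwarz integral *)

Section SchwarzIntegral.
Variable R : realType.
Local Notation C := (Cplx R).
Local Notation A := (@arcsine R).
Local Notation I := (`[(-1)%R, 1%R]%classic : set R).
Local Notation cp := (map_poly (@toC R)).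
Implicit Types (z u : C) (f g : R -> R) (F G : R -> C).

Definition cintg F := intg A (fun x => complex.Re (F x)) /\ intg A (fun x => complex.Im (F x)).
Local Notation cint := (cintegral A I).

Lemma eq_cint F G : {in I, F =1 G} -> cint F = cint G.
Proof.
by move=> FG; congr Complex; apply: eq_Rintegral => x xI; rewrite FG.
Qed.

Lemma cintD F G : cintg F -> cintg G -> cint (fun x => F x + G x) = cint F + cint G.
Proof.
move=> [F1 F2] [G1 G2]; apply: complex_ext; rewrite ?ReD ?ImD /=.
  by rewrite -[RHS]rintD//; apply: eq_rint => x _; rewrite ReD.
by rewrite -[RHS]rintD//; apply: eq_rint => x _; rewrite ImD.
Qed.

Lemma cintZ (c : C) F : cintg F -> cint (fun x => c * F x) = c * cint F.
Proof.
move=> [F1 F2]; have cR1 := intgZ (complex.Re c) F1; have cR2 := intgZ (complex.Re c) F2.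
have cI1 := intgZ (complex.Im c) F1; have cI2 := intgZ (complex.Im c) F2.
apply: complex_ext; rewrite ?ReM ?ImM /=.
  rewrite -(rintZ (complex.Re c) F1) -(rintZ (complex.Im c) F2) -rintB//.
  by apply: eq_rint => x _; rewrite ReM.
rewrite -(rintZ (complex.Re c) F2) -(rintZ (complex.Im c) F1) -rintD//.
by apply: eq_rint => x _; rewrite ImM.
Qed.

Lemma cintgZ (c : C) F : cintg F -> cintg (fun x => c * F x).
Proof.
move=> [F1 F2]; have cR1 := intgZ (complex.Re c) F1; have cR2 := intgZ (complex.Re c) F2.
have cI1 := intgZ (complex.Im c) F1; have cI2 := intgZ (complex.Im c) F2.
split; first by apply: eq_intg (intgB cR1 cI2) => x _; rewrite ReM.
by apply: eq_intg (intgD cR2 cI1) => x _; rewrite ImM.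
Qed.

Lemma cintB F G : cintg F -> cintg G -> cint (fun x => F x - G x) = cint F - cint G.
Proof.
move=> iF iG; rewrite -[- cint G]mulN1r -(cintZ (-1) iG) -(cintD iF (cintgZ (-1) iG)).
by apply: eq_cint => x _; rewrite mulN1r.
Qed.

Lemma cint_le F (b : R -> R) : cintg F -> intg A b -> (forall x, I x -> cmod (F x) <= b x) ->
  cmod (cint F) <= 2 * rint A b.
Proof.
move=> [F1 F2] ib Fb; apply: le_trans (cmod_le_ReIm _) _ => /=.
have h1 : `|rint A (fun x => complex.Re (F x))| <= rint A b.
  apply: le_trans (le_abs_rint F1) _; apply: le_rint => //; first exact: intg_norm.
  by move=> x xI; apply: le_trans (Re_le_cmod _) (Fb x xI).
have h2 : `|rint A (fun x => complex.Im (F x))| <= rint A b.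
  apply: le_trans (le_abs_rint F2) _; apply: le_rint => //; first exact: intg_norm.
  by move=> x xI; apply: le_trans (Im_le_cmod _) (Fb x xI).
move: h1 h2; rewrite /rint; lra.
Qed.

(* Half the sum of the values at the two points of the unit circle above [x] of
   the Schwarz kernel of the disk; it is [(1 - z^2) / (1 + z^2 - 2 x z)]. *)
Definition skern (x : R) z : C := (1 - ept x * z)^-1 + (1 - (ept x)^* * z)^-1 - 1.

Definition schwarz f z : C := cint (fun x => toC (f x) * skern x z).

Lemma kernel_le (r : R) z u : cmod u = 1 -> cmod z <= r -> r < 1 ->
  cmod (1 - u * z)^-1 <= (1 - r)^-1.
Proof.
move=> u1 zr r1; have u1' : cmod u^* = 1 by rewrite cmod_conj.
by have := cmod_kernel_le zr r1 u1'; rewrite conjCK mulrC.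
Qed.

Lemma skern_le (r : R) z x : cmod z <= r -> r < 1 -> cmod (skern x z) <= 3 / (1 - r).
Proof.
move=> zr r1; have e1 := cmod_ept x; have e2 : cmod (ept x)^* = 1 by rewrite cmod_conj.
have h1 := kernel_le e1 zr r1; have h2 := kernel_le e2 zr r1.
have r0 : 0 <= r := le_trans (cmod_ge0 z) zr.
have h3 : 1 <= (1 - r)^-1 by rewrite invf_ge1; lra.
apply: le_trans (cmodB _ _) _; rewrite cmod1.
by have := cmodD (1 - ept x * z)^-1 (1 - (ept x)^* * z)^-1; lra.
Qed.

Lemma kernel_lip (r : R) z z' u : cmod u = 1 -> cmod z <= r -> cmod z' <= r -> r < 1 ->
  cmod ((1 - u * z)^-1 - (1 - u * z')^-1) <= cmod (z - z') / (1 - r) ^+ 2.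
Proof.
move=> u1 zr zr' r1.
have n0 : 1 - u * z != 0 by rewrite neq0_1Br ?u1// (le_lt_trans zr).
have n0' : 1 - u * z' != 0 by rewrite neq0_1Br ?u1// (le_lt_trans zr').
have -> : (1 - u * z)^-1 - (1 - u * z')^-1 = u * (z - z') * ((1 - u * z)^-1 * (1 - u * z')^-1).
  by field; rewrite n0 n0'.
rewrite !cmodM u1 mul1r; apply: ler_wpM2l; first exact: cmod_ge0.
rewrite expr2 invfM; apply: ler_pM; rewrite ?cmod_ge0//; exact: kernel_le.
Qed.

Lemma skern_lip (r : R) z z' x : cmod z <= r -> cmod z' <= r -> r < 1 ->
  cmod (skern x z - skern x z') <= 2 * cmod (z - z') / (1 - r) ^+ 2.
Proof.
move=> zr zr' r1; have e1 := cmod_ept x; have e2 : cmod (ept x)^* = 1 by rewrite cmod_conj.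
have h1 := kernel_lip e1 zr zr' r1; have h2 := kernel_lip e2 zr zr' r1.
have -> : skern x z - skern x z' = ((1 - ept x * z)^-1 - (1 - ept x * z')^-1) +
  ((1 - (ept x)^* * z)^-1 - (1 - (ept x)^* * z')^-1) by rewrite /skern; ring.
by apply: le_trans (cmodD _ _) _; lra.
Qed.

Lemma skern_continuous z x : cmod z < 1 -> {for x, continuous (fun x => skern x z)}.
Proof.
move=> z1; have ce := @ept_continuous R x.
have cc : {for x, continuous (fun x : R => (ept x)^*)}.
  exact: (continuous_cvg _ (@conj_continuous _ (ept x)) ce).
have h (u : R -> C) : {for x, continuous u} -> cmod (u x) = 1 ->
    {for x, continuous (fun x => (1 - u x * z)^-1)}.
  move=> cu u1; apply: cvgV; first by rewrite neq0_1Br ?u1.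
  exact: (cvgB (cvg_cst _) (cvgM cu (cvg_cst _))).
have h1 := h _ ce (cmod_ept x).
have h2 := h _ cc ltac:(by rewrite cmod_conj cmod_ept).
exact: (cvgB (cvgD h1 h2) (cvg_cst _)).
Qed.

Lemma cintg_skern f z : intg A f -> cmod z < 1 -> cintg (fun x => toC (f x) * skern x z).
Proof.
move=> fi z1; have mf := intg_measurable fi.
have ck x := @skern_continuous z x z1.
have b x : I x -> cmod (skern x z) <= 3 / (1 - cmod z) by move=> _; exact: skern_le.
have h (G : C -> R) : (forall z, {for z, continuous G}) -> (forall z, `|G z| <= cmod z) ->
    intg A (fun x => f x * G (skern x z)).
  move=> cG GE; apply: (@intg_le _ _ _ (fun x => (3 / (1 - cmod z)) * `|f x|)).
  - apply: measurable_funM => //; apply: cont_measurable.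
    by apply: continuous_subspaceT => x; exact: (continuous_cvg _ (cG _) (ck x)).
  - by apply: intgZ; exact: intg_norm.
  - move=> x xI; rewrite normrM mulrC; apply: ler_wpM2r => //.
    by apply: le_trans (GE _) (b x xI).
split.
  apply: eq_intg (h _ (@Re_continuous R) (@Re_le_cmod R)) => x _.
  by rewrite ReM /= mul0r subr0.
apply: eq_intg (h _ (@Im_continuous R) (@Im_le_cmod R)) => x _.
by rewrite ImM /= mul0r addr0.
Qed.

Lemma schwarz_le f z (r : R) : intg A f -> cmod z <= r -> r < 1 ->
  cmod (schwarz f z) <= 6 / (1 - r) * rint A (fun x => `|f x|).
Proof.
move=> fi zr r1; have z1 := le_lt_trans zr r1.
have fn := intg_norm fi.
have -> : 6 / (1 - r) * rint A (fun x => `|f x|) =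
    2 * rint A (fun x => 3 / (1 - r) * `|f x|) by rewrite rintZ//; field; rewrite subr_eq0 gt_eqF.
apply: cint_le; [exact: cintg_skern|exact: intgZ|].
move=> x _; rewrite cmodM cmod_toC mulrC; apply: ler_wpM2r => //; exact: skern_le.
Qed.

Lemma schwarz_lip f z z' (r : R) : intg A f -> cmod z <= r -> cmod z' <= r -> r < 1 ->
  cmod (schwarz f z - schwarz f z') <=
  4 / (1 - r) ^+ 2 * rint A (fun x => `|f x|) * cmod (z - z').
Proof.
move=> fi zr zr' r1; have z1 := le_lt_trans zr r1; have z1' := le_lt_trans zr' r1.
have fn := intg_norm fi; have i1 := cintg_skern fi z1; have i2 := cintg_skern fi z1'.
rewrite /schwarz -cintB//.
pose c := 2 * cmod (z - z') / (1 - r) ^+ 2.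
have -> : 4 / (1 - r) ^+ 2 * rint A (fun x => `|f x|) * cmod (z - z') =
    2 * rint A (fun x => c * `|f x|).
  by rewrite rintZ// /c; field; rewrite subr_eq0 gt_eqF.
apply: cint_le.
- have [a1 a2] := i1; have [b1 b2] := i2; split.
    by apply: eq_intg (intgB a1 b1) => x _; rewrite ReD ReN.
  by apply: eq_intg (intgB a2 b2) => x _; rewrite ImD ImN.
- exact: intgZ.
move=> x _; rewrite -mulrBr cmodM cmod_toC mulrC; apply: ler_wpM2r => //.
exact: skern_lip.
Qed.

Lemma schwarzB f g z : intg A f -> intg A g -> cmod z < 1 ->
  schwarz (fun x => f x - g x) z = schwarz f z - schwarz g z.
Proof.
move=> fi gi z1; rewrite /schwarz -cintB; [|exact: cintg_skern|exact: cintg_skern].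
by apply: eq_cint => x _; rewrite rmorphB mulrBl.
Qed.

Lemma schwarz0 f : schwarz f 0 = toC (rint A f).
Proof.
rewrite /schwarz (@eq_cint _ (fun x => toC (f x))); last first.
  by move=> x _; rewrite /skern !mulr0 subr0 invr1 addrK mulr1.
apply: complex_ext => //=; rewrite -[RHS](@rint_arcsine_cst R 0).
exact: eq_rint.
Qed.

Lemma schwarz_poly (U g : {poly R}) z : outer_pair U g -> cmod z < 1 ->
  schwarz (horner U) z = 2 * (cp g).[z].
Proof.
move=> Ug z1; set G := fun z => (cp g).[z].
have cG : ccont G := @ccont_horner _ (cp g).
have dG : disk_alg G by exact: disk_alg_poly.
have ck := ccont_kernel z1; have ck2 := ccont_geometric z1.
have cc := @ccont_cst R.
have cGc : ccont (fun u => G u^*) := ccont_comp_conj cG.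
pose k u := (1 - z * u^*)^-1.
pose F u := (G u + G u^*) * (2 * k u - 1).
have SE : schwarz (horner U) z = cmean F.
  have FE x : I x -> (F (ept x) + F (ept x)^*) / 2 = toC U.[x] * skern x z.
    move=> xI; have := Ug _ (cmod_ept x); rewrite Re_ept// => ->.
    have -> : toC (2 * complex.Re (cp g).[ept x]) = G (ept x) + G (ept x)^*.
      rewrite /G horner_cp_conj; apply: complex_ext.
        by rewrite ReD conjCE /=; ring.
      by rewrite ImD conjCE /= subrr.
    by rewrite /F /k /skern !conjCK ![z * _]mulrC; field; 
      rewrite !neq0_1Br ?cmod_conj ?cmod_ept.
  apply: complex_ext; apply: eq_rint => x /[!inE] xI; rewrite -FE// /ravg.
    by rewrite -(rmorph_nat (@toC R) 2) -fmorphV ReM ReD /= mulr0 subr0.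
  by rewrite -(rmorph_nat (@toC R) 2) -fmorphV ImM ImD /= mulr0 add0r mulrC.
pose F1 u := 2 * (G u * k u) - G u.
pose F2 u := 2 * (G u * (1 - z * u)^-1) - G u.
have c1 : ccont F1 := ccontB (ccontM (cc 2) (ccontM cG ck)) cG.
have c3 : ccont (fun u => G u * (1 - z * u)^-1) := ccontM cG ck2.
have c2 : ccont F2 := ccontB (ccontM (cc 2) c3) cG.
have -> : schwarz (horner U) z = cmean F1 + cmean F2.
  rewrite SE -(cmean_conj F2) -(cmeanD c1 (ccont_comp_conj c2)).
  by apply: eq_cmean => u _; rewrite /F /F1 /F2 /k; ring.
rewrite /F1 /F2 (cmeanB (ccontM (cc 2) (ccontM cG ck)) cG) (cmeanB (ccontM (cc 2) c3) cG).
rewrite (cmeanZ _ (ccontM cG ck)) (cmeanZ _ c3) cmean_kernel// (cmean_disk_alg dG cG).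
rewrite cmean_disk_alg//; first by rewrite mulr0 subr0 invr1 mulr1 /G; ring.
by apply: disk_algM => //; exact: disk_alg_geometric.
Qed.

Lemma rint_outer_pair (U g : {poly R}) : outer_pair U g -> rint A (horner U) = 2 * g.[0].
Proof.
move=> Ug; have z0 : cmod (0 : C) < 1 by rewrite cmod0.
have := schwarz_poly Ug z0; rewrite schwarz0 -(rmorph0 (@toC R)) horner_cp_toC.
by rewrite -(rmorph_nat (@toC R) 2) -rmorphM => /(@toC_inj R).
Qed.

End SchwarzIntegral.


(** * Stability of the extremal function in mean square *)

Section HardyStability.
Variable R : realType.
Local Notation C := (Cplx R).
Local Notation A := (@arcsine R).
Local Notation I := (`[(-1)%R, 1%R]%classic : set R).
Local Notation cp := (map_poly (@toC R)).
Implicit Types (z u : C) (F ph : C -> C) (bs : seq C) (p g t th U : {poly R}).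

(** The inequality [2 b <= s + b^2 / s] with a free parameter [s] stands in for Cauchy-Schwarz. *)
Lemma rmean_le_sqr (b : C -> R) (s q : R) : rcont b -> 0 < s ->
  rmean (fun z => b z ^+ 2) <= q -> rmean b <= (s + q / s) / 2.
Proof.
move=> cb s0 hq; have cb2 := @rcontX _ b 2 cb.
have c1 : rcont (fun z => s^-1 * b z ^+ 2) := rcontM (@rcont_cst R s^-1) cb2.
have c2 : rcont (fun z => s + s^-1 * b z ^+ 2) := rcontD (@rcont_cst R s) c1.
have c3 : rcont (fun z => 2^-1 * (s + s^-1 * b z ^+ 2)) := rcontM (@rcont_cst R 2^-1) c2.
apply: (@le_trans _ _ (rmean (fun z => 2^-1 * (s + s^-1 * b z ^+ 2)))).
  apply: le_rmean => // z _.
  have -> : 2^-1 * (s + s^-1 * b z ^+ 2) = b z + (s - b z) ^+ 2 / s / 2.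
    by field; exact: lt0r_neq0.
  by rewrite lerDl divr_ge0// divr_ge0 ?sqr_ge0// ltW.
rewrite (rmeanZ _ c2) (rmeanD (@rcont_cst R s) c1) rmean_cst (rmeanZ _ cb2) mulrC.
rewrite ler_wpM2r// lerD2l mulrC; apply: ler_wpM2r => //.
by rewrite invr_ge0 ltW.
Qed.

(* On the circle [F = ph * conj F] and [|ph| = 1], hence [F * conj ph] has the
   same real part as [F], which is what makes the cross terms computable. *)
Lemma rmean_sqr_defect F ph : disk_alg F -> ccont F -> ccont ph ->
  (forall z, cmod z = 1 -> cmod (ph z) = 1) ->
  (forall z, cmod z = 1 -> F z = ph z * (F z)^*) ->
  rmean (fun z => cmod (F z - 1 - ph z) ^+ 2) =
  rmean (fun z => cmod (F z) ^+ 2) + 2 - 4 * complex.Re (F 0) + 2 * complex.Re (cmean ph).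
Proof.
move=> dF cF cph ph1 Fph.
have c1 : rcont (fun z => cmod (F z) ^+ 2) := @rcontX _ _ 2 (rcont_cmod cF).
have c2 := rcont_Re cF; have c3 := rcont_Re cph.
have c4 : rcont (fun z => 4 * complex.Re (F z)) := rcontM (@rcont_cst R 4) c2.
have c5 : rcont (fun z => 2 * complex.Re (ph z)) := rcontM (@rcont_cst R 2) c3.
have c6 : rcont (fun z => cmod (F z) ^+ 2 + 2) := rcontD c1 (@rcont_cst R 2).
rewrite -(cmean_disk_alg dF cF) /cmean /= -(rmeanZ _ c2) -(rmeanZ _ c3).
rewrite -[X in _ + X - _](rmean_cst (2 : R)).
rewrite -(rmeanD c1 (@rcont_cst R 2)) -(rmeanB c6 c4) -(rmeanD (rcontB c6 c4) c5).
apply: eq_rmean => z z1; have := ph1 z z1 => p1; have Fz := Fph z z1.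
have : cmod (ph z) ^+ 2 = 1 by rewrite p1 expr1n.
move: Fz p1 => + _; move: (F z) (ph z) => [a b] [c d].
rewrite !cmod_sqr /= => E e1.
have := congr1 (@complex.Re R) E; have := congr1 (@complex.Im R) E.
rewrite /= !mulrN => E1 E2.
have h1 := congr1 (fun x => c * x) E2; have h2 := congr1 (fun x => d * x) E1.
have h3 : a * (c ^+ 2 + d ^+ 2) = a by rewrite e1 mulr1.
have E3 : a * c + b * d = a by rewrite /= in h1 h2; lra.
rewrite !oppr0; lra.
Qed.

(** On the circle [|E| <= 1] because [t >= 0], so [|E - 1|^2 <= 2 - 2 Re E], whose mean is
    [2 - 2 e^(- th 0) <= 2 th 0]. The bound thus sees only the mean of [t], not its maximum or
    degree. *)
Lemma outer_ratio_small t th (al : R) : outer_pair t th -> (forall x, I x -> 0 <= t.[x]) ->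
  0 < al -> th.[0] <= al ^+ 2 / 64 ->
  rmean (fun z => cmod (outer (- th) z / (outer (- th) z)^* - 1)) <= al.
Proof.
move=> tth t0 al0 hth; set E := outer (- th).
have cE : ccont E := @outer_ccont _ (- th).
have E0 z : E z != 0 := outer_neq0 _ z.
have Ec0 z : (E z)^* != 0 by rewrite conjC_eq0.
have cB : ccont (fun z => E z - 1) := ccontB cE (@ccont_cst R 1).
have cR : ccont (fun z => E z / (E z)^* - 1).
  have h1 : ccont (fun z => ((E z)^*)^-1) := ccontV (ccont_conj cE) (fun z _ => Ec0 z).
  exact: (ccontB (ccontM cE h1) (@ccont_cst R 1)).
have E1 z : cmod z = 1 -> cmod (E z) <= 1.
  move=> z1; rewrite cmod_cexp -expR0 ler_expR rmorphN hornerN ReN oppr_le0.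
  have := t0 (complex.Re z); rewrite /= in_itv /= -ler_norml -z1 Re_le_cmod => /(_ isT).
  by rewrite tth// pmulr_rge0.
have rE2 : rmean (fun z => cmod (E z - 1) ^+ 2) <= al ^+ 2 / 32.
  have d1 : disk_alg (fun z => E z - 1).
    apply: (disk_algD (@outer_disk_alg _ (- th))); exact: disk_alg_cst.
  have e00 : E 0 = toC (expR (- th.[0])).
    by rewrite /E /outer -(rmorph0 (@toC R)) horner_cp_toC hornerN cexp_toC.
  have c1 : rcont (fun z => cmod (E z) ^+ 2) := @rcontX _ _ 2 (rcont_cmod cE).
  have c2 := rcont_Re cE.
  have c3 : rcont (fun z => 2 - 2 * complex.Re (E z)).
    exact: (rcontB (@rcont_cst R 2) (rcontM (@rcont_cst R 2) c2)).
  apply: (@le_trans _ _ (rmean (fun z => 2 - 2 * complex.Re (E z)))).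
    apply: le_rmean => //; first exact: (@rcontX _ _ 2 (rcont_cmod cB)).
    move=> z z1; have h1 := E1 z z1; have : cmod (E z) ^+ 2 <= 1 by rewrite expr_le1 ?cmod_ge0.
    move: (E z) => [a b]; rewrite !cmod_sqr /= => hab; nra.
  rewrite (rmeanB (@rcont_cst R 2) (rcontM (@rcont_cst R 2) c2)) rmean_cst (rmeanZ _ c2).
  have := cmean_disk_alg (@outer_disk_alg _ (- th)) cE.
  rewrite -/E e00 => /(congr1 (@complex.Re R)) /= ->.
  have := expR_ge1Dx (- th.[0]); lra.
apply: (@le_trans _ _ (rmean (fun z => 4 * cmod (E z - 1)))).
  apply: le_rmean; [exact: rcont_cmod|exact: (rcontM (@rcont_cst R 4) (rcont_cmod cB))|].
  move=> z z1; have E2 := E1 z z1.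
  (* Far from [1] the trivial bound [2] is enough; otherwise [|E| >= 1 / 2] permits the division by
     the conjugate. *)
  have [h|h] := lerP 2^-1 (cmod (E z - 1)).
    apply: (@le_trans _ _ 2); last lra.
    apply: le_trans (cmodB _ _) _; rewrite cmod1 cmodM cmodV cmod_conj divff ?cmod_eq0//.
  have -> : E z / (E z)^* - 1 = ((E z - 1) - (E z - 1)^*) / (E z)^*.
    by rewrite rmorphB rmorph1; field; exact: Ec0.
  rewrite cmodM cmodV cmod_conj ler_pdivrMr ?cmod_gt0//.
  have h1 : 2^-1 <= cmod (E z).
    have := cmod_dist (1 : C) (E z); rewrite cmod1 cmodBC; lra.
  have := cmodB (E z - 1) (E z - 1)^*; rewrite cmod_conj.
  have := cmod_ge0 (E z - 1); nra.
rewrite (rmeanZ _ (rcont_cmod cB)).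
have s0 : 0 < al / 8 by lra.
have := rmean_le_sqr (rcont_cmod cB) s0 rE2.
have -> : al ^+ 2 / 32 / (al / 8) = al / 4 by field; exact: lt0r_neq0.
by move=> h; lra.
Qed.

(** The kernel is expanded in a geometric series up to an order [m] depending on [r] and [e]. The
    remainder is at most a multiple of [r^m], and only finitely many Fourier coefficients of the
    phase are left, whence the uniformity in [z]. *)
Lemma phase_kernel_small g (r e : R) : 0 <= r -> r < 1 -> 0 < e ->
  exists T : R, forall bs, in_disk bs -> T <= deficit bs -> forall z, cmod z <= r ->
  cmod (cmean (fun u => phase bs g u * (1 - z * u^*)^-1)) <= e.
Proof.
move=> r0 r1 e0; pose K := (1 - r)^-1.
have K1 : 1 <= K by rewrite invf_ge1; lra.
have K0 : 0 < K by lra.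
have [m Hm] : exists m, r ^+ m < e / (4 * K).
  by apply: exists_expr_lt => //; rewrite divr_gt0//; lra.
have e10 : 0 < e / 2 / m.+1%:R by rewrite !divr_gt0.
have [T HT] : exists T : R, forall bs, in_disk bs -> T <= deficit bs ->
    forall k, (k < m)%N -> cmod (cmean (fun u => phase bs g u * u^* ^+ k)) <= e / 2 / m.+1%:R.
  move: (m.+1%:R) e10 => w e10; elim: m {Hm} => [|n [T HT]]; first by exists 0.
  have [T' HT'] := phase_mean_small g n e10.
  exists (Num.max T T') => bs db; rewrite ge_max => /andP[h1 h2] k.
  by rewrite ltnS leq_eqVlt => /orP[/eqP->|kn]; [exact: HT'|exact: HT].
exists T => bs db Tb z zr; have z1 := le_lt_trans zr r1.
set Ph := phase bs g; have cP : ccont Ph := @phase_ccont _ bs g db.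
have Ph1 u : cmod u = 1 -> cmod (Ph u) = 1 by exact: phase_circle.
have ck := ccont_kernel z1.
have cc (k : nat) : ccont (fun u => u^* ^+ k : C) :=
  @ccontX _ (fun u => u^*) k (ccont_conj (@ccont_id R)).
have cPk k : ccont (fun u => Ph u * u^* ^+ k) := ccontM cP (cc k).
pose S k u := \sum_(i < k) z ^+ i * (Ph u * u^* ^+ i).
have SS k u : S k.+1 u = S k u + z ^+ k * (Ph u * u^* ^+ k) by rewrite /S big_ord_recr.
have cS k : ccont (S k).
  elim: k => [|k IH].
    by apply: (@ccont_ext _ (fun=> 0)); [move=> u; rewrite /S big_ord0|exact: ccont_cst].
  apply: (@ccont_ext _ (fun u => S k u + z ^+ k * (Ph u * u^* ^+ k))).
    by move=> u; rewrite SS.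
  exact: (ccontD IH (ccontM (@ccont_cst R (z ^+ k)) (cPk k))).
have mS k : (k <= m)%N -> cmod (cmean (S k)) <= k%:R * (e / 2 / m.+1%:R).
  elim: k => [_|k IH km].
    rewrite (@eq_cmean _ _ (fun=> 0)); last by move=> u _; rewrite /S big_ord0.
    by rewrite cmean_cst cmod0 mul0r.
  rewrite (@eq_cmean _ _ (fun u => S k u + z ^+ k * (Ph u * u^* ^+ k))); last first.
    by move=> u _; rewrite SS.
  rewrite (cmeanD (cS k) (ccontM (@ccont_cst R (z ^+ k)) (cPk k))) (cmeanZ _ (cPk k)).
  apply: le_trans (cmodD _ _) _; rewrite -natr1 mulrDl mul1r; apply: lerD.
    exact: IH (ltnW km).
  rewrite cmodM cmodX -[leRHS]mul1r; apply: ler_pM; rewrite ?exprn_ge0 ?cmod_ge0//.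
    by rewrite exprn_ile1 ?cmod_ge0//; lra.
  exact: HT.
have kE u : cmod u = 1 -> Ph u * (1 - z * u^*)^-1 = S m u + (z * u^*) ^+ m * (Ph u * (1 - z * u^*)^-1).
  move=> u1; have n0 : 1 - z * u^* != 0.
    by rewrite mulrC neq0_1Br ?cmod_conj ?u1.
  suff SE : S m u = Ph u * (1 - (z * u^*) ^+ m) / (1 - z * u^*) by rewrite SE; field.
  elim: (m) => [|k IH]; first by rewrite /S big_ord0 expr0 subrr mulr0 mul0r.
  by rewrite SS IH exprS exprMn; field.
pose G u := (z * u^*) ^+ m * (Ph u * (1 - z * u^*)^-1).
have cG : ccont G.
  have h1 : ccont (fun u => (z * u^*) ^+ m).
    apply: (@ccontX _ (fun u => z * u^*)).
    exact: (ccontM (@ccont_cst R z) (ccont_conj (@ccont_id R))).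
  exact: (ccontM h1 (ccontM cP ck)).
rewrite (eq_cmean kE) (cmeanD (cS m) cG).
apply: le_trans (cmodD _ _) _.
have h1 : cmod (cmean G) <= 2 * (r ^+ m * K).
  apply: cmean_le_cst => // u u1; rewrite /G cmodM cmodX (cmodM z) cmod_conj u1 mulr1.
  rewrite (cmodM (Ph u)) Ph1// mul1r; apply: ler_pM; rewrite ?exprn_ge0 ?cmod_ge0//.
    by rewrite lerXn2r ?nnegrE ?cmod_ge0.
  exact: cmod_kernel_le.
have h2 : r ^+ m * K <= e / 4.
  have K40 : 0 < 4 * K by lra.
  move: Hm; rewrite (ltr_pdivlMr _ _ K40); clear; clearbody K; move: (r ^+ m) => q; lra.
have h3 : m%:R * (e / 2 / m.+1%:R) <= e / 2.
  have -> : m%:R * (e / 2 / m.+1%:R) = e / 2 * (m%:R / m.+1%:R) by rewrite mulrCA mulrA.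
  by rewrite ler_piMr ?divr_ge0 ?(ltW e0)// ler_pdivrMr// mul1r ler_nat.
apply: le_trans (lerD (mS m (leqnn m)) h1) _.
apply: le_trans (lerD h3 (ler_wpM2l (ler0n R 2) h2)) _; lra.
Qed.

Lemma outerD g th z : outer (g - th) z = outer g z * outer (- th) z.
Proof. by rewrite /outer rmorphD /= hornerD cexpD. Qed.

(** The order of the choices matters: [d] precedes [g], so that [g] may come from an approximation
    of quality [d]; [T] precedes [t] and [F], which may depend on [n]. Besides the mean square
    defect, the proof compares the phase of [g - th] with that of [g] in mean, since only the latter
    has Fourier coefficients controlled by [T]. *)
Lemma hardy_stability (r e : R) : 0 <= r -> r < 1 -> 0 < e ->
  exists2 d : R, 0 < d & forall g, exists T : R, forall bs t th F,
  in_disk bs -> T <= deficit bs -> outer_pair t th -> (forall x, I x -> 0 <= t.[x]) ->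
  th.[0] <= d -> disk_alg F -> ccont F ->
  (forall u, cmod u = 1 -> F u = phase bs (g - th) u * (F u)^*) ->
  rmean (fun u => cmod (F u) ^+ 2) <= 2 + d -> 1 - d <= complex.Re (F 0) ->
  forall z, cmod z <= r -> cmod (F z - 1) <= e.
Proof.
move=> r0 r1 e0; pose K := (1 - r)^-1.
have K1 : 1 <= K by rewrite invf_ge1; lra.
have K0 : 0 < K by lra.
(* The defect is at most [5 d + 2 e1 + 4 al], which the choices below keep under [be^2]; the Cauchy
   integral then costs at most [e1 + 4 K be <= 3 e / 4]. *)
pose be := e / (8 * K); have be0 : 0 < be by rewrite divr_gt0//; lra.
have beK : K * be = e / 8 by rewrite /be; field; exact: lt0r_neq0.
pose al := Num.min be (be ^+ 2 / 32).
have al0 : 0 < al by rewrite lt_min be0 divr_gt0// exprn_gt0.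
have albe : al <= be by rewrite ge_min lexx.
have albe2 : al <= be ^+ 2 / 32 by rewrite ge_min lexx orbT.
pose e1 := Num.min (e / 4) (be ^+ 2 / 32).
have e10 : 0 < e1 by rewrite lt_min !divr_gt0// exprn_gt0.
have e1e : e1 <= e / 4 by rewrite ge_min lexx.
have e1be : e1 <= be ^+ 2 / 32 by rewrite ge_min lexx orbT.
pose d := Num.min (al ^+ 2 / 64) (be ^+ 2 / 32).
have d0 : 0 < d by rewrite lt_min !divr_gt0// exprn_gt0.
have dal : d <= al ^+ 2 / 64 by rewrite ge_min lexx.
have dbe : d <= be ^+ 2 / 32 by rewrite ge_min lexx orbT.
exists d => // g; have [T HT] := phase_kernel_small g r0 r1 e10.
exists T => bs t th F db Tb tth t0 thd dF cF Fph F2 F0 z zr.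
have z1 := le_lt_trans zr r1.
set E := outer (- th).
have cE : ccont E := @outer_ccont _ (- th).
have E0 u : E u != 0 := outer_neq0 _ u.
have Ec0 u : (E u)^* != 0 by rewrite conjC_eq0.
have cR : ccont (fun u => E u / (E u)^* - 1).
  have h1 : ccont (fun u => ((E u)^*)^-1) := ccontV (ccont_conj cE) (fun u _ => Ec0 u).
  exact: (ccontB (ccontM cE h1) (@ccont_cst R 1)).
have hE := outer_ratio_small tth t0 al0 (le_trans thd dal).
set ph := phase bs (g - th); have cph : ccont ph := @phase_ccont _ bs (g - th) db.
set Ph := phase bs g; have cPh : ccont Ph := @phase_ccont _ bs g db.
have Ph1 u : cmod u = 1 -> cmod (Ph u) = 1 by exact: phase_circle.
have phE u : ph u = Ph u + Ph u * (E u / (E u)^* - 1).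
  rewrite /ph /phase !outerD -/E !outer_conj -/E /Ph /phase outer_conj.
  by rewrite /E outer_conj -/E; field; rewrite Ec0 conjC_eq0 outer_neq0.
have c2 : ccont (fun u => Ph u * (E u / (E u)^* - 1)) := ccontM cPh cR.
have cmph : cmod (cmean ph) <= e1 + 2 * al.
  rewrite (eq_cmean (fun u _ => phE u)) (cmeanD cPh c2).
  apply: le_trans (cmodD _ _) _; apply: lerD.
    have := HT bs db Tb 0; rewrite cmod0 => /(_ r0).
    by under [in X in X -> _]eq_cmean do rewrite mul0r subr0 invr1 mulr1.
  have : cmod (cmean (fun u => Ph u * (E u / (E u)^* - 1))) <=
      2 * rmean (fun u => cmod (E u / (E u)^* - 1)).
    apply: (cmean_le c2 (rcont_cmod cR)) => u u1.
    by rewrite cmodM Ph1// mul1r.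
  by move: hE; rewrite -/E; lra.
have ph1 u : cmod u = 1 -> cmod (ph u) = 1 by exact: phase_circle.
pose W u := F u - 1 - ph u.
have cF1 : ccont (fun u => F u - 1) := ccontB cF (@ccont_cst R 1).
have cW : ccont W := ccontB cF1 cph.
have W2 : rmean (fun u => cmod (W u) ^+ 2) <= be ^+ 2.
  rewrite (rmean_sqr_defect dF cF cph ph1 Fph).
  have : complex.Re (cmean ph) <= cmod (cmean ph) by apply: le_trans (ler_norm _) (Re_le_cmod _).
  have := sqr_ge0 be; lra.
have W1 : rmean (fun u => cmod (W u)) <= be.
  have := rmean_le_sqr (rcont_cmod cW) be0 W2.
  have -> : be ^+ 2 / be = be by field; exact: lt0r_neq0.
  lra.
have ck := ccont_kernel z1.
have dF1 : disk_alg (fun u => F u - 1) by apply: disk_algD => //; exact: disk_alg_cst.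
rewrite -(cmean_kernel dF1 cF1 z1).
pose k u := (1 - z * u^*)^-1.
have kK u : cmod u = 1 -> cmod (k u) <= K by exact: cmod_kernel_le.
have FE u : cmod u = 1 -> (F u - 1) * k u =
    (W u + Ph u * (E u / (E u)^* - 1)) * k u + Ph u * k u.
  by move=> _; rewrite /W phE; ring.
have c3 : ccont (fun u => (W u + Ph u * (E u / (E u)^* - 1)) * k u) := ccontM (ccontD cW c2) ck.
rewrite (eq_cmean FE) (cmeanD c3 (ccontM cPh ck)).
apply: le_trans (cmodD _ _) _.
have h1 := HT bs db Tb z zr.
have cb : rcont (fun u => cmod (W u) + cmod (E u / (E u)^* - 1)).
  exact: (rcontD (rcont_cmod cW) (rcont_cmod cR)).
have h2 : cmod (cmean (fun u => (W u + Ph u * (E u / (E u)^* - 1)) * k u)) <=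
    2 * rmean (fun u => K * (cmod (W u) + cmod (E u / (E u)^* - 1))).
  apply: (cmean_le c3 (rcontM (@rcont_cst R K) cb)) => u u1.
  rewrite cmodM mulrC; apply: ler_pM; rewrite ?cmod_ge0//; first exact: kK.
  apply: le_trans (cmodD _ _) _; by rewrite cmodM Ph1// mul1r.
rewrite (rmeanZ _ cb) (rmeanD (rcont_cmod cW) (rcont_cmod cR)) in h2.
have h3 : K * (rmean (fun u => cmod (W u)) + rmean (fun u => cmod (E u / (E u)^* - 1))) <= K * (be + be).
  by apply: ler_wpM2l; [exact: ltW|apply: lerD => //; apply: le_trans hE albe].
by move: h1 h2; rewrite -/Ph -/k; clear - h3 beK e1e e0; lra.
Qed.

End HardyStability.


(** * Asymptotics in the disk for one approximating polynomial *)

Section Asymptotics.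
Variable R : realType.
Local Notation C := (Cplx R).
Local Notation A := (@arcsine R).
Local Notation I := (`[(-1)%R, 1%R]%classic : set R).
Local Notation cp := (map_poly (@toC R)).
Implicit Types (z u : C) (bs : seq C) (p tau g t th U : {poly R}) (v h : R -> R).

(** The expansion of [z^n p((z + 1/z) / 2)] in which the pole at [0] is visibly cancelled. *)
Definition reciprocal n p : {poly R} :=
  \sum_(k < n.+1) (p`_k / 2 ^+ k) *: (('X^2 + 1) ^+ k * 'X^(n - k)).

Lemma reciprocalE n p z : (size p <= n.+1)%N -> z != 0 ->
  (cp (reciprocal n p)).[z] = z ^+ n * (cp p).[(z + z^-1) / 2].
Proof.
move=> sp z0.
rewrite rmorph_sum horner_sum (horner_coef_wide _ (n := n.+1)); last first.
  by rewrite size_map_poly.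
rewrite mulr_sumr; apply: eq_bigr => k _; rewrite coef_map /= map_polyZ hornerZ /=.
have -> : cp (('X^2 + 1) ^+ k * 'X^(n - k)) = ('X^2 + 1) ^+ k * 'X^(n - k).
  by rewrite rmorphM /= rmorphXn /= rmorphD /= rmorph1 !map_polyXn.
rewrite hornerM horner_exp hornerD !hornerXn (hornerC 1) fmorph_div rmorphXn rmorph_nat.
have -> : z ^+ n = z ^+ k * z ^+ (n - k) by rewrite -exprD subnKC// -ltnS.
have -> : (z + z^-1) / 2 = (z ^+ 2 + 1) / 2 / z by field; rewrite z0.
rewrite !exprMn !exprVn; field.
by rewrite !expf_neq0.
Qed.

Lemma reciprocal0 n p : (reciprocal n p).[0] = p`_n / 2 ^+ n.
Proof.
rewrite /reciprocal horner_sum big_ord_recr /= subnn expr0 mulr1 big1; last first.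
  move=> k _; rewrite hornerZ hornerM hornerXn expr0n subn_eq0 leqNgt ltn_ord /=.
  by rewrite !mulr0.
by rewrite add0r hornerZ horner_exp !hornerE expr0n add0r expr1n mulr1.
Qed.

Definition hardy_fun g n bs kap p z : C :=
  toC (Num.sqrt (2 * kap)) * outer g z * (cp (reciprocal n p)).[z] / bden bs z.

Section Basic.
Variables (g p : {poly R}) (n : nat) (bs : seq C) (kap : R) (tau : {poly R}).
Hypothesis adm : admissible n bs kap tau.
Hypothesis sp : size p = n.+1.
Local Notation F := (hardy_fun g n bs kap p).

Lemma hardy_fun_disk_alg : disk_alg F.
Proof.
have [db _ _ _ _] := adm; apply: disk_algM; last exact: bdenV_disk_alg.
apply: disk_algM; last exact: disk_alg_poly.
by apply: disk_algM; [exact: disk_alg_cst|exact: outer_disk_alg].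
Qed.

Lemma hardy_fun_ccont : ccont F.
Proof.
have [db _ _ _ _] := adm.
have h1 := ccontM (@ccont_cst R (toC (Num.sqrt (2 * kap)))) (@outer_ccont _ g).
exact: (ccontM (ccontM h1 (@ccont_horner _ (cp (reciprocal n p)))) (bdenV_ccont db)).
Qed.

Lemma hardy_fun0 : F 0 = toC (gamma0 g n kap p).
Proof.
rewrite /hardy_fun /outer -(rmorph0 (@toC R)) !horner_cp_toC reciprocal0 cexp_toC.
have -> : bden bs (toC 0) = 1 by rewrite /bden big1// => b _; rewrite rmorph0 mulr0 subr0.
by rewrite divr1 -!rmorphM /gamma0 lead_coefE sp.
Qed.

Lemma reciprocal_circle z : cmod z = 1 ->
  (cp (reciprocal n p)).[z] = z ^+ n * toC p.[complex.Re z].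
Proof.
move=> z1; rewrite reciprocalE ?sp ?circle_neq0//; congr (_ * _).
rewrite -(horner_cp_toC p); congr (_.[_]); rewrite -conj_circle//.
apply: complex_ext; rewrite -(rmorph_nat (@toC R) 2) -fmorphV ?ReM ?ImM ReD ImD conjCE /=.
  by field.
by rewrite subrr !mulr0 !mul0r addr0.
Qed.

(** On the circle the reciprocal polynomial is [z^n] times a real number, which drops out of the
    relation between [F] and its conjugate. *)
Lemma hardy_fun_conj z : cmod z = 1 -> F z = phase bs g z * (F z)^*.
Proof.
move=> z1; have [db sb s2n _ _] := adm; have z0 := circle_neq0 z1.
rewrite /hardy_fun /phase blaschke_bden// s2n mul2n -addnn exprD !reciprocal_circle//.
rewrite bden_conj// outer_conj.
have D0 : bden bs z != 0 by rewrite bden_neq0// z1.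
have dc0 : (bden bs z)^* != 0 by rewrite conjC_eq0.
have g0 := outer_neq0 g z; have gc0 : (outer g z)^* != 0 by rewrite conjC_eq0.
have zn : z ^+ n * (z ^+ n)^* = 1.
  by rewrite rmorphXn -exprMn mul_conj z1 expr1n rmorph1 expr1n.
move: D0 dc0 g0 gc0 zn; move: (bden bs z) (outer g z) (z ^+ n) => d o y D0 dc0 g0 gc0 zn.
have := conj_toC (Num.sqrt (2 * kap)); have := conj_toC p.[complex.Re z].
move: (toC (Num.sqrt _)) (toC p.[_]) => k x xc kc.
rewrite !rmorphM fmorphV /= kc xc -[LHS](mulr1) -zn; field.
by rewrite dc0 gc0 D0.
Qed.

Lemma hardy_fun_norm U z : outer_pair U g -> cmod z = 1 ->
  cmod (F z) ^+ 2 = 2 * (p.[complex.Re z] ^+ 2 * (expR U.[complex.Re z] / tau.[complex.Re z])).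
Proof.
move=> Ug z1; have [db sb s2n k0 tE] := adm.
have D0 : cmod (bden bs z) != 0 by rewrite cmod_eq0 bden_neq0// z1.
have tz : tau.[complex.Re z] = cmod (bden bs z) ^+ 2 / kap by rewrite -tE// mulfK// lt0r_neq0.
rewrite /hardy_fun reciprocal_circle// !cmodM cmodV cmodX z1 expr1n mul1r !cmod_toC.
rewrite -(cmod_outer Ug z1) tz !exprMn exprVn !real_normK ?num_real// sqr_sqrtr; last first.
  by rewrite mulr_ge0// ltW.
by field; rewrite D0 lt0r_neq0.
Qed.

End Basic.

(** The left-hand side of the asymptotics in the variable [phi z], with the true logarithmic weight
    [f] rather than a polynomial; [cexp (schwarz f z)] is the square of the Szego function. *)
Definition szego_ratio f n bs kap p z : C :=
  toC (2 * kap) * cexp (schwarz f z) * (cp (reciprocal n p)).[z] ^+ 2 / bden bs z ^+ 2.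

Lemma ae_expR_ln v h : log_integrable A v ->
  {ae A, forall x, expR (h x + ln (v x)) = expR (h x) * v x}.
Proof.
by move=> [v0 _]; apply: filterS v0 => x vx; rewrite expRD lnK.
Qed.

Lemma cmod_cexpB1 z : cmod z <= 2^-1 -> cmod (cexp z - 1) <= 3 * cmod z.
Proof.
move=> hz; have := cexp_taylor hz.
have := cmodD (cexp z - 1 - z) z; rewrite subrK.
have := cmod_ge0 z; nra.
Qed.

Lemma expRN_lip (y t : R) : 0 <= t -> expR (- t) <= expR (- y) + `|y - t|.
Proof.
move=> t0; have [yt|yt] := lerP (y - t) 0.
  by rewrite (le_trans _ (ler_wpDr (normr_ge0 _) (lexx _)))// ler_expR; lra.
have h1 : 1 - (y - t) <= expR (- (y - t)) by have := expR_ge1Dx (- (y - t)).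
have -> : expR (- y) = expR (- t) * expR (- (y - t)) by rewrite -expRD; congr expR; ring.
have h2 : expR (- t) <= 1 by rewrite -expR0 ler_expR; lra.
rewrite gtr0_norm//.
have := ler_wpM2l (expR_ge0 (- t)) h1; have := ler_wpM2r (ltW yt) h2; lra.
Qed.

Lemma cmod_sqrM_sub1 (x y : C) (e : R) : e <= 1 -> cmod (x - 1) <= e -> cmod (y - 1) <= e ->
  cmod (x ^+ 2 * y - 1) <= 7 * e.
Proof.
move=> e1 hx hy.
have -> : x ^+ 2 * y - 1 = (x - 1) * ((x - 1) + 2) * ((y - 1) + 1) + (y - 1) by ring.
have two : cmod (2 : C) = 2 by rewrite -(rmorph_nat (@toC R) 2) cmod_toC ger0_norm.
have h1 : cmod (x - 1 + 2) <= 3 by apply: le_trans (cmodD _ _) _; rewrite two; lra.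
have h2 : cmod (y - 1 + 1) <= 2 by apply: le_trans (cmodD _ _) _; rewrite cmod1; lra.
apply: le_trans (cmodD _ _) _; rewrite !cmodM.
have h3 : cmod (x - 1) * cmod (x - 1 + 2) * cmod (y - 1 + 1) <= e * 3 * 2.
  by apply: ler_pM; rewrite ?mulr_ge0 ?cmod_ge0//; apply: ler_pM; rewrite ?cmod_ge0.
lra.
Qed.

Lemma mulr_expRN_ge (x t d d1 : R) : 0 <= t -> 2 * t <= 2 * d -> d <= d1 / 3 -> d <= 1 / 2 ->
  1 - d <= x -> 1 - d1 <= x * expR (- t).
Proof.
move=> t0 td dd1 d2 dx; have h1 := expR_ge1Dx (- t); have h2 := expR_gt0 (- t).
apply: le_trans (_ : (1 - d) * (1 - t) <= _); first nra.
by apply: ler_pM => //; lra.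
Qed.

(** [F] is formed with [U - t], so that [e^(U - t)] exceeds [e^(h + log v)] by a controlled amount,
    and [mean |F|^2 <= 2 + d1] follows from the normalization of [p] by discarding the singular part
    of [m]. The difference between [h + log v] and [U - t] is small in [L^1], and [schwarz_le] turns
    it into a factor close to [1] on [|z| <= r]. *)
Lemma asymptotic_core (r e : R) : 0 <= r -> r < 1 -> 0 < e ->
  exists2 d : R, 0 < d & forall U g, outer_pair U g -> exists T : R,
  forall n bs kap tau (m : {finite_measure set R -> \bar R}) v h p,
  admissible n bs kap tau -> T <= deficit bs ->
  ac_density m A v -> log_integrable A v -> {within I, continuous h} ->
  orthonormal_poly n m h tau p ->
  rint A (fun x => `|U.[x] - (h x + ln (v x))|) <= d ->
  1 - d <= gamma0 g n kap p ->
  forall z, cmod z <= r ->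
  cmod (szego_ratio (fun x => h x + ln (v x)) n bs kap p z - 1) <= e.
Proof.
move=> r0 r1 e0.
pose e1 := Num.min 1 (e / 10).
have e10 : 0 < e1 by rewrite lt_min ltr01 divr_gt0.
have e11 : e1 <= 1 by rewrite ge_min lexx.
have e1e : e1 <= e / 10 by rewrite ge_min lexx orbT.
have [d1 d10 Hd1] := hardy_stability r0 r1 e10.
pose q := 6 / (1 - r); have q0 : 0 < q by rewrite divr_gt0// subr_gt0.
pose d := Num.min (Num.min (d1 / 3) (1 / 2)) (e1 / (18 * q)).
have d0 : 0 < d by rewrite !lt_min !divr_gt0// mulr_gt0.
have dd1 : d <= d1 / 3 by rewrite !ge_min lexx.
have d2 : d <= 1 / 2 by rewrite !ge_min lexx orbT.
have dq : q * (3 * d) <= e1 / 6.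
  have : d <= e1 / (18 * q) by rewrite !ge_min lexx orbT.
  have q18 : 0 < 18 * q by rewrite mulr_gt0.
  rewrite (ler_pdivlMr _ _ q18); clearbody d q e1; lra.
exists d => // U g Ug; have [T HT] := Hd1 g; exists T => n bs kap tau m v h p adm Tb hm lv ch op dU gam z zr.
have z1 := le_lt_trans zr r1.
have sp : size p = n.+1 by case: op.
have t0 x (xI : I x) : 0 < tau.[x] := admissible_tau_gt0 adm xI.
have [db sb s2n k0 tE] := adm.
have fA := arcsine_fin R.
have lvi := log_integrable_intg lv.
pose f x := h x + ln (v x).
have hi : intg A h by exact: intg_cont.
have fi : intg A f by exact: intgD.
pose dl x := U.[x] - f x.
have dli : intg A dl by apply: intgB => //; exact: intg_poly.
(* The positive part of [dl], the excess of [U]; it is merely integrable, so a polynomial [t] has to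
   replace it. *)
pose dp x := (dl x + `|dl x|) / 2.
have dpi : intg A dp.
  apply: eq_intg (intgZ 2^-1 (intgD dli (intg_norm dli))) => x _.
  by rewrite /dp mulrC.
have dp0 x : I x -> 0 <= dp x.
  move=> _; rewrite /dp divr_ge0//; have := ler_norm (- dl x); rewrite normrN; lra.
have dpl x : dl x <= dp x <= `|dl x|.
  by rewrite /dp; have := ler_norm (dl x); lra.
pose w x := p.[x] ^+ 2 * (expR U.[x] / tau.[x]).
have wE : w = (fun x => (p ^+ 2).[x] * (expR U.[x] / tau.[x])).
  by apply/funext => x; rewrite horner_exp.
have cw : {within I, continuous w}.
  by rewrite wE; apply: within_polyM; apply: within_expR_div => //; exact: cont_horner.
have [M M0 HM] := segment_bounded cw.
(* [M] bounds [p^2 e^U / tau] and depends on [n] and [p]. So does the accuracy [ep] of [t], which is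
   admissible because [T] was fixed before [t]. *)
pose ep := Num.min d (d1 / (2 * M)).
have ep0 : 0 < ep by rewrite lt_min d0 divr_gt0// mulr_gt0.
have epd : ep <= d by rewrite ge_min lexx.
have epM : 2 * (M * ep) <= d1.
  have : ep <= d1 / (2 * M) by rewrite ge_min lexx orbT.
  have M2 : 0 < 2 * M by rewrite mulr_gt0.
  rewrite (ler_pdivlMr _ _ M2); lra.
have [t [tpos tapp]] := ge0_poly_approx fA dpi dp0 ep0.
have [th tth] := half_analytic_circle t.
have tI := intg_poly fA t.
have rt : rint A (horner t) <= d + ep.
  apply: (@le_trans _ _ (rint A (fun x => `|dl x| + `|dp x - t.[x]|))).
    apply: le_rint => //.
      by apply: intgD; apply: intg_norm => //; exact: intgB.
    move=> x xI; have := dpl x => /andP[_ h1].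
    have := ler_norm (- (dp x - t.[x])); rewrite normrN; lra.
  rewrite rintD; [|exact: intg_norm|by apply: intg_norm; exact: intgB].
  by apply: lerD.
have th0 : 2 * th.[0] <= d + ep by rewrite -(rint_outer_pair tth).
have rt0 : 0 <= th.[0].
  have : 0 <= rint A (horner t) by exact: rint_ge0.
  by rewrite (rint_outer_pair tth) pmulr_rge0.
have utg : outer_pair (U - t) (g - th).
  move=> u u1; rewrite hornerD hornerN Ug// tth// rmorphB hornerD hornerN ReD ReN; ring.
set F := hardy_fun (g - th) n bs kap p.
have FN u : cmod u = 1 -> cmod (F u) ^+ 2 =
    2 * (p.[complex.Re u] ^+ 2 * (expR (U - t).[complex.Re u] / tau.[complex.Re u])).
  exact: (hardy_fun_norm adm sp utg).
have F2 : rmean (fun u => cmod (F u) ^+ 2) <= 2 + d1.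
  have fm := finite_measI m.
  pose y x := p.[x] ^+ 2 * (expR (h x) / tau.[x]).
  have yE : y = (fun x => (p ^+ 2).[x] * (expR (h x) / tau.[x])).
    by apply/funext => x; rewrite horner_exp.
  have cy : {within I, continuous y}.
    by rewrite yE; apply: within_polyM; exact: within_expR_div.
  have y0 x : I x -> 0 <= y x.
    by move=> xI; rewrite mulr_ge0 ?sqr_ge0// divr_ge0 ?expR_ge0// ltW// t0.
  have [yi yle] := ac_density_le hm (cont_measurable cy) y0 (intg_cont fm cy).
  have y1 : rint m y = 1.
    by case: op => _ _ _ E; rewrite /rint /Rintegral -[RHS](congr1 fine E).
  rewrite y1 in yle.
  pose yu x := p.[x] ^+ 2 * (expR (U - t).[x] / tau.[x]).
  have yuE : yu = (fun x => (p ^+ 2).[x] * (expR (U - t).[x] / tau.[x])).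
    by apply/funext => x; rewrite horner_exp.
  have yui : intg A yu.
    apply: (intg_cont fA).
    by rewrite yuE; apply: within_polyM; apply: within_expR_div => //; exact: cont_horner.
  have ti : intg A (fun x => M * `|dp x - t.[x]|).
    by apply: intgZ; apply: intg_norm; exact: intgB.
  have -> : rmean (fun u => cmod (F u) ^+ 2) = 2 * rint A yu.
    rewrite -rintZ//; apply: eq_rint => x /[!inE] xI; rewrite /ravg !FN ?cmod_conj ?cmod_ept//.
    by rewrite Re_conj Re_ept// /yu; field; rewrite lt0r_neq0// t0.
  suff : rint A yu <= rint A (fun x => y x * v x) + M * rint A (fun x => `|dp x - t.[x]|).
    have : M * rint A (fun x => `|dp x - t.[x]|) <= M * ep by apply: ler_wpM2l => //; exact: ltW.
    lra.
  rewrite -rintZ; last by apply: intg_norm; exact: intgB.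
  rewrite -rintD//; apply: ae_le_rint => //; first exact: intgD.
  apply: filterS (ae_expR_ln h lv) => x hx xI.
  have -> : y x * v x = p.[x] ^+ 2 * (expR (f x) / tau.[x]).
    by rewrite /y hx; ring.
  have h1 : expR (U - t).[x] <= expR (f x) + expR U.[x] * `|dp x - t.[x]|.
    have fE : f x = U.[x] - dl x by rewrite /dl; ring.
    rewrite fE hornerD hornerN !expRD -mulrDr ler_pM2l ?expR_gt0//.
    apply: le_trans (expRN_lip (dp x) (tpos x xI)) _.
    by rewrite lerD2r ler_expR lerN2; case/andP: (dpl x).
  apply: (@le_trans _ _ (p.[x] ^+ 2 * ((expR (f x) + expR U.[x] * `|dp x - t.[x]|) / tau.[x]))).
    apply: ler_wpM2l; first exact: sqr_ge0.
    by apply: ler_wpM2r => //; rewrite invr_ge0 ltW// t0.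
  have -> : p.[x] ^+ 2 * ((expR (f x) + expR U.[x] * `|dp x - t.[x]|) / tau.[x]) =
    p.[x] ^+ 2 * (expR (f x) / tau.[x]) + w x * `|dp x - t.[x]|.
    by rewrite /w; ring.
  rewrite lerD2l; apply: ler_wpM2r => //.
  by apply: le_trans (ler_norm _) _; exact: (HM x xI).
(* Subtracting [t] changes the value at [0] only by the factor [e^(- th 0)], and [2 th 0] is the
   mean of [t]. *)
have F0 : 1 - d1 <= complex.Re (F 0).
  rewrite /F hardy_fun0//=.
  have -> : gamma0 (g - th) n kap p = gamma0 g n kap p * expR (- th.[0]).
    by rewrite /gamma0 hornerD hornerN expRD; ring.
  by apply: (mulr_expRN_ge rt0 _ dd1 d2 gam); clear - th0 epd; lra.
have thd : th.[0] <= d1 by clear - th0 epd dd1 d10; lra.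
have hd : disk_alg F by exact: hardy_fun_disk_alg adm.
have hc : ccont F by exact: hardy_fun_ccont adm.
have hj u : cmod u = 1 -> F u = phase bs (g - th) u * (F u)^* by exact: (hardy_fun_conj (g - th) adm sp).
have Fz := HT bs t th F db Tb tth tpos thd hd hc hj F2 F0 z zr.
pose s x := f x - (U - t).[x].
have si : intg A s by apply: intgB => //; exact: intg_poly.
have sz : schwarz f z = 2 * (cp (g - th)).[z] + schwarz s z.
  rewrite -(schwarz_poly utg z1) /s schwarzB//; last exact: intg_poly.
  by rewrite addrC subrK.
(* [|s| <= |dl| + t] has integral at most [d + (d + ep) <= 3 d]. *)
have sle : cmod (schwarz s z) <= e1 / 6.
  apply: le_trans (schwarz_le si zr r1) _; apply: le_trans dq.
  apply: ler_wpM2l; first exact: ltW.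
  apply: (@le_trans _ _ (rint A (fun x => `|dl x| + t.[x]))).
    apply: le_rint; [exact: intg_norm|by apply: intgD => //; exact: intg_norm|].
    move=> x xI; rewrite /s hornerD hornerN.
    have -> : f x - (U.[x] - t.[x]) = - dl x + t.[x] by rewrite /dl; ring.
    apply: le_trans (ler_normD _ _) _; rewrite normrN lerD2l ger0_norm//.
    exact: tpos.
  rewrite rintD//; last exact: intg_norm.
  by apply: le_trans (lerD dU rt) _; clear - epd; lra.
have ratioE : szego_ratio f n bs kap p z = F z ^+ 2 * cexp (schwarz s z).
  rewrite /szego_ratio sz cexpD [2 * (cp _).[z]]mulr_natl cexpMn /F /hardy_fun /outer.
  have -> : toC (2 * kap) = toC (Num.sqrt (2 * kap)) ^+ 2.
    by rewrite -rmorphXn sqr_sqrtr// mulr_ge0// ltW.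
  by rewrite !exprMn exprVn; ring.
have sle2 : cmod (schwarz s z) <= 2^-1 by clear - sle e11; lra.
have sle3 : 3 * cmod (schwarz s z) <= e1 by clear - sle e10; lra.
rewrite ratioE; apply: (@le_trans _ _ (7 * e1)); last by clear - e1e e0; lra.
by apply: cmod_sqrM_sub1 => //; exact: le_trans (cmod_cexpB1 sle2) sle3.
Qed.

End Asymptotics.


(** * The conformal map [phi] and the Schwarz kernel *)

Section ConformalMap.
Variable R : realType.
Local Notation C := (Cplx R).
Local Notation Cb := (Cbar R).
Local Notation A := (@arcsine R).
Local Notation I := (`[(-1)%R, 1%R]%classic : set R).
Local Notation cp := (map_poly (@toC R)).
Implicit Types (z u : C).

Lemma intervalC_Re z : complex.Im z = 0 -> `|complex.Re z| <= 1 -> @intervalC R z.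
Proof.
move=> z0 z1; exists (complex.Re z); first by rewrite /= in_itv /= -ler_norml.
by apply: complex_ext => /=.
Qed.

Lemma intervalCP z : @intervalC R z <-> complex.Im z = 0 /\ `|complex.Re z| <= 1.
Proof.
split; last by case; exact: intervalC_Re.
by case=> x /=; rewrite in_itv /= -ler_norml => x1 <-.
Qed.

Lemma joukowski_inj (b d : C) : cmod b < 1 -> cmod d < 1 -> b != 0 -> d != 0 ->
  b + b^-1 = d + d^-1 -> b = d.
Proof.
move=> b1 d1 b0 d0 E; apply/eqP; rewrite -subr_eq0.
have : (b - d) * (1 - b * d) = 0.
  have -> : (b - d) * (1 - b * d) = b * d * ((d + d^-1) - (b + b^-1)).
    by field; rewrite b0 d0.
  by rewrite E subrr mulr0.
by move/eqP; rewrite mulf_eq0 => /orP[//|]; rewrite (negbTE (neq0_1B b1 (ltW d1))).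
Qed.

Lemma intervalC_sqr z : ~ @intervalC R z -> z ^+ 2 - 1 != 0.
Proof.
move=> zI; apply/eqP => E; apply: zI; apply/intervalCP.
have : (z - 1) * (z + 1) = 0 by rewrite -E; ring.
move/eqP; rewrite mulf_eq0 subr_eq0 addr_eq0 => /orP[]/eqP-> /=; split; rewrite ?oppr0//.
  by rewrite normr1.
by rewrite normrN1.
Qed.

Lemma intervalC_conj z : ~ @intervalC R z -> ~ @intervalC R z^*.
Proof.
move=> zI /intervalCP[]; rewrite conjCE /= => /eqP; rewrite oppr_eq0 => /eqP h1 h2.
by apply: zI; apply/intervalCP.
Qed.

Lemma toC_continuous x : {for x, continuous (@toC R)}.
Proof. by apply: (@cvg_Complex _ R (nbhs x) _ id (fun=> 0) x 0); [exact: cvg_id|exact: cvg_cst]. Qed.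

Lemma open_intervalC : open (~` @intervalC R).
Proof.
apply: closed_openC; apply: compact_closed; first exact: norm_hausdorff.
apply: continuous_compact; last exact: segment_compact.
by apply: continuous_subspaceT => x; exact: toC_continuous.
Qed.

Variable w : C -> C.
Hypothesis hw : is_w w.

Lemma w_continuous z : ~ @intervalC R z -> {for z, continuous w}.
Proof.
move=> zI; have [dw _ _] := hw; apply: differentiable_continuous.
by apply/derivable1_diffP; exact: dw.
Qed.

Lemma phi_mul z : ~ @intervalC R z -> phi w (Some z) * (z + w z) = 1.
Proof.
move=> zI; have [_ w2 _] := hw; rewrite /= -subr_sqr w2//; ring.
Qed.

Lemma phi_neq0 z : ~ @intervalC R z -> phi w (Some z) != 0.
Proof.
move=> /phi_mul E; apply/eqP => h; move: E; rewrite h mul0r => /esym/eqP.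
by rewrite oner_eq0.
Qed.

Lemma phiV z : ~ @intervalC R z -> (phi w (Some z))^-1 = z + w z.
Proof.
move=> zI; apply: (mulfI (phi_neq0 zI)).
by rewrite (phi_mul zI) divff// phi_neq0.
Qed.

Lemma phi_joukowski z : ~ @intervalC R z -> z = (phi w (Some z) + (phi w (Some z))^-1) / 2.
Proof. by move=> zI; rewrite phiV//=; field. Qed.

Lemma phi_w z : ~ @intervalC R z -> w z = ((phi w (Some z))^-1 - phi w (Some z)) / 2.
Proof. by move=> zI; rewrite phiV//=; field. Qed.

(** A unimodular [b] has [(b + 1/b) / 2 = Re b], a point of the interval. *)
Lemma phi_neq1 z : ~ @intervalC R z -> cmod (phi w (Some z)) != 1.
Proof.
move=> zI; apply/eqP => h1; apply: (zI); rewrite (phi_joukowski zI) -(conj_circle h1).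
move: (phi _ _) h1 => b b1; apply: intervalC_Re.
  by rewrite -(rmorph_nat (@toC R) 2) -fmorphV ImM ImD conjCE /= subrr !mulr0 mul0r addr0.
rewrite -(rmorph_nat (@toC R) 2) -fmorphV ReM ReD conjCE /= mulr0 subr0.
have -> : (complex.Re b + complex.Re b) * 2^-1 = complex.Re b by field.
by rewrite -b1 Re_le_cmod.
Qed.

Lemma phi_small_far (e : R) : 0 < e -> exists r : R, forall z, r < cmod z ->
  ~ @intervalC R z -> cmod (phi w (Some z)) < e.
Proof.
move=> e0; have [_ _ [M [r Mr]]] := hw.
exists (Num.max r (Num.max 0 ((M + e^-1) / 2))) => z; rewrite !gt_max => /and3P[h1 h2 h3] zI.
have h4 : cmod (phi w (Some z)) <= M by rewrite /= cmodBC; exact: Mr.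
have h5 : e^-1 < cmod (phi w (Some z))^-1.
  rewrite (phiV zI).
  have -> : z + w z = 2 * z - phi w (Some z) by rewrite /=; ring.
  have two : cmod (2 : C) = 2 by rewrite -(rmorph_nat (@toC R) 2) cmod_toC ger0_norm.
  have := cmod_dist (2 * z) (phi w (Some z)).
  have := cmod_dist (2 * z) (2 * z - phi w (Some z)).
  rewrite cmodM two.
  have -> : 2 * z - (2 * z - phi w (Some z)) = phi w (Some z) by ring.
  lra.
by move: h5; rewrite cmodV ltf_pV2 ?posrE// cmod_gt0 phi_neq0.
Qed.

Lemma phi_continuous_some z : ~ @intervalC R z -> {for z, continuous (fun z => phi w (Some z))}.
Proof.
move=> zI; have c1 : {for z, continuous (fun z : C => z)} by exact: cvg_id.
exact: (cvgB c1 (w_continuous zI)).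
Qed.

(** Along the ray [t z], [t >= 1], which avoids the interval, [|phi|] is continuous, never equal to
    [1], and small far away; the intermediate value theorem excludes [|phi z| >= 1]. *)
Lemma phi_lt1_some z : ~ @intervalC R z -> cmod (phi w (Some z)) < 1.
Proof.
move=> zI.
have zt (t : R) : 1 <= t -> ~ @intervalC R (toC t * z).
  move=> t1 /intervalCP[]; rewrite ImM ReM /= !mul0r addr0 subr0 => /eqP.
  rewrite mulf_eq0 => /orP[/eqP|/eqP z0 h]; first lra.
  apply: zI; apply/intervalCP; split => //; apply: le_trans h.
  by rewrite normrM ger0_norm; [rewrite ler_peMl|lra].
have z0 : 0 < cmod z.
  rewrite cmod_gt0; apply/eqP => E; apply: zI; rewrite E; apply: intervalC_Re => //=.
  by rewrite normr0.
have [r Hr] := phi_small_far ltr01.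
pose T := Num.max 1 ((r + 1) / cmod z).
have T1 : 1 <= T by rewrite le_max lexx.
have fT : cmod (phi w (Some (toC T * z))) < 1.
  apply: Hr; last exact: zt.
  rewrite cmodM cmod_toC ger0_norm; last lra.
  have : (r + 1) / cmod z <= T by rewrite le_max lexx orbT.
  by rewrite ler_pdivrMr//; lra.
rewrite ltNge; apply/negP => h1.
pose f (t : R) := cmod (phi w (Some (toC t * z))).
have cf : {within `[1, T], continuous f}.
  apply/subspace_continuousP => t; rewrite /= in_itv /= => /andP[t1 _].
  apply: cvg_within_filter.
  have ct : {for t, continuous (fun t : R => toC t * z)}.
    by apply: cvgM; [exact: toC_continuous|exact: cvg_cst].
  have cphi := phi_continuous_some (zt t t1).
  exact: (continuous_cvg _ (@cmod_continuous R _) (continuous_cvg _ cphi ct)).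
have f1 : 1 <= f 1 by rewrite /f rmorph1 mul1r.
have [|c] := IVT T1 cf (v := 1).
  by rewrite ge_min le_max f1 (ltW fT) orbT.
rewrite in_itv /= => /andP[c1 _] fc.
by have := phi_neq1 (zt c c1); rewrite -/(f c) fc eqxx.
Qed.

Lemma phi_lt1 (p : Cb) : @slit_sphere R p -> cmod (phi w p) < 1.
Proof.
case: p => [z|] zS; last by rewrite cmod0 ltr01.
by apply: phi_lt1_some => zI; apply: zS; exists z.
Qed.

(** The symmetry comes from uniqueness: both sides solve the same Joukowski equation in the disk. *)
Lemma phi_conj z : ~ @intervalC R z -> phi w (Some z^*) = (phi w (Some z))^*.
Proof.
move=> zI; have zIc := intervalC_conj zI.
apply: joukowski_inj; rewrite ?cmod_conj ?phi_lt1_some ?phi_neq0 ?conjC_eq0 ?phi_neq0//.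
have h1 := phi_joukowski zIc; have h2 := congr1 (@Num.conj C) (phi_joukowski zI).
move: h1; rewrite {1}h2 fmorph_div rmorphD fmorphV rmorph_nat => /(mulIf _) ->//.
Qed.

(** From [2 b (z - x) = (1 - e b) (1 - e^* b)] with [b = phi z] and [e = ept x]. *)
Lemma skern_phi (x : R) z : ~ @intervalC R z -> I x ->
  w z / (z - toC x) = skern x (phi w (Some z)).
Proof.
move=> zI xI; have b1 := phi_lt1_some zI; have b0 := phi_neq0 zI.
have zx : z - toC x != 0 by apply/eqP => /subr0_eq E; apply: zI; exists x.
have e1 := cmod_ept x; have ec1 : cmod (ept x)^* = 1 by rewrite cmod_conj.
have n1 : 1 - ept x * phi w (Some z) != 0 by rewrite neq0_1Br ?e1.
have n2 : 1 - (ept x)^* * phi w (Some z) != 0 by rewrite neq0_1Br ?ec1.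
have xE : toC x = (ept x + (ept x)^*) / 2.
  apply: complex_ext; rewrite -(rmorph_nat (@toC R) 2) -fmorphV ?ReM ?ImM ReD ImD conjCE /=.
    by rewrite /= clamp_id//; field.
  by rewrite subrr !mulr0 !mul0r addr0.
have eE : ept x * (ept x)^* = 1 by rewrite mul_conj e1 expr1n rmorph1.
have E1 : 2 * phi w (Some z) * (z - toC x) =
   (1 - ept x * phi w (Some z)) * (1 - (ept x)^* * phi w (Some z)).
  rewrite xE {2}(phi_joukowski zI).
  have -> : (1 - ept x * phi w (Some z)) * (1 - (ept x)^* * phi w (Some z)) =
    1 - (ept x + (ept x)^*) * phi w (Some z) + ept x * (ept x)^* * phi w (Some z) ^+ 2 by ring.
  by rewrite eE; field.
rewrite (phi_w zI) /skern; apply: (mulIf zx); rewrite divfK//.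
move: (phi w (Some z)) b0 n1 n2 E1 zx => b b0 n1 n2 E1 zx.
have -> : z - toC x = (1 - ept x * b) * (1 - (ept x)^* * b) / (2 * b) by rewrite -E1; field.
have -> : (b^-1 - b) / 2 = (1 - ept x * (ept x)^* * b ^+ 2) / (2 * b) by rewrite eE; field.
by field; rewrite n1 n2 b0.
Qed.

Lemma szego_exponent f z : intg A f -> ~ @intervalC R z ->
  w z / 2 * cintegral A I (fun x => toC (f x) / (z - toC x)) =
  schwarz f (phi w (Some z)) / 2.
Proof.
move=> fi zI; have b1 := phi_lt1_some zI.
have w0 : w z != 0.
  have [_ w2 _] := hw; apply/eqP => E; have := w2 z zI.
  by rewrite E expr0n /= => /esym/eqP; rewrite (negbTE (intervalC_sqr zI)).
rewrite (@eq_cint _ _ (fun x => (w z)^-1 * (toC (f x) * skern x (phi w (Some z))))); last first.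
  by move=> x /[!inE] xI; rewrite -skern_phi//; field; rewrite w0 andbT;
    apply/eqP => /subr0_eq E; apply: zI; exists x.
rewrite (cintZ _ (cintg_skern fi b1)) -/(schwarz f _); by field.
Qed.

End ConformalMap.


(** * Limits at infinity and removable singularities *)

Section RiemannSphere.
Variable R : realType.
Local Notation C := (Cplx R).
Local Notation Cb := (Cbar R).
Implicit Types (z u : C) (s : seq Cb).

Lemma nbhs_infty (r : R) : nbhs (None : Cb) [set q : Cb | if q is Some z then r < cmod z else True].
Proof.
pose J := `[- r, r]%classic : set R.
pose D := (fun p : R * R => Complex p.1 p.2 : C) @` (J `*` J).
have cD : compact D.
  apply: continuous_compact; last by apply: compact_setX; exact: segment_compact.
  apply: continuous_subspaceT => -[x y].
  by apply: (@cvg_Complex _ _ (nbhs (x, y)) _ fst snd x y); [exact: cvg_fst|exact: cvg_snd].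
exists D; first by split => //; apply: compact_closed => //; exact: norm_hausdorff.
case=> [z|//] [[u nD [<-]]|//]; rewrite /= ltNge; apply/negP => h; apply: nD.
exists (complex.Re u, complex.Im u); last by case: (u).
split; rewrite /= /J /= in_itv /= -ler_norml; apply: le_trans h.
  exact: Re_le_cmod.
exact: Im_le_cmod.
Qed.

(** A limit along a filter is unique only if the filter is proper. Compact sets of complex numbers
    are bounded, so every neighbourhood of infinity contains finite points. *)
Lemma proper_dnbhs_infty : ProperFilter ((None : Cb)^').
Proof.
apply: Build_ProperFilter_ex => P; rewrite /dnbhs /within /= => -[W [cW _] HW].
have cmodW : {within W, continuous (@cmod R)}.
  by apply: continuous_subspaceT => z; exact: cmod_continuous.
have [r Hr] : exists r : R, forall z, W z -> cmod z <= r.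
  have [->|/set0P W0] := eqVneq W set0; first by exists 0.
  have [c _ Hc] := compact_EVT_max W0 cW cmodW.
  by exists (cmod c) => z Wz; apply: Hc; rewrite inE.
exists (Some (toC (`|r| + 1))); apply: HW => //; left; exists (toC (`|r| + 1)) => //.
move=> /Hr; rewrite cmod_toC ger0_norm; last by rewrite addr_ge0.
by have := ler_norm r; lra.
Qed.

Lemma dnbhs_notin s z : \forall x \near z^', (Some x : Cb) \notin s.
Proof.
elim: s => [|b s IH]; first by near=> x; rewrite in_nil.
suff h : \forall x \near z^', (Some x : Cb) != b.
  by near=> x; rewrite in_cons negb_or; apply/andP; split; near: x.
case: b => [c|]; last by near=> x.
have [->|zc] := eqVneq z c.
  by apply: filterS (@nbhs_dnbhs_neq _ c) => x xc; apply: contra_neq xc => -[].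
apply: (@nbhs_dnbhs _ z).
have h : \forall x \near z, cmod (x - z) < cmod (c - z).
  apply/nbhs_cmodP; exists (cmod (c - z)) => //.
  by rewrite cmod_gt0 subr_eq0 eq_sym.
apply: filterS h => x; apply: contraTneq => -[->]; by rewrite ltxx.
Unshelve. all: by end_near. Qed.

Variable w : C -> C.
Hypothesis hw : is_w w.

Lemma dnbhs_infty_notin s (r : R) :
  \forall q \near (None : Cb)^', exists2 z, q = Some z & r < cmod z /\ q \notin s.
Proof.
have [M HM] : exists M, forall z, (Some z : Cb) \in s -> cmod z <= M.
  elim: s => [|b s [M HM]]; first by exists 0.
  exists (Num.max M (if b is Some c then cmod c else 0)) => z.
  by rewrite in_cons le_max => /orP[/eqP<-|/HM->//]; rewrite lexx orbT.
have := nbhs_infty (Num.max r M); rewrite /dnbhs /within.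
apply: filterS => -[z|]; last by rewrite eqxx.
move=> /=; rewrite gt_max => /andP[h1 h2] _; exists z => //; split => //.
by apply: contraTN h2 => /HM; rewrite -leNgt.
Qed.

Lemma far_intervalC z : 1 < cmod z -> ~ @intervalC R z.
Proof.
move=> h /intervalCP[h1 h2]; move: h; rewrite ltNge => /negP; apply.
by apply: le_trans (cmod_le_ReIm z) _; rewrite h1 normr0 addr0.
Qed.

(** Off the finite list [s] the expression is a continuous function of [phi z], so each limit exists
    and is read off that function; infinity corresponds to [0]. *)
Lemma by_continuity_eq s (f F : C -> C) (p : Cb) :
  (forall u, cmod u < 1 -> {for u, continuous F}) ->
  (forall z, ~ @intervalC R z -> (Some z : Cb) \notin s -> f z = F (phi w (Some z))) ->
  @slit_sphere R p -> by_continuity s f p = F (phi w p).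
Proof.
move=> cF fF pS; have hC : hausdorff_space C := @norm_hausdorff _ _.
case: p pS => [z|] pS /=; last first.
  apply: (@cvg_lim _ hC _ _ proper_dnbhs_infty).
  apply/cvg_cmodP => e e0.
  have := cF 0; rewrite cmod0 => /(_ ltr01)/ccontinuous_atP /(_ e e0)[d d0 Hd].
  have [r Hr] := phi_small_far hw d0.
  have := dnbhs_infty_notin s (Num.max 1 r); apply: filterS => q [z -> [h qs]] /=.
  move: h; rewrite gt_max => /andP[h1 h2]; have zI := far_intervalC h1.
  by rewrite fF//; apply: Hd; rewrite subr0; exact: Hr.
have zI : ~ @intervalC R z by move=> zI; apply: pS; exists z.
case: ifPn => [zs|]; last exact: fF.
apply: (@cvg_lim _ hC).
have cFp : {for z, continuous (fun x => F (phi w (Some x)))}.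
  have h1 := phi_continuous_some hw zI.
  exact: (continuous_cvg _ (cF _ (phi_lt1_some hw zI)) h1).
have h : (fun x => F (phi w (Some x))) @ z^' --> F (phi w (Some z)).
  exact: cvg_trans (cvg_app _ (@nbhs_dnbhs _ z)) cFp.
apply: cvg_trans h; apply: near_eq_cvg.
have hI : \forall x \near z^', ~ @intervalC R x.
  by apply: nbhs_dnbhs; apply: open_nbhs_nbhs; split => //; exact: open_intervalC.
apply: filterS2 hI (dnbhs_notin s z) => x xI xs.
by rewrite fF.
Qed.

Lemma phi_cmod_continuous (p : Cb) : @slit_sphere R p ->
  {for p, continuous (fun q : Cb => cmod (phi w q))}.
Proof.
move=> pS; apply/(@cvgrPdist_lt _ _ _ (nbhs p) (@nbhs_filter _ p)) => e e0; case: p pS => [z|] pS.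
  have zI : ~ @intervalC R z by move=> zI; apply: pS; exists z.
  have h1 : {for z, continuous (fun z => cmod (phi w (Some z)))}.
    exact: (continuous_cvg _ (@cmod_continuous R _) (phi_continuous_some hw zI)).
  by move/cvgrPdist_lt : h1 => /(_ e e0).
have [r Hr] := phi_small_far hw e0.
have := nbhs_infty (Num.max 1 r).
apply: (@filterS _ (nbhs (None : Cb)) (@nbhs_filter _ (None : Cb))) => -[z|_].
  move=> /=; rewrite gt_max => /andP[h1 h2] /=; rewrite cmod0 sub0r normrN ger0_norm ?cmod_ge0//.
  by apply: Hr => //; exact: far_intervalC.
by rewrite /= subrr normr0.
Qed.

(** [|phi|] is continuous and less than [1] off the slit, infinity included, hence attains its
    maximum on a compact set. Locally uniform convergence there reduces to uniform convergence on
    disks of radius [r < 1]. *)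
Lemma compact_phi_bound (S : set Cb) : compact S -> S `<=` @slit_sphere R ->
  exists r : R, [/\ 0 <= r, r < 1 & forall p, S p -> cmod (phi w p) <= r].
Proof.
move=> cS SS; have [->|/set0P S0] := eqVneq S set0; first by exists 0; split => //; rewrite ltr01.
have cc : {within S, continuous (fun q : Cb => cmod (phi w q))}.
  apply/subspace_continuousP => p Sp; apply: cvg_within_filter.
  by apply: phi_cmod_continuous; exact: SS.
have [c cS' Hc] := compact_EVT_max S0 cS cc.
exists (cmod (phi w c)); split; first exact: cmod_ge0.
  by apply: phi_lt1 => //; apply: SS; rewrite inE in cS'.
by move=> p Sp; apply: Hc; rewrite inE.
Qed.

End RiemannSphere.


(** * The two expressions of the theorem in the disk variable *)

Section Identification.
Variable R : realType.
Local Notation C := (Cplx R).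
Local Notation Cb := (Cbar R).
Local Notation A := (@arcsine R).
Local Notation I := (`[(-1)%R, 1%R]%classic : set R).
Local Notation cp := (map_poly (@toC R)).
Implicit Types (z u : C) (a : seq Cb) (bs : seq C) (f h v : R -> R) (p tau : {poly R}).

Lemma schwarz_continuous f u : intg A f -> cmod u < 1 -> {for u, continuous (schwarz f)}.
Proof.
move=> fi u1; pose r := (1 + cmod u) / 2.
have r1 : r < 1 by rewrite /r; lra.
have ur : cmod u <= r by rewrite /r; lra.
pose L := 4 / (1 - r) ^+ 2 * rint A (fun x => `|f x|).
have L0 : 0 <= L.
  by rewrite mulr_ge0//; [rewrite divr_ge0 ?sqr_ge0|apply: rint_ge0].
apply/ccontinuous_atP => e e0; exists (Num.min ((1 - cmod u) / 2) (e / (L + 1))).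
  by rewrite lt_min !divr_gt0 ?subr_gt0//; lra.
have L1 : 0 < L + 1 by lra.
move=> y; rewrite lt_min (ltr_pdivlMr _ _ L1) => /andP[h1 h2].
have yr : cmod y <= r.
  by have := cmodD (y - u) u; rewrite subrK /r; lra.
apply: le_lt_trans (schwarz_lip fi yr ur r1) _; rewrite -/L.
have := cmod_ge0 (y - u); lra.
Qed.

Lemma chorner_continuous (q : {poly C}) u : {for u, continuous (fun z => q.[z])}.
Proof.
elim/poly_ind: q => [|q c IH].
  have -> : (fun z => (0 : {poly C}).[z]) = fun=> 0 by apply/funext => z; rewrite horner0.
  exact: cst_continuous.
have -> : (fun z => (q * 'X + c%:P).[z]) = fun z => q.[z] * z + c.
  by apply/funext => z; rewrite hornerMXaddC.
have ci : {for u, continuous (fun z : C => z)} by exact: cvg_id.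
exact: (cvgD (cvgM IH ci) (cvg_cst c)).
Qed.

Lemma bden_continuous bs u : {for u, continuous (bden bs)}.
Proof.
have -> : bden bs = horner (\prod_(b <- bs) (1 - b *: 'X)).
  apply/funext => z; rewrite horner_prod; apply: eq_bigr => b _.
  by rewrite !hornerE.
exact: chorner_continuous.
Qed.

Lemma szego_ratio_continuous f n bs (kap : R) p u : intg A f -> in_disk bs -> cmod u < 1 ->
  {for u, continuous (szego_ratio f n bs kap p)}.
Proof.
move=> fi db u1.
have c1 : {for u, continuous (fun z => cexp (schwarz f z))}.
  exact: (continuous_cvg _ (@cexp_continuous R _) (schwarz_continuous fi u1)).
have c2 : {for u, continuous (fun z => (cp (reciprocal n p)).[z])} by exact: chorner_continuous.
have c3 := @bden_continuous bs u.
have c4 : {for u, continuous (fun z => bden bs z * bden bs z)} by exact: (cvgM c3 c3).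
have d0 : bden bs u * bden bs u != 0 by rewrite mulf_neq0// bden_neq0// ltW.
have c0 : {for u, continuous (fun _ : C => toC (2 * kap))} by exact: cst_continuous.
have c5 : {for u, continuous (fun z => (bden bs z * bden bs z)^-1)} by exact: (cvgV d0 c4).
have -> : szego_ratio f n bs kap p = fun z => toC (2 * kap) * cexp (schwarz f z) *
    ((cp (reciprocal n p)).[z] * (cp (reciprocal n p)).[z]) * (bden bs z * bden bs z)^-1.
  by apply/funext => z; rewrite /szego_ratio !expr2.
exact: (cvgM (cvgM (cvgM c0 c1) (cvgM c2 c2)) c5).
Qed.

Variable w : C -> C.
Hypothesis hw : is_w w.

Lemma szego_some h v z : intg A (fun x => h x + ln (v x)) -> ~ @intervalC R z ->
  szego w h v (Some z) ^+ 2 = cexp (schwarz (fun x => h x + ln (v x)) (phi w (Some z))).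
Proof.
move=> fi zI; rewrite /szego /by_continuity in_nil (szego_exponent hw fi zI).
by rewrite -cexpMn; congr cexp; rewrite -mulr_natr; field.
Qed.

Lemma szego_infty h v : intg A (fun x => h x + ln (v x)) ->
  szego w h v None ^+ 2 = cexp (schwarz (fun x => h x + ln (v x)) 0).
Proof.
move=> fi; set f := fun x => _.
rewrite /szego (by_continuity_eq hw (F := fun z => cexp (schwarz f z / 2))).
- by rewrite -cexpMn; congr cexp; rewrite -mulr_natr; field.
- move=> u u1; have c1 := schwarz_continuous fi u1.
  have c2 : {for u, continuous (fun z => schwarz f z / 2)}.
    by exact: (cvgM c1 (cvg_cst _)).
  exact: (continuous_cvg _ (@cexp_continuous R _) c2).
- by move=> z zI _; rewrite (szego_exponent hw fi zI).
- by move=> [z _].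
Qed.

Definition disk_points a : seq C := map (phi w) a.

Definition iunit : C := Complex 0 1.
(** The point [i] of the circle lies above [0], where [tau] equals [1], so this is the constant of
    proportionality between [|D|^2] and [tau]. *)
Definition dnorm bs : R := cmod (bden bs iunit) ^+ 2.

Lemma cmod_iunit : cmod iunit = 1.
Proof. by rewrite cmodE /= expr0n expr1n add0r sqrtr1. Qed.

Variables (n : nat) (tau : {poly R}) (a : seq Cb).
Hypothesis den : denominator n tau a.
Hypothesis sa : size a = (2 * n)%N.
Local Notation bs := (disk_points a).
Local Notation kap := (dnorm bs).

Lemma disk_points_in_disk : in_disk bs.
Proof.
have [_ _ _ [aS _ _]] := den; apply/allP => b /mapP[q qa ->].
by apply: phi_lt1 => //; exact: aS.
Qed.

Lemma disk_points_conj_sym : conj_sym bs.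
Proof.
have [_ _ _ [aS ac _]] := den; rewrite /conj_sym.
have -> : map (@Num.conj C) bs = map (phi w) (map (omap (@Num.conj C)) a).
  rewrite -!map_comp; apply/eq_in_map => -[z|] qa /=; last by rewrite conjC0.
  rewrite -[LHS]/((phi w (Some z))^*) -(phi_conj hw)// => zI.
  by apply: (aS _ qa); exists z.
exact: perm_map.
Qed.

Lemma toC_dnorm : toC kap = \prod_(b <- bs) (1 + b ^+ 2).
Proof.
have i2 : iunit * iunit = -1.
  by apply: complex_ext => /=; rewrite ?mulr0 ?mul0r ?mulr1 ?add0r ?sub0r ?oppr0.
rewrite /dnorm -mul_conj -bden_conj; last exact: disk_points_conj_sym.
have -> : iunit^* = - iunit by apply: complex_ext => /=; rewrite ?oppr0.
rewrite /bden -big_split; apply: eq_bigr => b _ /=.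
have -> : (1 - b * iunit) * (1 - b * - iunit) = 1 - b ^+ 2 * (iunit * iunit) by ring.
by rewrite i2 mulrN1 opprK.
Qed.

Lemma dnorm_gt0 : 0 < kap.
Proof.
rewrite /dnorm exprn_gt0// cmod_gt0 bden_neq0 ?cmod_iunit//.
exact: disk_points_in_disk.
Qed.

(** Factor by factor: if [c = (1 + b^2) / (2 b)] and [x = (z + 1/z) / 2], then [(1 + b^2) (1 - x /
    c) = (1 - b z) (1 - b / z)]. A point at infinity has [b = 0] and contributes [1] to both
    sides. *)
Lemma tau_bden z : z != 0 ->
  (cp tau).[(z + z^-1) / 2] * toC kap = bden bs z * bden bs z^-1.
Proof.
move=> z0; have [_ _ _ [aS _ ->]] := den.
rewrite toC_dnorm /bden /disk_points !big_map horner_prod -!big_split.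
apply: eq_big_seq => -[c|] qa; rewrite !hornerE /=; last by rewrite expr0n /= !subr0 addr0.
have cI : ~ @intervalC R c by move=> cI; apply: (aS _ qa); exists c.
have c0 : c != 0.
  by apply/eqP => E; apply: cI; rewrite E; apply: intervalC_Re => //=; rewrite normr0.
have E := phi_joukowski hw cI; have b0 := phi_neq0 hw cI; move: E b0.
rewrite -[c - w c]/(phi w (Some c)); move: (phi w (Some c)) => b E b0.
have cE : c = (1 + b ^+ 2) / (2 * b) by rewrite E; field.
have b2 : 1 + b ^+ 2 != 0 by apply: contra_neq c0 => h; rewrite cE h mul0r.
by rewrite cE; field; rewrite b2 b0 z0.
Qed.

Lemma denominator_admissible : admissible n bs kap tau.
Proof.
split; [exact: disk_points_in_disk|exact: disk_points_conj_sym|by rewrite size_map| |].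
  exact: dnorm_gt0.
move=> z z1; apply: (@toC_inj R); rewrite -mul_conj (rmorphM (@toC R)) /= -(horner_cp_toC tau).
rewrite -(bden_conj _ disk_points_conj_sym) conj_circle// -tau_bden ?circle_neq0//.
congr (_.[_] * _); rewrite -conj_circle//.
apply: complex_ext; rewrite -(rmorph_nat (@toC R) 2) -fmorphV ?ReM ?ImM ReD ImD conjCE /=.
  by field.
by rewrite subrr !mulr0 !mul0r addr0.
Qed.

(** The zeros of the Blaschke product cancel those of [tau], since [D(1/b)] is a power of [b] times
    [prod (b - b_j)], where [b = phi z]. What remains is the square of [D] in the denominator,
    without singularities in the disk. *)
Lemma asymptotic_lhsE h v p (P : Cb) : (size p <= n.+1)%N ->
  intg A (fun x => h x + ln (v x)) -> @slit_sphere R P ->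
  asymptotic_lhs w h v tau p a P =
  szego_ratio (fun x => h x + ln (v x)) n bs kap p (phi w P).
Proof.
move=> sp fi PS; set f := fun x => _.
apply: (by_continuity_eq hw (F := szego_ratio f n bs kap p) _ _ PS).
  by move=> u u1; apply: szego_ratio_continuous => //; exact: disk_points_in_disk.
move=> z zI za; rewrite szego_some//.
have db := disk_points_in_disk; have sb := disk_points_conj_sym.
have b1 := phi_lt1_some hw zI; have b0 := phi_neq0 hw zI; have zE := phi_joukowski hw zI.
set b := phi w (Some z) in b1 b0 zE *.
have D0 : bden bs b != 0 by rewrite bden_neq0// ltW.
have -> : \prod_(c <- a) ((b - phi w c) / (1 - (phi w c)^* * b)) =
    (\prod_(c <- bs) (b - c)) / bden bs b.
  by rewrite -(blaschkeE _ sb) /blaschke big_map.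
(* A factor vanishes only when [z] is a listed point, because [z] is recovered from [phi z]. *)
have N0 : \prod_(c <- bs) (b - c) != 0.
  rewrite big_map prodf_seq_neq0; apply/allP => -[c|] ca /=; last by rewrite subr0.
  have cI : ~ @intervalC R c.
    by have [_ _ _ [aS _ _]] := den => cI; apply: (aS _ ca); exists c.
  apply/eqP => /subr0_eq E; move: za; rewrite zE.
  have -> : b = phi w (Some c) by exact: E.
  by rewrite -(phi_joukowski hw cI) ca.
have DV : bden bs b^-1 = b ^- (2 * n) * \prod_(c <- bs) (b - c).
  rewrite -sa -(size_map (phi w)) -/(disk_points a) /bden.
  elim: (bs) => [|c s IH]; first by rewrite !big_nil expr0 invr1 mulr1.
  by rewrite !big_cons IH /= exprS; field; rewrite b0 expf_neq0.
have k0 : toC kap != 0 by rewrite fmorph_eq0 lt0r_neq0// dnorm_gt0.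
have tE : (cp tau).[z] = bden bs b * bden bs b^-1 / toC kap.
  by rewrite -(tau_bden b0) -zE mulfK.
have E2 : toC (2 * kap) = 2 * toC kap.
  by rewrite -(rmorph_nat (@toC R) 2) -(rmorphM (@toC R)).
have pE : (cp p).[z] = (cp (reciprocal n p)).[b] / b ^+ n.
  by rewrite (reciprocalE sp b0) -zE mulrC mulKf// expf_neq0.
rewrite /szego_ratio tE pE DV mul2n -addnn exprD E2.
have bn0 : b ^+ n != 0 by rewrite expf_neq0.
rewrite -/f; move: (cexp (schwarz f b)) (b ^+ n) bn0 (toC kap) k0 (bden bs b) D0
  (\prod_(c <- _) _) N0 => X y y0 k kn0 D Dn0 N Nn0.
by field; rewrite kn0 y0 Dn0 Nn0.
Qed.

(** Each finite point contributes [2 c phi(c) = 1 + b^2] and each infinite one the factor [1] to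
    [kap]. *)
Lemma leading_lhsE h v p : size p = n.+1 -> intg A (fun x => h x + ln (v x)) ->
  leading_lhs n w h v p a = szego_ratio (fun x => h x + ln (v x)) n bs kap p 0.
Proof.
move=> sp fi; set f := fun x => _.
have E2 : toC (2 * kap) = 2 * toC kap.
  by rewrite -(rmorph_nat (@toC R) 2) -(rmorphM (@toC R)).
rewrite /leading_lhs szego_infty// -/f /szego_ratio.
have -> : bden bs 0 = 1 by rewrite /bden big1// => b _; rewrite mulr0 subr0.
rewrite -[X in (cp _).[X]](rmorph0 (@toC R)) horner_cp_toC reciprocal0 lead_coefE sp.
rewrite expr1n divr1 E2 toC_dnorm.
have -> : \prod_(c <- pmap id a) (2 * c * phi w (Some c)) = \prod_(b <- bs) (1 + b ^+ 2).
  have [_ _ _ [aS _ _]] := den; rewrite big_map; elim: (a) aS => [|[c|] s IH] aS /=.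
  - by rewrite !big_nil.
  - rewrite !big_cons IH; last by move=> b bs'; apply: aS; rewrite in_cons bs' orbT.
    congr (_ * _).
    have cI : ~ @intervalC R c by move=> cI; apply: (aS (Some c)); rewrite ?mem_head//; exists c.
    have E := phi_joukowski hw cI; have b0 := phi_neq0 hw cI.
    by rewrite -[c - w c]/(phi w (Some c)) {1}E; field.
  - rewrite big_cons IH; last by move=> b bs'; apply: aS; rewrite in_cons bs' orbT.
    by rewrite /= expr0n addr0 mul1r.
rewrite (fmorph_div (@toC R)) (rmorphXn (@toC R)) /= !(rmorph_nat (@toC R)).
have -> : (2 : C) ^ (1 - (2 * n)%:Z) = 2 / (2 ^+ n) ^+ 2.
  rewrite exprzDr ?unitfE ?pnatr_eq0// -exprnN expr1z -exprM mulnC.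
  by [].
have t0 : (2 : C) ^+ n != 0 by rewrite expf_neq0// pnatr_eq0.
by field.
Qed.

Lemma deficit_disk_points : deficit bs = \sum_(b <- a) (1 - cmod (phi w b)).
Proof. by rewrite /deficit big_map. Qed.

End Identification.


(** * Passage to the limit and uniformity over the compact set *)

Section Limit.
Variable R : realType.
Local Notation C := (Cplx R).
Local Notation Cb := (Cbar R).
Local Notation A := (@arcsine R).
Local Notation I := (`[(-1)%R, 1%R]%classic : set R).
Local Notation cp := (map_poly (@toC R)).

Lemma limn_esup_lt_near (u : nat -> \bar R) (c : \bar R) : (limn_esup u < c)%E ->
  \forall n \near \oo, (u n < c)%E.
Proof.
move=> /ereal_inf_lt[y [V Voo <-]] yc; apply: filterS Voo => n Vn.
by apply: le_lt_trans yc; apply: ereal_sup_ubound; exists n.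
Qed.

Lemma Lnorm1_rint_near (vt : nat -> R -> R) (v : R -> R) (e : R) :
  (forall n, (0 < n)%N -> log_integrable A (vt n)) -> log_integrable A v ->
  ('N[A]_1[EFin \o (fun x => (ln (vt n x) - ln (v x))%R)])%E @[n --> \oo] --> 0%E ->
  0 < e -> \forall n \near \oo, rint A (fun x => `|ln (vt n x) - ln (v x)|) < e.
Proof.
move=> hvt hv /fine_cvgP[hfin /cvgrPdist_lt /(_ e)] + e0 => /(_ e0) hlt.
near=> n; have n0 : (0 < n)%N by near: n; exact: nbhs_infty_gt.
have [_ i1] := hvt n n0; have [_ i2] := hv.
have di : intg A (fun x => ln (vt n x) - ln (v x)).
  by apply: intgB; apply: log_integrable_intg => //; exact: hvt.
rewrite -lte_fin (rintE (intg_norm di)).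
have fn : ('N[A]_1[EFin \o (fun x => (ln (vt n x) - ln (v x))%R)] \is a fin_num)%E.
  by near: n.
apply: (@le_lt_trans _ _ ('N[A]_1[EFin \o (fun x => (ln (vt n x) - ln (v x))%R)])%E).
  rewrite Lnorm1; pose F x := (`|ln (vt n x) - ln (v x)|%:E : \bar R).
  apply: (@ge0_subset_integral _ _ _ A I setT (@measI R) measurableT F) => //; last first.
    by move=> x _; rewrite /F lee_fin.
  have /integrableP[mi _] := integrableB measurableT i1 i2.
  exact: (measurableT_comp (@abse_measurable R setT) mi).
rewrite -(fineK fn) lte_fin; apply: le_lt_trans (ler_norm _) _.
by rewrite -normrN -sub0r; near: n.
Unshelve. all: by end_near. Qed.

(** To first order the left side of the hypothesis is [1 - d / 20], while [x < 1 - d] would keep the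
    right side under [1 - 3 d / 2]. *)
Lemma ge_of_sqr_ge (d x : R) : 0 < d -> d <= 1 -> 0 <= x ->
  (1 - d / 40) ^+ 2 <= x ^+ 2 * (1 + d / 2) -> 1 - d <= x.
Proof.
move=> d0 d1 x0 h; rewrite leNgt; apply/negP => /ltW xd.
have h1 : x ^+ 2 <= (1 - d) ^+ 2 by rewrite lerXn2r ?nnegrE//; lra.
have h2 : x ^+ 2 * (1 + d / 2) <= (1 - d) ^+ 2 * (1 + d / 2) by apply: ler_wpM2r => //; lra.
have h3 : 0 < d * d by rewrite mulr_gt0.
have h4 : d * d * d <= d * d by rewrite ler_piMr// mulr_ge0// ltW.
have h5 : d * d <= d by rewrite ler_piMr// ltW.
move: h h2; rewrite !expr2; lra.
Qed.

Lemma shifted_envelope (ep a b c u : R) : `|a - b| < ep -> `|a + c + 2 * ep - u| <= ep ->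
  b + c <= u /\ `|u - b - c| <= 4 * ep.
Proof.
rewrite ltr_norml !ler_norml => /andP[? ?] /andP[? ?]; split; first lra.
by apply/andP; split; lra.
Qed.

Variables (mut : nat -> {finite_measure set R -> \bar R})
  (mu : {finite_measure set R -> \bar R}) (vt : nat -> R -> R) (v : R -> R)
  (K : set (R -> R)) (tau : nat -> {poly R}) (bs : nat -> seq C) (kap : nat -> R).
Hypotheses
  (adm : forall n, (0 < n)%N -> admissible n (bs n) (kap n) (tau n))
  (hA : forall f : R -> R, {within `[-1, 1], continuous f} ->
     (forall x, x \in `[-1, 1] -> 0 <= f x) ->
     (limn_esup (fun n => \int[mut n]_(x in `[(-1)%R, 1%R]) (f x)%:E)
        <= \int[mu]_(x in `[(-1)%R, 1%R]) (f x)%:E)%E)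
  (hvt : forall n, (0 < n)%N ->
     ac_density (mut n) (@arcsine R) (vt n) /\
     log_integrable (@arcsine R) (vt n))
  (hv : ac_density mu (@arcsine R) v /\ log_integrable (@arcsine R) v)
  (hB : ('N[@arcsine R]_1[EFin \o (fun x => (ln (vt n x) - ln (v x))%R)])%E
          @[n --> \oo] --> 0%E)
  (hKcont : forall h : R -> R, K h -> {within `[-1, 1], continuous h})
  (hKcompact : @compact {uniform` `[-1, 1]%classic -> R} K)
  (hD : deficit (bs n) @[n --> \oo] --> +oo).

(** [V] is fixed first, so (A) is applied to the single function [e^(- V)]. The rest is done near
    one [h0] of [K], with [U] and both thresholds chosen for it; the covering form of compactness
    then gives one range of [n] for all of [K]. *)
Lemma szego_ratio_limit (r e : R) : 0 <= r -> r < 1 -> 0 < e ->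
  \forall n \near \oo, forall (h : R -> R) (p : {poly R}),
    K h -> orthonormal_poly n (mut n) h (tau n) p ->
    forall z, cmod z <= r ->
    cmod (szego_ratio (fun x => h x + ln (vt n x)) n (bs n) (kap n) p z - 1) <= e.
Proof.
move=> r0 r1 e0; have [d0 d00 Hd] := asymptotic_core r0 r1 e0.
pose d := Num.min d0 1.
have dp : 0 < d by rewrite lt_min d00 ltr01.
have dd0 : d <= d0 by rewrite ge_min lexx.
have d1 : d <= 1 by rewrite ge_min lexx orbT.
(* With [eta = d / 40] the error in the lower bound becomes [10 eta + 16 (2 ep) = d / 2]; moreover
   [4 ep + 2 ep <= d]. *)
pose ep := d / 128; have ep0 : 0 < ep by rewrite divr_gt0.
have [mv lv] := hv.
have [V [V1 V2]] := exists_log_weight mv lv ep0.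
have cV : {within `[-1, 1], continuous (fun x : R => expR (- V.[x]))}.
  apply: continuous_subspaceT => x.
  apply: (@continuous_comp _ _ _ (fun x => - V.[x]) expR); last exact: continuous_expR.
  exact: (cvgN (@continuous_horner R V x)).
have hV : \forall n \near \oo, rint (mut n) (fun x => expR (- V.[x])) <= 1 + 2 * ep.
  have iV (m : {finite_measure set R -> \bar R}) := intg_cont (finite_measI m) cV.
  have h := hA cV (fun x _ => expR_ge0 _).
  have h1 : (limn_esup (fun n => \int[mut n]_(x in `[(-1)%R, 1%R]) (expR (- V.[x]))%:E) <
      (1 + 2 * ep)%:E)%E.
    apply: le_lt_trans h _; rewrite -(rintE (iV mu)) lte_fin.
    by apply: le_lt_trans V1 _; rewrite ltrD2l; lra.
  apply: filterS (limn_esup_lt_near h1) => n.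
  by rewrite -(rintE (iV (mut n))) lte_fin => /ltW.
have hL : \forall n \near \oo, rint A (fun x => `|ln (vt n x) - V.[x]|) <= 2 * ep.
  have h := Lnorm1_rint_near (fun n n0 => (hvt n0).2) lv hB ep0.
  near=> n; have n0 : (0 < n)%N by near: n; exact: nbhs_infty_gt.
  have i1 := log_integrable_intg (hvt n0).2; have i2 := log_integrable_intg lv.
  have := L1_dist i1 i2 (intg_poly (arcsine_fin R) V).
  have h2 : rint A (fun x => `|ln (vt n x) - ln (v x)|) < ep by near: n.
  by move=> h3; lra.
pose P n (h : R -> R) := forall p : {poly R},
    K h -> orthonormal_poly n (mut n) h (tau n) p ->
    forall z, cmod z <= r ->
    cmod (szego_ratio (fun x => h x + ln (vt n x)) n (bs n) (kap n) p z - 1) <= e.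
suff H : \forall n \near \oo, K `<=` P n.
  by apply: filterS H => n Hn h p Kh; apply: (Hn h Kh).
have /compact_near_coveringP cK := hKcompact.
apply: cK => h0 Kh0.
have ch0 := hKcont Kh0.
(* Raising by [2 ep] leaves room for the error [ep] of [U] and the radius [ep] of the neighbourhood
   of [h0]: every [h] in it satisfies [h + V <= U <= h + V + 4 ep]. *)
have cg : {within `[-1, 1], continuous (fun x => h0 x + V.[x] + 2 * ep)}.
  move/subspace_continuousP : ch0 => ch0; apply/subspace_continuousP => x xI.
  apply: cvgD; last exact: cvg_cst.
  apply: cvgD; first exact: ch0.
  by apply: cvg_within_filter; exact: continuous_horner.
have [U HU] := weierstrass cg ep0.
have [g Ug] := half_analytic_circle U.
have eta0 : 0 < d / 40 by rewrite divr_gt0.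
have eta1 : d / 40 <= 1 by lra.
have [T1 HT1] := lower_bound V Ug eta0 eta1.
have [T2 HT2] := Hd U g Ug.
have nb : nbhs (h0 : {uniform` `[-1, 1]%classic -> R})
    [set h : R -> R | forall x, I x -> `|h0 x - h x| < ep].
  apply/uniform_nbhs; exists [set xy : R * R | ball xy.1 ep xy.2]; split => //.
  exact: (entourage_ball _ (PosNum ep0)).
have nn : \forall n \near \oo, [/\ (0 < n)%N, T1 <= deficit (bs n), T2 <= deficit (bs n),
    rint (mut n) (fun x => expR (- V.[x])) <= 1 + 2 * ep &
    rint A (fun x => `|ln (vt n x) - V.[x]|) <= 2 * ep].
  move/cvgryPge : hD => hD'.
  near=> n; split; near: n; [exact: nbhs_infty_gt|exact: hD'|exact: hD'|exact: hV|exact: hL].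
exists ([set h : R -> R | forall x, I x -> `|h0 x - h x| < ep],
  [set n | [/\ (0 < n)%N, T1 <= deficit (bs n), T2 <= deficit (bs n),
    rint (mut n) (fun x => expR (- V.[x])) <= 1 + 2 * ep &
    rint A (fun x => `|ln (vt n x) - V.[x]|) <= 2 * ep]]); first by split.
move=> [h n] /= [hh [n0 D1 D2 mV AV]] p Kh op z zr.
have ch := hKcont Kh; have [mvt lvt] := hvt n0.
have hUV x : I x -> h x + V.[x] <= U.[x] /\ `|U.[x] - h x - V.[x]| <= 4 * ep.
  by move=> xI; exact: shifted_envelope (hh x xI) (HU x xI).
have lb := HT1 n (bs n) (kap n) (tau n) (mut n) (vt n) h p (2 * ep) n0 (adm n0) D1 mvt lvt ch
  (fun x xI => (hUV x xI).1) mV AV op.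
apply: (HT2 n (bs n) (kap n) (tau n) (mut n) (vt n) h p (adm n0) D2 mvt lvt ch op) => //.
  apply: (@le_trans _ _ (rint A (fun x => 4 * ep + `|ln (vt n x) - V.[x]|))).
    have i1 := log_integrable_intg lvt.
    have i2 : intg A (fun x => ln (vt n x) - V.[x]).
      by apply: intgB => //; exact: (intg_poly (arcsine_fin R)).
    have ih : intg A h := intg_cont (arcsine_fin R) ch.
    apply: le_rint.
    - apply: intg_norm; apply: intgB; first exact: (intg_poly (arcsine_fin R)).
      exact: intgD.
    - by apply: intgD; [exact: (intg_cst (arcsine_fin R))|exact: intg_norm].
    - move=> x xI; have [_ u2] := hUV x xI.
      have -> : U.[x] - (h x + ln (vt n x)) = (U.[x] - h x - V.[x]) - (ln (vt n x) - V.[x]) by ring.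
      by apply: le_trans (ler_normB _ _) _; rewrite lerD2r.
  rewrite rintD; [|exact: (intg_cst (arcsine_fin R))|apply: intg_norm; apply: intgB].
  - rewrite rint_arcsine_cst; apply: le_trans (lerD (lexx _) AV) _; apply: le_trans _ dd0.
    by rewrite /ep; lra.
  - exact: log_integrable_intg.
  - exact: (intg_poly (arcsine_fin R)).
have g0 : 0 <= gamma0 g n (kap n) p.
  have [_ lp _ _] := op.
  by rewrite /gamma0 !mulr_ge0 ?sqrtr_ge0 ?expR_ge0// ltW// divr_gt0// exprn_gt0.
have sE : 1 + 10 * (d / 40) + 16 * (2 * ep) = 1 + d / 2 by rewrite /ep; field.
rewrite sE in lb; apply: le_trans (ge_of_sqr_ge dp d1 g0 lb).
by rewrite lerB.
Unshelve. all: by end_near. Qed.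

End Limit.


(** * The asymptotic formulas on the sphere and at infinity *)

Theorem theorem2p2 (R : realType) (w : Cplx R -> Cplx R)
  (mut : nat -> {finite_measure set R -> \bar R})
  (mu : {finite_measure set R -> \bar R})
  (vt : nat -> R -> R) (v : R -> R)
  (K : set (R -> R))
  (tau : nat -> {poly R}) (a : forall n, (2 * n).-tuple (Cbar R))
  (hw : is_w w)
  (hmut : forall n, (0 < n)%N -> on_interval (mut n))
  (hmu : on_interval mu)
  (htau : forall n, (0 < n)%N -> denominator n (tau n) (a n))
  (hA : forall f : R -> R, {within `[-1, 1], continuous f} ->
     (forall x, x \in `[-1, 1] -> 0 <= f x) ->
     (limn_esup (fun n => \int[mut n]_(x in `[(-1)%R, 1%R]) (f x)%:E)
        <= \int[mu]_(x in `[(-1)%R, 1%R]) (f x)%:E)%E)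
  (hvt : forall n, (0 < n)%N ->
     ac_density (mut n) (@arcsine R) (vt n) /\
     log_integrable (@arcsine R) (vt n))
  (hv : ac_density mu (@arcsine R) v /\ log_integrable (@arcsine R) v)
  (hB : ('N[@arcsine R]_1[EFin \o (fun x => (ln (vt n x) - ln (v x))%R)])%E
          @[n --> \oo] --> 0%E)
  (hKcont : forall h : R -> R, K h -> {within `[-1, 1], continuous h})
  (hKcompact : @compact {uniform` `[-1, 1]%classic -> R} K)
  (hD : (\sum_(b <- a n) (1 - cmod (phi w b))) @[n --> \oo] --> +oo) :
  (forall S : set (Cbar R), compact S -> S `<=` @slit_sphere R ->
     forall eps : R, 0 < eps ->
     \forall n \near \oo, forall (h : R -> R) (p : {poly R}),
       K h -> orthonormal_poly n (mut n) h (tau n) p ->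
       forall z, S z ->
         cmod (asymptotic_lhs w h (vt n) (tau n) p (a n) z - 1) < eps)
  /\
  (forall eps : R, 0 < eps ->
     \forall n \near \oo, forall (h : R -> R) (p : {poly R}),
       K h -> orthonormal_poly n (mut n) h (tau n) p ->
         cmod (leading_lhs n w h (vt n) p (a n) - 1) < eps).
Proof.
pose bs n := disk_points w (a n); pose kap n := dnorm (bs n).
have sa n : size (a n) = (2 * n)%N by rewrite size_tuple.
have adm n : (0 < n)%N -> admissible n (bs n) (kap n) (tau n).
  by move=> n0; exact: (denominator_admissible hw (htau n n0) (sa n)).
have defE n : deficit (bs n) = \sum_(b <- a n) (1 - cmod (phi w b)).
  exact: deficit_disk_points.
have hD' : deficit (bs n) @[n --> \oo] --> +oo.
  by under eq_fun do rewrite defE.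
have lim r e r0 r1 e0 :=
  @szego_ratio_limit R mut mu vt v K tau bs kap adm hA hvt hv hB hKcont hKcompact hD' r e r0 r1 e0.
have fi n h : (0 < n)%N -> K h ->
    intg (@arcsine R) (fun x => h x + ln (vt n x)).
  move=> n0 Kh; apply: intgD; first exact: (intg_cont (arcsine_fin R) (hKcont h Kh)).
  exact: log_integrable_intg (hvt n n0).2.
(* Both conclusions are instances of the limit in the disk: on [|zeta| <= r], with [r] given by the
   compact set, and at [zeta = 0]. *)
split=> [S cS SS e e0|e e0].
  have e20 : 0 < e / 2 by rewrite divr_gt0.
  have [r [r0 r1 Hr]] := compact_phi_bound hw cS SS.
  near=> n => h p Kh op z Sz.
  have n0 : (0 < n)%N by near: n; exact: nbhs_infty_gt.
  have sp : (size p <= n.+1)%N by case: op => ->.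
  rewrite (asymptotic_lhsE hw (htau n n0) (sa n) sp (fi n h n0 Kh) (SS z Sz)).
  apply: (@le_lt_trans _ _ (e / 2)); last lra.
  move: h p Kh op z Sz {sp}; near: n; apply: filterS (lim r (e / 2) r0 r1 e20).
  by move=> n Hn h p Kh op z Sz; apply: Hn => //; exact: Hr.
have e20 : 0 < e / 2 by rewrite divr_gt0.
near=> n => h p Kh op.
have n0 : (0 < n)%N by near: n; exact: nbhs_infty_gt.
have sp : size p = n.+1 by case: op.
rewrite (leading_lhsE hw (htau n n0) sp (fi n h n0 Kh)).
apply: (@le_lt_trans _ _ (e / 2)); last lra.
move: h p Kh op {sp}; near: n; apply: filterS (lim 0 (e / 2) (lexx 0) ltr01 e20).
by move=> n Hn h p Kh op; apply: Hn => //; rewrite cmod0.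
Unshelve. all: by end_near. Qed.
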